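(* Let $\Delta$ be a positive integer. Then there exist an integer $m_1 = m_1(\Delta)$ and an integer $n_1 = n_1(\Delta, m_1)$ such that the following holds for every $n \geq n_1$ and for every tree $T = (V,E)$ with $|V| = n$ and maximum degree $\Delta(T) \leq \Delta$. If $T$ admits a bare path of length $m_1$, then Maker has a strategy to win the tree embedding game $(E(K_n), \mathcal{T}_n)$ within $n$ moves (of Maker).
   Context: Maker-Breaker game: Let $X$ be a finite set (the board) and $\mathcal{F} \subseteq 2^X$ a family of winning sets. In the Maker-Breaker game $(X, \mathcal{F})$, Maker and Breaker alternately claim one previously unclaimed element of $X$ per move, with Breaker going first. Maker wins as soon as she has claimed all elements of some winning set. ''Maker has a strategy to win within $k$ moves'' means that she has a strategy that, against any strategy of Breaker, ensures that she has fully claimed a winning set after making at most $k$ moves of her own. Tree embedding game: For a tree $T$ on $n$ vertices, the tree embedding game $(E(K_n), \mathcal{T}_n)$ is the Maker-Breaker game whose board is the edge set of the complete graph $K_n$ and whose (minimal) winning sets are the edge sets of all labeled copies of $T$ in $K_n$; so Maker wins as soon as the graph formed by her edges contains a copy of $T$. Bare path: A path of a tree $T$ is called bare if all of its interior vertices (i.e. vertices other than its two endpoints) have degree $2$ in $T$. The length of a path is its number of edges. *)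

(* Defs.v *)
From mathcomp Require Import all_boot.

Set Implicit Arguments.
Unset Strict Implicit.
Unset Printing Implicit Defensive.

Section MakerBreaker.

Variable X : finType.

(* A history lists all moves made so far by both players, oldest first.
   Breaker moves first, so he makes the moves at even positions and Maker
   those at odd positions.  A strategy of either player maps the full history
   to the next move; [None] is allowed only when the board is exhausted. *)
Definition strategy := seq X -> option X.

Definition legal (s : strategy) : Prop :=
  forall h : seq X,
    match s h return Prop with
    | Some x => x \notin h
    | None => forall x, x \in h
    end.

Definition play_step (maker breaker : strategy) (h : seq X) : seq X :=
  if (if odd (size h) then maker h else breaker h) is Some x
  then rcons h x else h.

Definition play (maker breaker : strategy) (t : nat) : seq X :=
  iter t (play_step maker breaker) [::].

Definition maker_claimed (h : seq X) : {set X} :=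
  [set x in h | odd (index x h)].

(* The number of moves Maker has made is the number of elements she has
   claimed, since plays of legal strategies are duplicate-free. *)
Definition maker_wins_within (F : {set {set X}}) (k : nat) : Prop :=
  exists2 maker : strategy, legal maker &
    forall breaker : strategy, legal breaker ->
      exists t : nat,
        #|maker_claimed (play maker breaker t)| <= k /\
        exists2 A : {set X}, A \in F & A \subset maker_claimed (play maker breaker t).

End MakerBreaker.

Section Graphs.

Variables (V : finType) (e : rel V).

Definition simple_graph : Prop := symmetric e /\ irreflexive e.

Definition connected_graph : Prop := 0 < #|V| /\ forall x y, connect e x y.

(* [ucycle e [:: x; y]] holds for every edge xy, hence the size bound. *)
Definition acyclic : Prop := forall c : seq V, 2 < size c -> ~ ucycle e c.

Definition tree : Prop := [/\ simple_graph, connected_graph & acyclic].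

Definition degree (v : V) : nat := #|[set w | e v w]|.

Definition max_degree : nat := \max_(v : V) degree v.

Definition bare_path (x : V) (p : seq V) : Prop :=
  [/\ path e x p, uniq (x :: p) &
      forall v, v \in x :: p -> v != x -> v != last x p -> degree v = 2].

Definition has_bare_path (m : nat) : Prop :=
  exists (x : V) (p : seq V), bare_path x p /\ size p = m.

End Graphs.

Notation complete_edge n := {a : {set 'I_n} | #|a| == 2}.

Definition copy_edges (V : finType) (e : rel V) (n : nat)
    (f : {ffun V -> 'I_n}) : {set complete_edge n} :=
  [set a | [exists u, exists v, e u v && (val a == [set f u; f v])]].

Definition tree_copies (V : finType) (e : rel V) (n : nat) :
    {set {set complete_edge n}} :=
  [set copy_edges e f | f : {ffun V -> 'I_n} & injectiveb f].

(* Main.v *)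
Require Import Defs.
From mathcomp Require Import all_boot.
From mathcomp Require Import zify.

(** Fix a bare path of [T] from [x] to [y] with interior [ip].  Maker builds a
    copy of [T] without [ip], one vertex per move, and then has to run through
    all unused vertices [U], of which there are [size ip], by a path between
    the images of [x] and [y].  Every edge of the first part belongs to the
    copy, and the path needs [#|U| + 1] edges, so Maker can afford one wasted
    move.  The point is that Breaker must not have too many edges in [U] and
    at the images of [x] and [y] when the second part begins: their number is
    bounded in terms of [Delta] alone, whereas [size ip] is as large as
    desired.

    First part.  Call the number of Breaker's edges from the image of an
    embedded vertex into [U] its load.  When Breaker claims an edge between
    the image of [a] and [U], Maker embeds a missing child of [a]; if there is
    none, she embeds a child of another vertex [r], at a vertex which Breaker
    has joined to [a] and not to [r]; if there is none either, the load of [a]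
    is at most that of [r] ([outer_reply]).  So the loads stay bounded.  An
    edge [pq] inside [U] is answered by using [p] or [q] as the image of a
    child of some [r], which is possible unless [r] is joined to both by
    Breaker.  As long as vertices with further descendants are missing, a
    reserve of vertices of load at most 1 makes such a reply possible every
    time, and no Breaker edge remains inside [U] ([growing_win]).  Once only
    leaves are missing, an edge that cannot be answered joins two common
    neighbours of all vertices whose children are still missing; as these have
    bounded load, there is a bounded number of such edges
    ([only_leaves_win]).

    Second part.  The embedded part counts as one path from the image of [x]
    to that of [y], and each unused vertex as a path by itself; Maker links
    these paths up to a cycle.  She pairs up single vertices until few are
    left ([pairing_win]) and attaches those to the ends of longer paths
    ([attach_win]).  Then [K] paths are left, and the number [D] of Breaker's
    edges between ends of different paths, called dirty, exceeds [K] by at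
    most a constant.  Joining two ends removes one path and all dirty edges at
    these ends.  While [D] is not small compared to [K], Maker can remove
    three dirty edges per move, or else break up two of the obstacles to that
    while Breaker creates at most one ([gain3]); so the surplus of [D] over
    [K] shrinks ([many_dirty_win]).  When [D] is less than [K], removing two
    dirty edges per move lets [D] decrease steadily to 0 ([few_dirty_win]).
    At that time Maker invests her spare move in a chord that turns one path
    into a fork, which has a choice between two vertices for its last end
    ([clean_win]).  She then appends all other paths to the first end of the
    fork, so that each of Breaker's edges becomes harmless at once, and
    finally closes the cycle at one of the two last ends, of which Breaker can
    block only one ([forked_win]). *)

Set Implicit Arguments.
Unset Strict Implicit.
Unset Printing Implicit Defensive.

(** * Games on the edges of a complete graph *)

Section EdgeGame.

Variable W : finType.
Implicit Types (M B : {set {set W}}) (e : {set W}) (u v : W).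

Lemma eq_set2P u v x y :
  reflect (u = x /\ v = y \/ u = y /\ v = x) ([set u; v] == [set x; y]).
Proof.
apply: (iffP eqP) => [eq_uv|]; last by case=> -[-> ->] //; rewrite setUC.
have := set21 u v; rewrite eq_uv !inE => /orP[]/eqP ux.
  have := set22 u v; rewrite eq_uv !inE => /orP[]/eqP vy; last by left.
  have := set22 x y; rewrite -eq_uv ux vy !inE orbb => /eqP->.
  by left.
have := set22 u v; rewrite eq_uv !inE => /orP[]/eqP vy; first by right.
have := set21 x y; rewrite -eq_uv ux vy !inE orbb => /eqP->.
by left.
Qed.

(** The board consists of the two-element sets, and [G] is any goal for Maker's
    graph.  Maker may claim one of her own edges again, since a wasted move is
    harmless; so only Breaker's edges are forbidden to her. *)
Fixpoint win (G : {set {set W}} -> Prop) (k : nat) M B : Prop :=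
  G M \/
  if k is k'.+1 then
    forall e, #|e| = 2 ->
      exists e', [/\ #|e'| = 2, e' \notin e |: B & win G k' (e' |: M) (e |: B)]
  else False.

Lemma win_round (G : {set {set W}} -> Prop) k M B :
    (forall p q, p != q -> exists u v,
       [/\ u != v, [set u; v] \notin [set p; q] |: B
         & win G k ([set u; v] |: M) ([set p; q] |: B)]) ->
  win G k.+1 M B.
Proof.
move=> step; right=> e e2; have /cards2P[p [q [pq ->]]] : #|e| == 2 by apply/eqP.
have [u [v [uv uvB winM]]] := step p q pq.
by exists [set u; v]; split=> //; rewrite cards2 uv.
Qed.

End EdgeGame.

(** * From winning positions to strategies *)

Section Strategy.

Variables (X : finType) (F : {set {set X}}) (N : nat).
Implicit Types (M B : {set X}) (h : seq X).

Fixpoint winb (k : nat) M B : bool :=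
  [exists A in F, A \subset M] ||
  (if k is k'.+1 then
     [forall a, exists b, (b \notin a |: B) && winb k' (b |: M) (a |: B)]
   else false).

Lemma winb_mono k M M' B : M \subset M' -> winb k M B -> winb k M' B.
Proof.
elim: k M M' B => [|k IHk] M M' B sMM' /=; rewrite ?orbF.
  case/existsP=> A /andP[AF sAM]; apply/existsP; exists A.
  by rewrite AF (subset_trans sAM).
case/orP=> [/existsP[A /andP[AF sAM]]|/forallP wins]; apply/orP.
  by left; apply/existsP; exists A; rewrite AF (subset_trans sAM).
right; apply/forallP=> a; have /existsP[b /andP[bB winM]] := wins a.
by apply/existsP; exists b; rewrite bB; apply: IHk winM; apply: setUS.
Qed.

Definition breaker_claimed h : {set X} := [set x in h | ~~ odd (index x h)].

Definition free_choice h (P : pred X) : option X :=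
  if [pick b | (b \notin h) && P b] is Some b then Some b else [pick b | b \notin h].

(** Any unclaimed element will do if no unclaimed element leads to a winning
    position: this happens only when [winb] holds because of an element that is
    already Maker's, so that she may waste the move. *)
Definition maker : strategy X := fun h =>
  free_choice h (fun b =>
    winb (N - (size h)./2).-1 (b |: maker_claimed h) (breaker_claimed h)).

Lemma maker_legal : legal maker.
Proof.
move=> h; rewrite /maker /free_choice.
case: pickP => [b /andP[] //|_]; case: pickP => // none x.
by have /negbT := none x; rewrite negbK.
Qed.

Lemma claimed_rcons h x : x \notin h ->
  maker_claimed (rcons h x) =
    (if odd (size h) then x |: maker_claimed h else maker_claimed h) /\
  breaker_claimed (rcons h x) =
    (if odd (size h) then breaker_claimed h else x |: breaker_claimed h).
Proof.
move=> xh; have idx z : index z (rcons h x) = if z \in h then index z h else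
    size h + (z != x).
  rewrite -cats1 index_cat /= [x == z]eq_sym; case: ifP => // _.
  by case: (z == x); rewrite ?addn0 ?addn1.
split; apply/setP=> z; rewrite !inE mem_rcons inE idx.
  have [->|zx] := eqVneq z x; rewrite /= ?addn0.
    by rewrite (negbTE xh); case: (odd _); rewrite !inE ?eqxx // (negbTE xh).
  by case: (odd (size h)); rewrite !inE ?(negbTE zx) /=; case: (z \in h).
have [->|zx] := eqVneq z x; rewrite /= ?addn0.
  by rewrite (negbTE xh); case: (odd _); rewrite !inE ?eqxx // (negbTE xh).
by case: (odd (size h)); rewrite !inE ?(negbTE zx) /=; case: (z \in h).
Qed.

Lemma unclaimed h : size h < #|X| -> exists x, x \notin h.
Proof.
move=> lt; apply/existsP; rewrite -negb_forall; apply: contraTN lt => /forallP all_h.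
rewrite -leqNgt; apply: leq_trans (card_size h).
by apply/subset_leq_card/subsetP=> x _; apply: all_h.
Qed.

(** The bound on [N] ensures that the board is not exhausted before Maker has
    made [N] moves. *)
Lemma winb_strategy : 2 * N <= #|X| -> winb N set0 set0 -> maker_wins_within F N.
Proof.
move=> NX win0; exists maker; first exact: maker_legal.
move=> breaker legB; pose h i := play maker breaker i.*2.
pose won := exists t, #|maker_claimed (play maker breaker t)| <= N /\
  exists2 A, A \in F & A \subset maker_claimed (play maker breaker t).
suff inv i : i <= N -> won \/ [/\ size (h i) = i.*2, #|maker_claimed (h i)| <= i &
    winb (N - i) (maker_claimed (h i)) (breaker_claimed (h i))].
  case: (inv N (leqnn N)) => // -[_ leN]; rewrite subnn /= orbF.
  by case/existsP=> A /andP[AF sA]; exists N.*2; split=> //; exists A.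
elim: i => [|i IHi] iN.
  have h0 : h 0 = [::] by [].
  have M0 : maker_claimed [::] = set0 :> {set X} by apply/setP=> z; rewrite !inE.
  have B0 : breaker_claimed [::] = set0 by apply/setP=> z; rewrite !inE.
  by right; rewrite h0 M0 B0 cards0 subn0.
case: (IHi (ltnW iN)) => [|[sz leM]]; first by left.
rewrite -(prednK (_ : 0 < N - i)) ?subn_gt0 //= => /orP[].
  case/existsP=> A /andP[AF sA]; left; exists i.*2.
  by split; [apply: leq_trans leM (ltnW iN)|exists A].
move=> /forallP wins; right.
have szX : (size (h i)).+2 <= #|X| by rewrite sz; apply: leq_trans NX; move: iN; clear; lia.
have [a [ah ha]] : exists a, a \notin h i /\ play maker breaker i.*2.+1 = rcons (h i) a.
  rewrite /play iterS -/(play maker breaker i.*2) -/(h i) /play_step sz odd_double.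
  have := legB (h i); case: (breaker (h i)) => [a ah|all_h]; first by exists a.
  by have [z] := unclaimed (ltnW szX); rewrite all_h.
have [Ma Ba] := claimed_rcons ah; rewrite sz odd_double in Ma Ba.
have sza : size (rcons (h i) a) = i.*2.+1 by rewrite size_rcons sz.
have [z zh] : exists z, z \notin rcons (h i) a by apply: unclaimed; rewrite size_rcons.
have [b [bh winM hb]] : exists b, [/\ b \notin rcons (h i) a,
    winb (N - i).-1 (b |: maker_claimed (h i)) (a |: breaker_claimed (h i)) &
    maker (rcons (h i) a) = Some b].
  rewrite /maker /free_choice sza /= uphalf_double Ma Ba.
  case: pickP => [b /andP[bh winM]|none]; first by exists b.
  have /existsP[b /andP[bB winM]] := wins a.
  have bM : b \in maker_claimed (h i).
    have := none b; rewrite winM andbT => /negbFE.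
    rewrite mem_rcons inE => /orP[/eqP ba|bh]; first by rewrite ba setU11 in bB.
    move: bB; rewrite !inE bh negb_or /= negbK => /andP[_ ->] //.
  have := none z; rewrite zh /= => /negP[].
  apply: winb_mono winM; rewrite subUset sub1set !inE.
  by move: bM; rewrite inE => ->; rewrite orbT subsetUr.
have hS : h i.+1 = rcons (rcons (h i) a) b.
  rewrite /h doubleS /play iterS -/(play maker breaker i.*2.+1) ha /play_step.
  by rewrite sza /= odd_double hb.
have [Mb Bb] := claimed_rcons bh; rewrite sza /= odd_double in Mb Bb.
rewrite hS Mb Bb Ma Ba size_rcons sza subnS; split=> //.
by rewrite cardsU1; case: (_ \notin _) => //=; apply: leqW.
Qed.

End Strategy.

Lemma win_strategy n N (G : {set {set 'I_n}} -> Prop) (F : {set {set complete_edge n}}) :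
    2 * N <= 'C(n, 2) ->
    (forall M : {set complete_edge n}, G (val @: M) -> exists2 A, A \in F & A \subset M) ->
  win G N set0 set0 -> maker_wins_within F N.
Proof.
move=> NC GF winG; apply: winb_strategy.
  rewrite card_sig (eq_card (B := mem [set A : {set 'I_n} | #|A| == 2])).
    by rewrite card_draws card_ord.
  by move=> A; rewrite !inE.
suff winbP k (M B : {set complete_edge n}) : win G k (val @: M) (val @: B) -> winb F k M B.
  by apply: winbP; rewrite imset0.
elim: k M B => [|k IHk] M B /=.
  by case=> // /GF[A AF sA]; rewrite orbF; apply/existsP; exists A; rewrite AF.
case=> [/GF[A AF sA]|wins].
  by apply/orP; left; apply/existsP; exists A; rewrite AF.
apply/orP; right; apply/forallP=> a.
have [e' [e'2 e'B winM]] := wins (val a) (eqP (valP a)).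
have e'P : #|e'| == 2 by apply/eqP.
apply/existsP; exists (Sub e' e'P); apply/andP; split.
  apply: contra e'B; rewrite !in_setU1 => /orP[/eqP<-|bB]; first by rewrite SubK eqxx.
  by apply/orP; right; apply/imsetP; exists (Sub e' e'P); rewrite ?SubK.
by apply: IHk; rewrite !imsetU1 SubK.
Qed.

(** * Systems of paths *)

Section Joining.

Variable W : finType.
Implicit Types (E : {set W}) (mu nu : W -> W) (M B : {set {set W}}).
Implicit Types (G : {set {set W}} -> Prop).

(** Maker's graph is seen as a system of disjoint paths: [E] is the set of
    their ends, and [mu] sends an end to the other end of its path; a path with
    a single vertex is a fixed point of [mu].  A path that is entered at [u] is
    left at [mu u]. *)
Definition link mu M : rel W := [rel u v | [set mu u; v] \in M].

(** Ways to run through all paths: [s] lists the ends at which they are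
    entered. *)
Definition transversal E mu (s : seq W) : Prop :=
  [/\ uniq s, {subset s <= E},
      forall u, u \in E -> (u \in s) || (mu u \in s)
    & forall u, u \in s -> mu u \in s -> mu u = u].

(** Only ends matter: Maker has won as soon as she has linked up the paths of
    the system cyclically in any order. *)
Definition closes G E mu M : Prop :=
  forall M' s, M \subset M' -> transversal E mu s -> cycle (link mu M') s -> G M'.

Definition mating E mu : Prop := forall u, u \in E -> mu u \in E /\ mu (mu u) = u.

(** The mates after a join, when [a] and [b] are the ends of the new path. *)
Definition upd mu a b : W -> W :=
  fun u => if u == a then b else if u == b then a else mu u.

(** Joining [a] and [b] makes them interior vertices, unless they are single
    vertices: these are ends still, which is why [mu a] and [mu b] are put back. *)
Definition joinE E mu a b : {set W} := (E :\: [set a; b]) :|: [set mu a; mu b].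

Lemma updC mu a b : upd mu a b =1 upd mu b a.
Proof. by move=> u; rewrite /upd; do 2!case: eqP => [->|]. Qed.

Lemma joinEC E mu a b : joinE E mu a b = joinE E mu b a.
Proof. by rewrite /joinE setUC [[set b; a]]setUC [[set mu b; mu a]]setUC [LHS]setUC. Qed.

Lemma closes_sub G E mu M M' : M \subset M' -> closes G E mu M -> closes G E mu M'.
Proof. by move=> sMM' clM M2 s /(subset_trans sMM'); apply: clM. Qed.

Lemma cycle_link_eq mu nu M s :
  {in s, mu =1 nu} -> cycle (link mu M) s = cycle (link nu M) s.
Proof.
move=> eq_mn; apply: (@eq_in_cycle _ (mem s)); last by apply/allP.
by move=> u v us vs; rewrite /link /= eq_mn.
Qed.

Lemma closes_eq G E E' mu nu M :
  E = E' -> {in E, mu =1 nu} -> closes G E mu M -> closes G E' nu M.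
Proof.
move=> <- eq_mn clM M' s sMM' [Us sE cov once] cyc.
apply: (clM M' s) => //.
  split=> // u.
    by move=> uE; rewrite eq_mn //; apply: cov.
  by move=> us; rewrite eq_mn; [apply: once|apply: sE].
by rewrite (@cycle_link_eq mu nu) // => u us; rewrite eq_mn // sE.
Qed.

Lemma mating_inj E mu u v : mating E mu -> u \in E -> v \in E -> mu u = mu v -> u = v.
Proof. by move=> mt uE vE eq_uv; rewrite -(mt u uE).2 eq_uv (mt v vE).2. Qed.

Lemma path_link_upd mu nu M u v (t : seq W) w :
    mu u = nu v -> {in t, mu =1 nu} ->
  path (link mu M) u (rcons t w) -> path (link nu M) v (rcons t w).
Proof.
move=> eq_uv; case: t => [|z t] eq_t /=; first by rewrite /link /= eq_uv.
rewrite /link /= eq_uv => /andP[-> /=].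
rewrite !rcons_path => /andP[pt lt]; apply/andP; split.
  rewrite (@eq_in_path _ (mem (z :: t)) _ (link mu M)) //; last exact/allP.
  by move=> x y xt yt; rewrite /link /= eq_t.
by move: lt; rewrite /link /= eq_t // mem_last.
Qed.

(** A list through the new system that enters the joined path at [mu a] becomes
    a list through the old one when [b] is inserted after [mu a]: the path of
    [a] is left at [a], and the edge [ab] leads to [b]. *)
Lemma closes_join_half G E mu a b M M' s :
    mating E mu -> a \in E -> b \in E -> b != a -> b != mu a ->
    closes G E mu M -> [set a; b] |: M \subset M' ->
    transversal (joinE E mu a b) (upd mu (mu a) (mu b)) s ->
    cycle (link (upd mu (mu a) (mu b)) M') s -> mu a \in s ->
  G M'.
Proof.
set a' := mu a; set b' := mu b; set nu := upd _ _ _; set E' := joinE _ _ _ _.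
move=> mt aE bE ba ba' clM sMM' tr cyc a's.
have [a'E a'K] := mt a aE; have [b'E b'K] := mt b bE.
have ab' : a' != b' by apply: contra ba => /eqP/(mating_inj mt aE bE)->.
have b'a : b' != a by apply: contra ba' => /eqP b'a; rewrite /a' -b'a b'K.
have [i t rot_s] := rot_to a's.
have mem_s : s =i a' :: t by move=> u; rewrite -rot_s mem_rot.
have {}cyc : cycle (link nu M') (a' :: t) by rewrite -rot_s rot_cycle.
have [Us sE' cov once] := tr.
have Ut : uniq (a' :: t) by rewrite -rot_s rot_uniq.
have nu_a' : nu a' = b' by rewrite /nu /upd eqxx.
have nu_b' : nu b' = a' by rewrite /nu /upd eqxx eq_sym (negbTE ab').
have a't : a' \notin t by case/andP: Ut.
have b't : b' \notin t.
  apply: contra ab' => b't; apply/eqP.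
  by have := once a' a's; rewrite nu_a' mem_s inE b't orbT => /(_ isT).
have nu_t : {in t, nu =1 mu}.
  move=> u ut; rewrite /nu /upd; case: eqP => [ua'|_].
    by rewrite ua' (negbTE a't) in ut.
  by case: eqP => // ub'; rewrite ub' (negbTE b't) in ut.
have tE' u : u \in t -> u \in E' by move=> ut; apply: sE'; rewrite mem_s inE ut orbT.
have tE u : u \in t -> u \in E.
  by move/tE'; rewrite !inE => /orP[/andP[_ //]|/orP[]/eqP->].
have bt : b \notin t.
  apply/negP=> bt; have := tE' b bt; rewrite !inE eqxx orbT /= (negbTE ba') /=.
  by move=> /eqP bb'; rewrite bb' (negbTE b't) in bt.
have at_ : a \notin t.
  apply/negP=> at_; have := tE' a at_; rewrite !inE eqxx /=.
  rewrite [a == mu b]eq_sym (negbTE b'a) orbF => /eqP aa'.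
  by case/negP: a't; rewrite /a' -aa'.
apply: (clM M' (a' :: b :: t)).
- exact: subset_trans (subsetUr _ _) sMM'.
- split.
  + rewrite /= inE negb_or eq_sym ba' a't bt /=.
    by case/andP: Ut.
  + by move=> u; rewrite !inE => /or3P[/eqP->|/eqP->|/tE].
  + move=> u uE; rewrite !inE.
    have [->|ua] := eqVneq u a; first by rewrite eqxx !orbT.
    have [->|ub] := eqVneq u b; first by rewrite !orbT.
    have [->|ua'] := eqVneq u a'; first by [].
    have [->|ub'] := eqVneq u b'; first by rewrite b'K eqxx !orbT.
    have /cov : u \in E' by rewrite !inE (negbTE ua) (negbTE ub) uE.
    rewrite /nu /upd (negbTE ua') (negbTE ub') !mem_s !inE (negbTE ua') /=.
    by case/or3P=> ->; rewrite ?orbT.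
  + move=> u; rewrite !inE => /or3P[/eqP->|/eqP->|ut].
    * rewrite a'K [a == b]eq_sym (negbTE ba) (negbTE at_) !orbF.
      by move/eqP.
    * rewrite -/b' [b' == a']eq_sym (negbTE ab') (negbTE b't) orbF.
      by move/eqP.
    case/or3P=> [/eqP mua|/eqP mub|mut].
    * have := ut; rewrite (mating_inj mt (tE u ut) aE mua).
      by rewrite (negbTE at_).
    * have := ut; rewrite (_ : u = b') ?(negbTE b't) //.
      by rewrite /b' -mub (mt u (tE u ut)).2.
    have := once u; rewrite nu_t // !mem_s !inE ut mut !orbT.
    by move=> /(_ isT isT).
have abM : [set a; b] \in M' by apply: (subsetP sMM'); rewrite setU11.
rewrite /= {1}/link /= a'K abM /=.
apply: path_link_upd cyc; first by rewrite nu_a'.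
exact: nu_t.
Qed.

Lemma closes_join G E mu a b M :
    mating E mu -> a \in E -> b \in E -> b != a -> b != mu a ->
    closes G E mu M ->
  closes G (joinE E mu a b) (upd mu (mu a) (mu b)) ([set a; b] |: M).
Proof.
move=> mt aE bE ba ba' clM M' s sMM' tr cyc.
have [_ _ cov _] := tr.
have /cov : mu a \in joinE E mu a b by rewrite !inE eqxx orbT.
rewrite /upd eqxx => /orP[a's|b's].
  exact: (closes_join_half mt aE bE ba ba' clM sMM' tr cyc a's).
apply: (@closes_join_half G E mu b a M M' s) => //.
- by rewrite eq_sym.
- by apply: contra ba' => /eqP->; rewrite (mt b bE).2.
- by rewrite setUC [[set b; a]]setUC setUC.
- rewrite joinEC; case: tr => Us sE cov' once; split=> // u.
    by move=> uE; rewrite updC; apply: cov'.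
  by move=> us; rewrite updC; apply: once.
rewrite (@cycle_link_eq _ (upd mu (mu a) (mu b))) // => u _.
exact: updC.
Qed.

Lemma mating_join E mu a b :
    mating E mu -> a \in E -> b \in E -> b != a -> b != mu a ->
  mating (joinE E mu a b) (upd mu (mu a) (mu b)).
Proof.
move=> mt aE bE ba ba' u.
have [a'E a'K] := mt a aE; have [b'E b'K] := mt b bE.
have ab' : mu a != mu b by apply: contra ba => /eqP/(mating_inj mt aE bE)->.
rewrite /upd; have [->|ua'] := eqVneq u (mu a).
  by rewrite !inE !eqxx !orbT eq_sym (negbTE ab').
have [->|ub'] := eqVneq u (mu b); first by rewrite !inE !eqxx !orbT.
rewrite !inE (negbTE ua') (negbTE ub') /= !orbF negb_or => /andP[/andP[ua ub] uE].
have [u'E u'K] := mt u uE.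
have -> : (mu u == mu a) = false.
  by apply/negbTE; apply: contra ua => /eqP/(mating_inj mt uE aE)->.
have -> : (mu u == mu b) = false.
  by apply/negbTE; apply: contra ub => /eqP/(mating_inj mt uE bE)->.
split=> //; rewrite u'E andbT negb_or !orbF; apply/andP; split.
  by apply: contra ua' => /eqP<-; rewrite u'K.
by apply: contra ub' => /eqP<-; rewrite u'K.
Qed.

(** The Breaker edges that matter: the edge between the two ends of one path
    would only close this path prematurely. *)
Definition dirty E mu B : {set {set W}} :=
  [set e in B | [exists u in E, exists v in E,
                   [&& v != u, v != mu u & e == [set u; v]]]].

Lemma dirtyP E mu B e :
  reflect (exists u v, [/\ u \in E, v \in E, v != u, v != mu u & e = [set u; v] /\ e \in B])
          (e \in dirty E mu B).
Proof.
rewrite inE; apply: (iffP andP).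
  case=> eB /existsP[u /andP[uE /existsP[v /and4P[vE vu vmu /eqP euv]]]].
  by exists u, v.
case=> u [v [uE vE vu vmu [euv eB]]]; split=> //.
apply/existsP; exists u; rewrite uE; apply/existsP; exists v.
by rewrite vE vu vmu euv eqxx.
Qed.

Lemma dirty_edge E mu B u v :
    u \in E -> v \in E -> v != u -> v != mu u ->
  ([set u; v] \in dirty E mu B) = ([set u; v] \in B).
Proof.
move=> uE vE vu vmu; apply/idP/idP; first by rewrite inE => /andP[].
by move=> uvB; apply/dirtyP; exists u, v.
Qed.

Lemma dirty_add E mu B e : dirty E mu (e |: B) \subset e |: dirty E mu B.
Proof.
apply/subsetP=> e' /dirtyP[u [v [uE vE vu vmu [euv]]]].
rewrite !inE => /orP[->//|e'B]; apply/orP; right.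
by rewrite e'B; apply/existsP; exists u; rewrite uE; apply/existsP; exists v;
  rewrite vE vu vmu euv /=.
Qed.

Lemma card_dirty_add E mu B e : #|dirty E mu (e |: B)| <= #|dirty E mu B|.+1.
Proof.
apply: leq_trans (subset_leq_card (dirty_add _ _ _ _)) _.
by rewrite cardsU1; case: (_ \notin _).
Qed.

End Joining.

(** * Removing dirty edges *)

Section Paired.

Variable W : finType.
Implicit Types (E : {set W}) (mu nu : W -> W) (M B : {set {set W}}).

Definition paired E mu : Prop := mating E mu /\ forall u, u \in E -> mu u != u.

Definition joinable E mu B a b : Prop :=
  [/\ a \in E, b \in E, b != a, b != mu a & [set a; b] \notin B].

Lemma joinEP E mu a b u : paired E mu -> a \in E -> b \in E -> b != a -> b != mu a ->
  (u \in joinE E mu a b) = [&& u != a, u != b & u \in E].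
Proof.
move=> [mt ns] aE bE ba ba'.
have [a'E a'K] := mt a aE; have [b'E b'K] := mt b bE.
rewrite !inE negb_or -andbA.
have [->|ua'] := eqVneq u (mu a).
  by rewrite ns // eq_sym ba' a'E !orbT.
have [->|ub'] := eqVneq u (mu b); last by rewrite !orbF.
have b'a : mu b != a by apply: contra ba' => /eqP<-; rewrite b'K.
by rewrite ns // b'E b'a !orbT.
Qed.

Lemma joinE_sub E mu a b : mating E mu -> a \in E -> b \in E -> joinE E mu a b \subset E.
Proof.
move=> mt aE bE; apply/subsetP=> u; rewrite !inE => /orP[/andP[]//|].
by case/orP=> /eqP->; [have [] := mt a aE | have [] := mt b bE].
Qed.

Lemma paired_join E mu a b : paired E mu -> a \in E -> b \in E -> b != a -> b != mu a ->
  paired (joinE E mu a b) (upd mu (mu a) (mu b)).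
Proof.
move=> [mt ns] aE bE ba ba'; split; first exact: mating_join.
have ab' : mu a != mu b by apply: contra ba => /eqP/(mating_inj mt aE bE)->.
move=> u /(subsetP (joinE_sub mt aE bE)) uE; rewrite /upd.
have [->|_] := eqVneq u (mu a); first by rewrite eq_sym.
by have [->|_] := eqVneq u (mu b); last exact: ns.
Qed.

Lemma card_join E mu a b : paired E mu -> a \in E -> b \in E -> b != a -> b != mu a ->
  #|E| = #|joinE E mu a b|.+2.
Proof.
move=> pr aE bE ba ba'; rewrite (cardsD1 a) aE (cardsD1 b (_ :\ _)) !inE ba bE.
rewrite /= !add1n; congr (_.+2); apply: eq_card => u.
by rewrite joinEP // !inE andbCA.
Qed.

(** Joining creates no dirty edges.  It removes those at [a] and [b], which are
    no ends any longer unless they are single vertices, and the edge between their mates, which are now the ends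
    of one path. *)
Lemma dirty_join E mu B a b e :
    mating E mu -> a \in E -> b \in E -> b != a -> b != mu a ->
    e \in dirty (joinE E mu a b) (upd mu (mu a) (mu b)) B ->
  [/\ e \in dirty E mu B, a \in e -> mu a = a, b \in e -> mu b = b
    & e != [set mu a; mu b]].
Proof.
move=> mt aE bE ba ba' /dirtyP[u [v [uE' vE' vu]]].
have ab' : mu a != mu b by apply: contra ba => /eqP/(mating_inj mt aE bE)->.
have [a'E a'K] := mt a aE; have [b'E b'K] := mt b bE.
have b'a : mu b != a by apply: contra ba' => /eqP<-; rewrite b'K.
have sE := subsetP (joinE_sub mt aE bE).
have aE' : a \in joinE E mu a b -> mu a = a.
  rewrite !inE eqxx /= => /orP[/eqP<-//|/eqP eq_a].
  by rewrite -eq_a eqxx in b'a.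
have bE' : b \in joinE E mu a b -> mu b = b.
  rewrite !inE eqxx orbT /= => /orP[/eqP eq_b|/eqP<-//].
  by rewrite eq_b eqxx in ba'.
rewrite {1}/upd => vmu [-> eB]; split.
- apply/dirtyP; exists u, v; split; rewrite ?sE //.
  move: vmu; have [ua|_] := eqVneq u (mu a).
    rewrite ua a'K in vu * => _; apply/eqP => va; move: vE' vu; rewrite va => /aE' ->.
    by rewrite eqxx.
  have [ub|//] := eqVneq u (mu b).
  rewrite ub b'K in vu * => _; apply/eqP => vb; move: vE' vu.
  by rewrite vb => /bE' ->; rewrite eqxx.
- by case/set2P=> eq_a; apply: aE'; rewrite [X in X \in _]eq_a.
- by case/set2P=> eq_b; apply: bE'; rewrite [X in X \in _]eq_b.
apply/negP=> /eq_set2P[] [uu vv]; move: vmu; rewrite uu vv.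
  by rewrite eqxx eqxx.
by rewrite [mu b == _]eq_sym (negbTE ab') !eqxx.
Qed.

Lemma dirty_join_kill E mu B a b (X : {set {set W}}) :
    paired E mu -> a \in E -> b \in E -> b != a -> b != mu a ->
    X \subset dirty E mu B ->
    (forall e, e \in X -> [|| a \in e, b \in e | e == [set mu a; mu b]]) ->
  #|dirty (joinE E mu a b) (upd mu (mu a) (mu b)) B| + #|X| <= #|dirty E mu B|.
Proof.
move=> [mt ns] aE bE ba ba' sX killed.
rewrite -(cardsID X (dirty E mu B)) addnC; rewrite (setIidPr sX) leq_add2l.
apply/subset_leq_card/subsetP=> e /(dirty_join mt aE bE ba ba')[eD ea eb eab].
rewrite inE eD andbT; apply/negP=> /killed/or3P[/ea/eqP|/eb/eqP|].
- by rewrite (negbTE (ns a aE)).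
- by rewrite (negbTE (ns b bE)).
by rewrite (negbTE eab).
Qed.

Lemma joinable_freeE E mu B a b :
    a \in E -> b \in E -> b != a -> b != mu a -> [set a; b] \notin dirty E mu B ->
  joinable E mu B a b.
Proof. by move=> aE bE ba ba'; rewrite dirty_edge. Qed.

Definition dnbr E mu B a : {set W} :=
  [set v in E | [&& v != a, v != mu a & [set a; v] \in B]].

Lemma dnbr_edges E mu B a : a \in E ->
  exists X : {set {set W}}, [/\ X \subset dirty E mu B, forall e, e \in X -> a \in e &
               #|X| = #|dnbr E mu B a|].
Proof.
move=> aE; exists [set [set a; v] | v in dnbr E mu B a]; split.
- apply/subsetP=> _ /imsetP[v + ->]; rewrite inE => /and4P[vE va va' vB].
  by rewrite dirty_edge.
- by move=> _ /imsetP[v _ ->]; rewrite set21.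
apply: card_in_imset => v w; rewrite !inE => /and4P[_ va _ _] /and4P[_ wa _ _].
by move/eqP/eq_set2P=> [[]//|[aw va']]; rewrite va' eqxx in va.
Qed.

Lemma card_dnbr E mu B a : a \in E -> #|dnbr E mu B a| <= #|dirty E mu B|.
Proof. by move=> /(dnbr_edges mu B)[X [sX _ <-]]; apply: subset_leq_card. Qed.

Lemma free_end E (X : {set W}) : #|X| < #|E| -> exists2 c, c \in E & c \notin X.
Proof.
move=> ltXE; have : E :\: X != set0.
  by rewrite -card_gt0 -(ltn_add2l #|E :&: X|) cardsID addn0;
     apply: leq_ltn_trans ltXE; apply/subset_leq_card/subsetIr.
by case/set0Pn=> c; rewrite inE => /andP[cX cE]; exists c.
Qed.

Lemma free_partner E mu B a : a \in E -> #|dnbr E mu B a| + 2 < #|E| ->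
  exists b, joinable E mu B a b.
Proof.
move=> aE ltE; have [|c cE] := @free_end E (dnbr E mu B a :|: [set a; mu a]).
  apply: leq_ltn_trans ltE; apply: leq_trans (leq_card_setU _ _) _.
  by rewrite leq_add2l cards2; case: (_ != _).
rewrite !inE !negb_or cE /= => /and3P[+ ca ca']; rewrite ca ca' /= => free.
by exists c.
Qed.

(** Two edges with a common end die together when that end is joined to
    anything.  Two disjoint edges always have nonmate ends, one from each. *)
Lemma kill2 E mu B :
    paired E mu -> 1 < #|dirty E mu B| -> #|dirty E mu B| + 2 < #|E| ->
  exists a b, joinable E mu B a b /\
    #|dirty (joinE E mu a b) (upd mu (mu a) (mu b)) B| + 2 <= #|dirty E mu B|.
Proof.
move=> pr D2 ltDE; have [mt ns] := pr.
have shared a e1 e2 : e1 \in dirty E mu B -> e2 \in dirty E mu B -> e1 != e2 ->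
    a \in E -> a \in e1 -> a \in e2 -> exists a b, joinable E mu B a b /\
    #|dirty (joinE E mu a b) (upd mu (mu a) (mu b)) B| + 2 <= #|dirty E mu B|.
  move=> e1D e2D e12 aE ae1 ae2.
  have [|b jab] := @free_partner E mu B a aE.
    by apply: leq_ltn_trans ltDE; rewrite leq_add2r card_dnbr.
  exists a, b; split=> //; have [_ bE ba ba' _] := jab.
  have -> : 2 = #|[set e1; e2]| by rewrite cards2 e12.
  apply: dirty_join_kill => //; first by rewrite subUset !sub1set e1D.
  by move=> e /set2P[]->; rewrite ?ae1 ?ae2.
have /card_gt1P[e1 [e2 [e1D e2D e12]]] := D2.
have [a [s [aE sE sa sa' [e1E e1B]]]] := dirtyP _ _ _ _ e1D.
have [b [t [bE tE tb tb' [e2E e2B]]]] := dirtyP _ _ _ _ e2D.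
have key c : c \in E -> c \in e2 -> c != mu a -> exists a b, joinable E mu B a b /\
    #|dirty (joinE E mu a b) (upd mu (mu a) (mu b)) B| + 2 <= #|dirty E mu B|.
  move=> cE ce2 ca'.
  have [ca|ca] := eqVneq c a.
    by apply: (shared a e1 e2) => //; rewrite ?e1E ?set21 // -ca.
  have [acD|acD] := boolP ([set a; c] \in dirty E mu B).
    have [ac1|ac1] := eqVneq [set a; c] e1.
      by apply: (shared c e1 e2) => //; rewrite -ac1 set22.
    by apply: (shared a e1 [set a; c]); rewrite ?set21 //;
      [rewrite eq_sym | rewrite e1E set21].
  exists a, c; split; first exact: joinable_freeE.
  have -> : 2 = #|[set e1; e2]| by rewrite cards2 e12.
  apply: dirty_join_kill => //; first by rewrite subUset !sub1set e1D.
  by move=> e /set2P[]->; rewrite ?ce2 ?e1E ?set21 ?orbT.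
have [ba'|ba'] := eqVneq b (mu a); last by apply: (key b); rewrite // e2E set21.
by apply: (key t); rewrite ?e2E ?set22 // -ba'.
Qed.

Lemma kill1 E mu B :
    paired E mu -> 0 < #|dirty E mu B| -> #|dirty E mu B| + 2 < #|E| ->
  exists a b, joinable E mu B a b /\
    #|dirty (joinE E mu a b) (upd mu (mu a) (mu b)) B| < #|dirty E mu B|.
Proof.
move=> pr /card_gt0P[e eD] ltDE.
have [a [s [aE sE sa sa' [eE eB]]]] := dirtyP _ _ _ _ eD.
have [|b jab] := @free_partner E mu B a aE.
  by apply: leq_ltn_trans ltDE; rewrite leq_add2r card_dnbr.
exists a, b; split=> //; have [_ bE ba ba' _] := jab.
rewrite -addn1 -(cards1 e); apply: dirty_join_kill => //; first by rewrite sub1set.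
by move=> e' /set1P->; rewrite eE set21.
Qed.

End Paired.

(** * Removing three dirty edges at once *)

Section Gain.

Variable W : finType.
Implicit Types (E : {set W}) (mu nu : W -> W) (M B : {set {set W}}).

(** Twins run between the same two paths, at opposite ends.  They are what can
    prevent a join from removing three dirty edges when all dirty edges are
    disjoint: joining the two other ends of these paths would remove an edge and
    the dirty edges at both of these ends, but is blocked by the twin. *)
Definition twinned E mu B : {set {set W}} :=
  [set e in dirty E mu B | mu @: e \in dirty E mu B].

Lemma imset2_set2 mu (u v : W) : mu @: [set u; v] = [set mu u; mu v].
Proof. by rewrite imsetU !imset_set1. Qed.

(** An end [a] with exactly two dirty edges is joined with an end [c] of a third
    one, where [c] is neither [a], nor its mate, nor one of the two neighbours.
    There is such a [c], because at most [2 ^ 4] edges lie inside these four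
    vertices. *)
Lemma gain3_shared E mu B a :
    paired E mu -> 16 < #|dirty E mu B| -> #|dirty E mu B| + 2 < #|E| ->
    a \in E -> 1 < #|dnbr E mu B a| ->
  exists a b, joinable E mu B a b /\
    #|dirty (joinE E mu a b) (upd mu (mu a) (mu b)) B| + 3 <= #|dirty E mu B|.
Proof.
move=> pr D16 ltDE aE a2.
have [X [sX aX cX]] := dnbr_edges mu B aE.
have [a3|a3] := leqP 3 #|dnbr E mu B a|.
  have [|b jab] := @free_partner W E mu B a aE.
    by apply: leq_ltn_trans ltDE; rewrite leq_add2r card_dnbr.
  exists a, b; split=> //; have [_ bE ba ba' _] := jab.
  apply: leq_trans (dirty_join_kill pr aE bE ba ba' sX _).
    by rewrite leq_add2l cX.
  by move=> e /aX->.
have c2 : #|dnbr E mu B a| = 2 by lia.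
set Z := [set a; mu a] :|: dnbr E mu B a.
have cZ : #|Z| <= 4.
  apply: leq_trans (leq_card_setU _ _) _; have := cards2 a (mu a).
  rewrite c2; lia.
have /subsetPn[e3 e3D e3Z] : ~~ (dirty E mu B \subset powerset Z).
  apply: contraL D16 => /subset_leq_card; rewrite card_powerset -leqNgt => le2.
  by apply: leq_trans le2 _; rewrite (@leq_exp2l 2 _ 4).
have [c ce3 cZ'] : exists2 c, c \in e3 & c \notin Z.
  by apply/subsetPn; move: e3Z; rewrite inE.
have [s [t [sE tE ts ts' [e3E e3B]]]] := dirtyP _ _ _ _ e3D.
have cE : c \in E by move: ce3; rewrite e3E => /set2P[]->.
move: cZ'; rewrite !inE !negb_or cE /= => /andP[/andP[ca ca']].
rewrite ca ca' /= => free; exists a, c; split=> //.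
apply: leq_trans (dirty_join_kill (X := e3 |: X) pr aE cE ca ca' _ _).
- rewrite leq_add2l cardsU1 cX c2; case: (boolP (e3 \in X)) => // /aX.
  rewrite e3E => /set2P[]as_; move: free; move: ce3; rewrite e3E -as_ => /set2P[]cs.
  + by rewrite cs eqxx in ca.
  + by rewrite cs as_ -e3E e3B.
  + by rewrite cs as_ setUC -e3E e3B.
  by rewrite cs as_ eqxx in ca.
- by rewrite subUset sub1set e3D.
by move=> e /setU1P[->|/aX->//]; rewrite ce3 orbT.
Qed.

Section Matching.

Variables (E : {set W}) (mu : W -> W) (B : {set {set W}}).
Hypotheses (pr : paired E mu)
  (single : forall a, a \in E -> #|dnbr E mu B a| <= 1).

Let mt : mating E mu := pr.1.
Local Notation D := (dirty E mu B).

Lemma matching_uniq e e' a : e \in D -> e' \in D -> a \in e -> a \in e' -> e = e'.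
Proof.
move=> /dirtyP[u [v [uE vE vu vu' [-> eB]]]] e'D ae ae'.
have nbr x y : x \in E -> y \in E -> y != x -> y != mu x -> [set x; y] \in B ->
    forall f, f \in D -> x \in f -> [set x; y] = f.
  move=> xE yE yx yx' xyB f /dirtyP[s [t [sE tE ts ts' [-> fB]]]].
  have yN : y \in dnbr E mu B x by rewrite inE yE yx yx'.
  have := single xE => /card_le1_eqP cN /set2P[xs|xt].
    rewrite xs (cN _ _ yN (_ : t \in _)) // -?xs //.
    by rewrite inE tE xs ts ts' fB.
  rewrite setUC [[set s; t]]setUC [[set t; s]]setUC.
  rewrite xt [RHS]setUC (cN _ _ yN (_ : s \in _)) //; first by rewrite setUC.
  rewrite inE sE xt eq_sym ts /= setUC fB andbT.
  by apply: contra ts' => /eqP->; rewrite (mt tE).2.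
case/set2P: ae ae' => -> => [ae'|ae']; first exact: nbr ae'.
rewrite setUC; apply: nbr ae' => //; first by rewrite eq_sym.
  by apply: contra vu' => /eqP->; rewrite (mt vE).2.
by rewrite setUC.
Qed.

(** The dirty edges are pairwise disjoint, so they cover [#|D|.*2] ends. *)
Lemma matching_clean : #|[set u in E | dnbr E mu B u == set0]| + #|D|.*2 <= #|E|.
Proof.
have tI : trivIset D.
  apply/trivIsetP=> e e' eD e'D; apply: contraR => /pred0Pn[a /andP[ae ae']].
  exact/eqP/(matching_uniq eD e'D ae ae').
have cD : #|cover D| = #|D|.*2.
  rewrite -(eqP tI) (eq_bigr (fun=> 2)) ?sum_nat_const ?muln2 // => e.
  move=> /dirtyP[u [v [_ _ vu _ [-> _]]]].
  by rewrite cards2 eq_sym vu.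
rewrite -cD -(cardsID (cover D) E) addnC leq_add //.
  apply/subset_leq_card/subsetP=> a /bigcupP[e eD ae]; rewrite inE.
  have /dirtyP[u [v [uE vE vu vu' [eE eB]]]] := eD.
  have -> : a \in E by move: ae; rewrite eE => /set2P[]->.
  by apply/bigcupP; exists e.
apply/subset_leq_card/subsetP=> u; rewrite inE => /andP[uE /eqP uN].
rewrite inE uE andbT; apply/bigcupP=> -[e eD ue].
have /dirtyP[s [t [sE tE ts ts' [eE eB]]]] := eD.
suff : exists v, v \in dnbr E mu B u by rewrite uN => -[v]; rewrite inE.
move: ue; rewrite eE => /set2P[]->.
  by exists t; rewrite inE tE ts ts' -eE eB.
exists s; rewrite inE sE eq_sym ts setUC -eE eB /= andbT.
by apply: contra ts' => /eqP->; rewrite (mt tE).2.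
Qed.

(** An end without dirty edge spoils only the dirty edge at its mate.  Fewer
    than [#|D| - 2] ends have no dirty edge, hence a dirty edge outside [X] is
    not spoiled. *)
Lemma pick_covered (X : {set {set W}}) :
    #|X| <= 2 -> #|E| + 2 < 3 * #|D| ->
  exists2 e, e \in D :\: X & forall u, u \in e -> dnbr E mu B (mu u) != set0.
Proof.
move=> cX ltED; pose C := [set u in E | dnbr E mu B u == set0].
pose h w := odflt set0 [pick e in D | mu w \in e].
have cC := matching_clean; rewrite -/C in cC.
have /subsetPn[e eD] : ~~ (D \subset X :|: h @: C).
  apply: contraL ltED => /subset_leq_card leD; rewrite -leqNgt.
  have := (leq_card_setU X (h @: C)).1; have := leq_imset_card h C; move: cC leD cX; clear.
  by move: (#|X :|: _|) (#|_ @: _|); lia.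
rewrite inE negb_or => /andP[eX eh]; exists e; first by rewrite inE eX.
have /dirtyP[s [t [sE tE ts ts' [eE eB]]]] := eD.
move=> u ue; apply: contra eh => uN.
have uE : u \in E by move: ue; rewrite eE => /set2P[]->.
apply/imsetP; exists (mu u); first by rewrite inE uN (mt uE).1.
rewrite /h (mt uE).2; case: pickP => [e' /andP[e'D ue']|/(_ e)]; last by rewrite eD ue.
exact: matching_uniq ue ue'.
Qed.

Lemma dnbr_dirty a : a \in E -> dnbr E mu B a != set0 ->
  exists2 e, e \in D & a \in e.
Proof.
move=> aE /set0Pn[v]; rewrite inE => /and4P[vE va va' avB].
by exists [set a; v]; rewrite ?set21 // dirty_edge.
Qed.

(** Joining the mates of the ends of an edge also buries the edge itself. *)
Lemma gain3_mates u v :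
    u \in E -> v \in E -> v != u -> v != mu u -> [set u; v] \in B ->
    dnbr E mu B (mu u) != set0 -> dnbr E mu B (mu v) != set0 ->
    [set mu u; mu v] \notin B ->
  exists a b, joinable E mu B a b /\
    #|dirty (joinE E mu a b) (upd mu (mu a) (mu b)) B| + 3 <= #|D|.
Proof.
move=> uE vE vu vu' uvB uN vN freeB.
have [u'E u'K] := mt uE; have [v'E v'K] := mt vE.
have v'u' : mu v != mu u by apply: contra vu => /eqP/(mating_inj mt vE uE)->.
have v'u : mu v != u by apply: contra vu' => /eqP<-; rewrite v'K.
have eD : [set u; v] \in D by rewrite dirty_edge.
have [f fD u'f] := dnbr_dirty u'E uN; have [g gD v'g] := dnbr_dirty v'E vN.
exists (mu u), (mu v); split; first by split; rewrite // u'K.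
have u'e : mu u \notin [set u; v].
  by rewrite !inE negb_or pr.2 // eq_sym.
have v'e : mu v \notin [set u; v] by rewrite !inE negb_or v'u pr.2.
have fg : f != g.
  apply: contra freeB => /eqP fg; have v'f : mu v \in f by rewrite fg.
  have /dirtyP[s [t [_ _ _ _ [fE fB]]]] := fD.
  move: u'f v'f v'u'; rewrite fE => /set2P[]-> /set2P[]->; rewrite ?eqxx // -?fE //.
  by rewrite setUC -fE.
have ef : [set u; v] != f by apply: contra u'e => /eqP->.
have eg : [set u; v] != g by apply: contra v'e => /eqP->.
have c3 : #|[set u; v] |: [set f; g]| = 3.
  by rewrite cardsU1 cards2 fg !inE negb_or ef eg.
rewrite -c3; apply: dirty_join_kill; rewrite ?u'K //.
  by rewrite subUset sub1set eD subUset !sub1set fD.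
move=> e /setU1P[->|/set2P[]->]; rewrite ?u'f ?v'g ?orbT //.
by rewrite ?u'K v'K eqxx !orbT.
Qed.

(** Joining across two twin pairs buries one edge of each and leaves the
    other two edges without twin. *)
Lemma gain3_twins u v w z :
    u \in E -> v \in E -> v != u -> v != mu u -> [set u; v] \in B ->
    w \in E -> z \in E -> z != w -> z != mu w -> [set w; z] \in B ->
    [set mu u; mu v] \in B -> [set mu w; mu z] \in B ->
    [set w; z] != [set u; v] -> [set w; z] != [set mu u; mu v] ->
  [/\ joinable E mu B u w,
    #|dirty (joinE E mu u w) (upd mu (mu u) (mu w)) B| + 2 <= #|D|
  & #|twinned (joinE E mu u w) (upd mu (mu u) (mu w)) B| + 4 <= #|twinned E mu B|].
Proof.
move=> uE vE vu vu' uvB wE zE zw zw' wzB tuB twB ne1 ne2.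
have [u'E u'K] := mt uE; have [v'E v'K] := mt vE.
have [w'E w'K] := mt wE; have [z'E z'K] := mt zE.
have inj := mating_inj mt.
have dD x y : x \in E -> y \in E -> y != x -> y != mu x -> [set x; y] \in B ->
    [set x; y] \in D /\ [set mu x; mu y] != [set x; y].
  move=> xE yE yx yx' xyB; split; first by rewrite dirty_edge.
  apply/eqP/eqP/eq_set2P=> -[[/eqP]|[xy _]]; first by rewrite (negbTE (pr.2 x xE)).
  by rewrite xy eqxx in yx'.
have dD' x y : x \in E -> y \in E -> y != x -> y != mu x -> [set mu x; mu y] \in B ->
    [set mu x; mu y] \in D.
  move=> xE yE yx yx' xyB; have [x'E x'K] := mt xE; have [y'E y'K] := mt yE.
  rewrite dirty_edge // ?x'K; first by apply: contra yx => /eqP/(inj _ _ yE xE)->.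
  by apply: contra yx' => /eqP<-; rewrite y'K.
have [e1D e1t] := dD u v uE vE vu vu' uvB.
have [e2D e2t] := dD w z wE zE zw zw' wzB.
have t1D := dD' u v uE vE vu vu' tuB; have t2D := dD' w z wE zE zw zw' twB.
set e1 := [set u; v] in e1D e1t ne1; set e2 := [set w; z] in e2D e2t ne1 ne2.
set t1 := [set mu u; mu v] in t1D e1t ne2; set t2 := [set mu w; mu z] in t2D e2t.
have sep e e' a : e \in D -> e' \in D -> e != e' -> a \in e -> a \notin e'.
  by move=> eD e'D ne ae; apply: contra ne => ae'; apply/eqP/(matching_uniq eD e'D ae ae').
have t21 : t2 != e1.
  apply: contra ne2 => /eqP t2e1.
  have : mu @: t2 = mu @: e1 by rewrite t2e1.
  by rewrite !imset2_set2 w'K z'K => eq_e; apply/eqP.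
have t22 : t2 != t1.
  apply: contra ne1 => /eqP t2t1.
  have : mu @: t2 = mu @: t1 by rewrite t2t1.
  by rewrite !imset2_set2 w'K z'K u'K v'K => eq_e; apply/eqP.
have we1 : w \notin e1 by apply: sep e2D e1D ne1 _; rewrite set21.
have wt1 : w \notin t1 by apply: sep e2D t1D ne2 _; rewrite set21.
have wu : w != u by apply: contra we1 => /eqP->; rewrite set21.
have wu' : w != mu u by apply: contra wt1 => /eqP->; rewrite set21.
have uwB : [set u; w] \notin D.
  apply: contra we1 => uwD.
  by rewrite (matching_uniq e1D uwD (a := u)) ?set21 ?set22.
have jn : joinable E mu B u w by apply: joinable_freeE.
split=> //.
  have -> : 2 = #|[set e1; e2]| by rewrite cards2 eq_sym ne1.
  apply: dirty_join_kill => //; first by rewrite subUset !sub1set e1D.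
  by move=> e /set2P[]->; rewrite ?set21 ?orbT.
set nu := upd _ _ _; set X := [set e1; t1] :|: [set e2; t2].
have c4 : #|X| = 4.
  rewrite cardsU !cards2 [e1 == t1]eq_sym e1t [e2 == t2]eq_sym e2t /=.
  rewrite (_ : _ :&: _ = set0) ?cards0 //; apply/setP=> e; rewrite !inE.
  apply/negbTE/negP=> /andP[/orP[]/eqP-> /orP[]]; apply/negP=> //.
  - by rewrite eq_sym.
  - by rewrite eq_sym.
  - by rewrite eq_sym.
  by rewrite eq_sym.
have tw e : e \in X -> e \in twinned E mu B.
  by rewrite inE => /orP[]/set2P[]->; rewrite inE ?imset2_set2
    ?u'K ?v'K ?w'K ?z'K ?e1D ?e2D ?t1D ?t2D.
rewrite -(cardsID X (twinned E mu B)) (setIidPr _) ?c4; last first.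
  by apply/subsetP=> e; apply: tw.
rewrite addnC leq_add2l; apply/subset_leq_card/subsetP=> e.
rewrite inE => /andP[eD' teD'].
have [eD ue we _] := dirty_join mt uE wE wu wu' eD'.
have [teD _ _ _] := dirty_join mt uE wE wu wu' teD'.
have {}ue : u \notin e by apply/negP=> /ue/eqP; rewrite (negbTE (pr.2 u uE)).
have {}we : w \notin e by apply/negP=> /we/eqP; rewrite (negbTE (pr.2 w wE)).
have vw : v != w by apply: contra we1 => /eqP<-; rewrite set22.
have zu : z != u.
  apply: contraNneq (sep _ _ u e1D e2D _ _) => [<-||]; rewrite ?set22 ?set21 //.
  by rewrite eq_sym.
have ne_e1 : e != e1 by apply: contra ue => /eqP->; rewrite set21.
have ne_e2 : e != e2 by apply: contra we => /eqP->; rewrite set21.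
have ne_t1 : e != t1.
  apply/eqP=> et1; move: teD; rewrite et1 imset2_set2 /nu /upd eqxx.
  have -> : (mu v == mu u) = false by apply/eqP=> /(inj _ _ vE uE)/eqP; rewrite (negbTE vu).
  have -> : (mu v == mu w) = false by apply/eqP=> /(inj _ _ vE wE)/eqP; rewrite (negbTE vw).
  rewrite v'K.
  move=> wvD; have := sep t2 e1 (mu w) t2D e1D t21; rewrite set21 => /(_ isT).
  by rewrite (matching_uniq e1D wvD (a := v)) ?set21 ?set22.
have ne_t2 : e != t2.
  apply/eqP=> et2; move: teD; rewrite et2 imset2_set2 /nu /upd eqxx.
  have -> : (mu w == mu u) = false by apply/eqP=> /(inj _ _ wE uE)/eqP; rewrite (negbTE wu).
  have -> : (mu z == mu u) = false by apply/eqP=> /(inj _ _ zE uE)/eqP; rewrite (negbTE zu).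
  have -> : (mu z == mu w) = false by apply/eqP=> /(inj _ _ zE wE)/eqP; rewrite (negbTE zw).
  rewrite z'K => uzD; have := sep t1 e2 (mu u) t1D e2D; rewrite eq_sym ne2 set21.
  by move=> /(_ isT isT); rewrite (matching_uniq e2D uzD (a := z)) ?set21 ?set22.
have u'e : mu u \notin e by apply: (sep t1); rewrite ?set21 // eq_sym.
have w'e : mu w \notin e by apply: (sep t2); rewrite ?set21 // eq_sym.
have nu_e : nu @: e = mu @: e.
  apply: eq_in_imset => x xe; rewrite /nu /upd.
  have [xu|_] := eqVneq x (mu u); first by rewrite -xu xe in u'e.
  by have [xw|//] := eqVneq x (mu w); rewrite -xw xe in w'e.
rewrite in_setD [_ \in twinned _ _ _]inE eD -nu_e teD !andbT.
by rewrite in_setU !in_set2 !negb_or ne_e1 ne_e2 ne_t1 ne_t2.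
Qed.

End Matching.

(** As each round costs one path and Breaker adds one dirty edge, two removals
    per round preserve the surplus of dirty edges over paths, and a third one
    decreases it. *)
Lemma gain3 E mu B :
    paired E mu -> #|E| <= (#|dirty E mu B| + 14).*2 ->
    #|dirty E mu B| + 2 < #|E| -> 100 <= #|E| ->
  exists a b, joinable E mu B a b /\
    (#|dirty (joinE E mu a b) (upd mu (mu a) (mu b)) B| + 3 <= #|dirty E mu B| \/
     #|dirty (joinE E mu a b) (upd mu (mu a) (mu b)) B| + 2 <= #|dirty E mu B| /\
     #|twinned (joinE E mu a b) (upd mu (mu a) (mu b)) B| + 4 <= #|twinned E mu B|).
Proof.
move=> pr leED ltDE E100; have [mt ns] := pr.
have [/existsP[a /andP[aE a2]]|matching] := boolP [exists a in E, 1 < #|dnbr E mu B a|].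
  have [|c [b [jcb gain]]] := gain3_shared pr _ ltDE aE a2; first by lia.
  by exists c, b; split=> //; left.
have single a : a \in E -> #|dnbr E mu B a| <= 1.
  move=> aE; rewrite leqNgt; apply: contra matching => a2.
  by apply/existsP; exists a; rewrite aE.
have big : #|E| + 2 < 3 * #|dirty E mu B| by lia.
have [|e] := pick_covered pr single (X := set0) _ big; first by rewrite cards0.
rewrite setD0 => eD.
have [u [v [uE vE vu vu' [-> uvB]]]] := dirtyP _ _ _ _ eD.
move=> cov_e; have uN := cov_e u (set21 _ _); have vN := cov_e v (set22 _ _).
have [tuB|tuB] := boolP ([set mu u; mu v] \in B); last first.
  have [a [b [jab gain]]] := gain3_mates pr uE vE vu vu' uvB uN vN tuB.
  by exists a, b; split=> //; left.
have [|f] := pick_covered pr single (X := [set [set u; v]; [set mu u; mu v]]) _ big.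
  by rewrite cards2; case: (_ != _).
rewrite in_setD in_set2 negb_or => /andP[/andP[fe ft] fD].
have [w [z [wE zE zw zw' [fE wzB]]]] := dirtyP _ _ _ _ fD.
rewrite fE in fe ft wzB *.
move=> cov_f; have wN := cov_f w (set21 _ _); have zN := cov_f z (set22 _ _).
have [twB|twB] := boolP ([set mu w; mu z] \in B); last first.
  have [a [b [jab gain]]] := gain3_mates pr wE zE zw zw' wzB wN zN twB.
  by exists a, b; split=> //; left.
have [juw k2 k4] := gain3_twins pr single uE vE vu vu' uvB wE zE zw zw' wzB tuB twB fe ft.
by exists u, w; split=> //; right.
Qed.

End Gain.

(** * Forked paths *)

Section Forked.

Variables (W : finType) (G : {set {set W}} -> Prop) (p1 p2 : W).
Hypothesis p12 : p1 != p2.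
Implicit Types (F : {set W}) (mu nu : W -> W) (M B : {set {set W}}).

Lemma closes_pair mu q p M : p != q ->
  closes G [set q; p] (upd mu q p) M -> [set q; p] \in M -> G M.
Proof.
move=> pq clM qpM; apply: (clM M [:: p]) => //.
  split=> // [u|u|u].
  - by rewrite inE => /eqP->; rewrite set22.
  - by case/set2P=> ->; rewrite !inE /upd ?eqxx ?orbT.
  by rewrite !inE => /eqP->; rewrite /upd (negbTE pq) eqxx eq_sym (negbTE pq).
by rewrite /= /link /= /upd (negbTE pq) eqxx qpM.
Qed.

(** All paths but one have their ends in [F].  The last one has the end [q], and
    thanks to a chord it can be run through from [q] both to [p1] and to
    [p2]. *)
Definition forked F mu q M : Prop :=
  [/\ paired F mu, q \notin F, p1 \notin F, p2 \notin F &
   [/\ q != p1, q != p2,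
   closes G (q |: (p1 |: F)) (upd mu q p1) M &
   closes G (q |: (p2 |: F)) (upd mu q p2) M]].

(** The analogue of [dirty] for forked systems: [q], [p1] and [p2] belong to
    one path. *)
Definition rough F mu q B : {set {set W}} :=
  [set e in B | [exists u in F, exists v in F :|: [set q; p1; p2],
                   [&& v != u, v != mu u & e == [set u; v]]]].

Lemma roughP F mu q B e :
  reflect (exists u v, [/\ u \in F, v \in F :|: [set q; p1; p2], v != u, v != mu u
                          & e = [set u; v] /\ e \in B])
          (e \in rough F mu q B).
Proof.
rewrite inE; apply: (iffP andP).
  case=> eB /existsP[u /andP[uF /existsP[v /and4P[vF vu vu' /eqP euv]]]].
  by exists u, v.
case=> u [v [uF vF vu vu' [euv eB]]]; split=> //.
apply/existsP; exists u; rewrite uF; apply/existsP; exists v.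
by rewrite vF vu vu' euv eqxx.
Qed.

Lemma rough_edge F mu q B u v :
    u \in F -> v \in F :|: [set q; p1; p2] -> v != u -> v != mu u ->
  ([set u; v] \in rough F mu q B) = ([set u; v] \in B).
Proof.
move=> uF vF vu vu'; apply/idP/idP; first by rewrite inE => /andP[].
by move=> uvB; apply/roughP; exists u, v.
Qed.

Lemma card_rough_add F mu q B e : #|rough F mu q (e |: B)| <= #|rough F mu q B|.+1.
Proof.
have /subset_leq_card leX : rough F mu q (e |: B) \subset e |: rough F mu q B.
  apply/subsetP=> e' /roughP[u [v [uF vF vu vu' [e'E]]]].
  by rewrite 2!in_setU1 => /orP[->//|e'B]; apply/orP; right; apply/roughP; exists u, v.
by apply: leq_trans leX _; rewrite cardsU1; case: (_ \notin _).
Qed.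

Lemma paired_ends F mu q p : paired F mu -> q \notin F -> p \notin F -> q != p ->
  paired (q |: (p |: F)) (upd mu q p).
Proof.
move=> [mt ns] qF pF qp; have pq : (p == q) = false by rewrite eq_sym (negbTE qp).
split=> u; rewrite !inE /upd; have [->|uq] := eqVneq u q.
- by rewrite pq !eqxx !orbT.
- have [->|up] := eqVneq u p; first by rewrite !eqxx.
  move=> /= uF; have [u'F u'K] := mt u uF; rewrite u'F !orbT; split=> //.
  have [u'q|_] := eqVneq (mu u) q; first by rewrite -u'q u'F in qF.
  by have [u'p|_] := eqVneq (mu u) p; first by rewrite -u'p u'F in pF.
- by rewrite pq.
have [->|up] := eqVneq u p; first by rewrite (negbTE qp).
exact: ns.
Qed.

Definition shrink F mu r : {set W} := F :\: [set r; mu r].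

Lemma paired_shrink F mu r : paired F mu -> r \in F -> paired (shrink F mu r) mu.
Proof.
move=> [mt ns] rF; split=> u; rewrite !inE negb_or => /andP[/andP[ur ur'] uF]; last exact: ns.
have [u'F u'K] := mt u uF; split=> //; rewrite u'F andbT negb_or.
apply/andP; split; first by apply: contra ur' => /eqP<-; rewrite u'K.
by apply: contra ur => /eqP/(mating_inj mt uF rF)->.
Qed.

Lemma card_shrink F mu r : paired F mu -> r \in F -> #|F| = #|shrink F mu r|.+2.
Proof.
move=> [mt ns] rF; rewrite -(cardsID [set r; mu r] F) (setIidPr _).
  by rewrite cards2 eq_sym ns.
by rewrite subUset !sub1set rF (mt r rF).1.
Qed.

Lemma closes_extend F mu q p r M :
    paired F mu -> q \notin F -> p \notin F -> q != p -> r \in F ->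
    closes G (q |: (p |: F)) (upd mu q p) M ->
  closes G (mu r |: (p |: shrink F mu r)) (upd mu (mu r) p) ([set q; r] |: M).
Proof.
move=> pr qF pF qp rF clM; have [mt ns] := pr; have [r'F r'K] := mt r rF.
have [mt' ns'] := paired_ends pr qF pF qp.
have rq : r != q by apply: contra qF => /eqP<-.
have rp : r != p by apply: contra pF => /eqP<-.
have r'q : mu r != q by apply: contra qF => /eqP<-.
have r'p : mu r != p by apply: contra pF => /eqP<-.
have nuq : upd mu q p q = p by rewrite /upd eqxx.
have nur : upd mu q p r = mu r by rewrite /upd (negbTE rq) (negbTE rp).
have qE : q \in q |: (p |: F) by rewrite setU11.
have rE : r \in q |: (p |: F) by rewrite !inE rF !orbT.
have := closes_join mt' qE rE rq; rewrite nuq nur => /(_ _ _ rp clM).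
apply: closes_eq.
  apply/setP=> u; rewrite (joinEP _ (paired_ends pr qF pF qp)) ?nuq //.
  rewrite !inE negb_or; have [->|uq] := eqVneq u q.
    by rewrite [q == mu r]eq_sym (negbTE r'q) (negbTE qp) (negbTE qF) /= !andbF.
  have [->|ur] := eqVneq u r.
    by rewrite [r == mu r]eq_sym (negbTE (ns r rF)) (negbTE rp).
  by have [->|ur'] := eqVneq u (mu r); rewrite ?r'F ?orbT.
move=> u; rewrite (joinEP _ (paired_ends pr qF pF qp)) ?nuq // => /andP[uq _].
rewrite updC /upd; case: (u == mu r) => //; case: (eqVneq u p) => // _.
by rewrite (negbTE uq).
Qed.

Lemma closes_join_aside F mu q p a b M :
    paired F mu -> q \notin F -> p \notin F -> q != p ->
    a \in F -> b \in F -> b != a -> b != mu a ->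
    closes G (q |: (p |: F)) (upd mu q p) M ->
  closes G (q |: (p |: joinE F mu a b)) (upd (upd mu (mu a) (mu b)) q p)
         ([set a; b] |: M).
Proof.
move=> pr qF pF qp aF bF ba ba' clM; have [mt ns] := pr.
have prE := paired_ends pr qF pF qp; have [mtE nsE] := prE.
have notF u : u \in F -> (u == q) = false /\ (u == p) = false.
  by move=> uF; split; apply/negbTE; [apply: contra qF|apply: contra pF] => /eqP<-.
have nuF u : u \in F -> upd mu q p u = mu u.
  by move=> /notF[uq up]; rewrite /upd uq up.
have aE : a \in q |: (p |: F) by rewrite !inE aF !orbT.
have bE : b \in q |: (p |: F) by rewrite !inE bF !orbT.
have := closes_join mtE aE bE ba; rewrite !nuF // => /(_ _ _ ba' clM).
apply: closes_eq.
  apply/setP=> u; rewrite (joinEP _ prE) ?nuF // !in_setU1 (joinEP _ pr) //.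
  have [[aq ap] [bq bp]] := (notF a aF, notF b bF).
  have [->|_] := eqVneq u q; first by rewrite [q == a]eq_sym [q == b]eq_sym aq bq.
  have [->|_] := eqVneq u p; last by [].
  by rewrite [p == a]eq_sym [p == b]eq_sym ap bp orbT.
have [a'F _] := mt a aF; have [b'F _] := mt b bF.
have [[aq ap] [bq bp]] := (notF _ a'F, notF _ b'F).
move=> u _; rewrite /upd.
have [->|uq] := eqVneq u q; first by rewrite [q == mu a]eq_sym [q == mu b]eq_sym aq bq.
have [->|up] := eqVneq u p; last by [].
by rewrite [p == mu a]eq_sym [p == mu b]eq_sym ap bp.
Qed.

Lemma forked_extend F mu q r M : forked F mu q M -> r \in F ->
  forked (shrink F mu r) mu (mu r) ([set q; r] |: M).
Proof.
case=> pr qF p1F p2F [qp1 qp2 cl1 cl2] rF; have [r'F _] := pr.1 r rF.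
split; first exact: paired_shrink.
- by rewrite !inE eqxx orbT.
- by rewrite inE (negbTE p1F) andbF.
- by rewrite inE (negbTE p2F) andbF.
split.
- by apply: contra p1F => /eqP<-.
- by apply: contra p2F => /eqP<-.
- exact: closes_extend.
exact: closes_extend.
Qed.

Lemma forked_aside F mu q a b M : forked F mu q M ->
    a \in F -> b \in F -> b != a -> b != mu a ->
  forked (joinE F mu a b) (upd mu (mu a) (mu b)) q ([set a; b] |: M).
Proof.
case=> pr qF p1F p2F [qp1 qp2 cl1 cl2] aF bF ba ba'.
have sF := subsetP (joinE_sub pr.1 aF bF).
split; first exact: paired_join.
- by apply: contra qF => /sF.
- by apply: contra p1F => /sF.
- by apply: contra p2F => /sF.
by split=> //; apply: closes_join_aside.
Qed.

Lemma rough_extend F mu q r M B e : forked F mu q M -> r \in F ->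
    e \in rough (shrink F mu r) mu (mu r) B ->
  [/\ e \in rough F mu q B, q \notin e, r \notin e &
      exists2 u, u \in shrink F mu r & u \in e].
Proof.
case=> pr qF p1F p2F [qp1 qp2 _ _] rF.
have [r'F _] := pr.1 r rF.
move=> /roughP[u [v [uF' vF' vu vu' [eE eB]]]].
have := uF'; rewrite in_setD in_set2 negb_or => /andP[/andP[ur ur'] uF].
have [vr vq vF] : [/\ v != r, v != q & v \in F :|: [set q; p1; p2]].
  move: vF'; rewrite !inE negb_or -!orbA => /orP[/andP[/andP[vr vr'] vF]|].
    by rewrite vr vF; split=> //; apply: contra qF => /eqP<-.
  case/or3P=> /eqP->; rewrite ?eqxx ?orbT ?r'F; split=> //.
  - exact: pr.2.
  - by apply: contra qF => /eqP<-.
  - by apply: contra p1F => /eqP->.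
  - by rewrite eq_sym.
  - by apply: contra p2F => /eqP->.
  by rewrite eq_sym.
have uq : u != q by apply: contra qF => /eqP<-.
split.
- by apply/roughP; exists u, v.
- by rewrite eE !inE negb_or ![q == _]eq_sym uq vq.
- by rewrite eE !inE negb_or ![r == _]eq_sym ur vr.
by exists u; rewrite // eE set21.
Qed.

Lemma rough_aside F mu q a b M B e : forked F mu q M ->
    a \in F -> b \in F -> b != a -> b != mu a ->
    e \in rough (joinE F mu a b) (upd mu (mu a) (mu b)) q B ->
  [/\ e \in rough F mu q B, a \notin e & b \notin e].
Proof.
case=> pr qF p1F p2F _ aF bF ba ba'.
have [a'F a'K] := pr.1 a aF; have [b'F b'K] := pr.1 b bF.
move=> /roughP[u [v [+ vF vu vu' [eE eB]]]].
rewrite (joinEP _ pr) // => /and3P[ua ub uF].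
have notF w : w \in F -> w \notin [set q; p1; p2].
  by move=> wF; rewrite !inE !negb_or -andbA; apply/and3P; split;
    [apply: contra qF|apply: contra p1F|apply: contra p2F] => /eqP<-.
have [va vb {}vF] : [/\ v != a, v != b & v \in F :|: [set q; p1; p2]].
  move: vF; rewrite in_setU (joinEP _ pr) // => /orP[/and3P[va vb vF]|vX].
    by rewrite in_setU vF.
  rewrite in_setU vX orbT; split=> //; apply: contraTneq vX => ->; exact: notF.
split.
- apply/roughP; exists u, v; split=> //.
  move: vu'; rewrite /upd; have [->|_] := eqVneq u (mu a); first by rewrite a'K.
  by have [->|//] := eqVneq u (mu b); rewrite b'K.
- by rewrite eE !inE negb_or ![a == _]eq_sym ua va.
by rewrite eE !inE negb_or ![b == _]eq_sym ub vb.
Qed.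

(** Appending the path of [r] at [q] should make Breaker's last edge [e]
    harmless: if [e] contains [q] or [r], one of its ends has become an interior
    vertex, and an edge that avoids [F] cannot be rough. *)
Lemma pick_extension F mu q (e : {set W}) :
    paired F mu -> q \notin F -> #|e| = 2 -> F != set0 ->
  exists r, [/\ r \in F, [set q; r] != e & [|| q \in e, r \in e | [disjoint F & e]]].
Proof.
move=> pr qF e2 /set0Pn[r0 r0F].
have [qe|qe] := boolP (q \in e).
  have [eqr|] := eqVneq [set q; r0] e; last by exists r0; split.
  have [r'F _] := pr.1 r0 r0F; exists (mu r0); split=> //.
  rewrite -eqr; apply/eqP => /eqP/eq_set2P[[_ /eqP]|[qr0 _]].
    by rewrite (negbTE (pr.2 r0 r0F)).
  by move: qF; rewrite qr0 r0F.
have [dis|] := boolP [disjoint F & e].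
  by exists r0; split; rewrite ?dis ?orbT //; apply: contra qe => /eqP<-; rewrite set21.
case/pred0Pn=> r /andP[rF re]; exists r; split=> //.
  by apply: contra qe => /eqP<-; rewrite set21.
by rewrite [r \in e]re.
Qed.

(** Without rough edges, the only obstacle after Breaker's move is his last
    edge.  Appending a path at [q] makes it harmless, so that there are no rough
    edges again.  When all paths are appended, Breaker cannot have both
    the edge from [q] to [p1] and that from [q] to [p2]. *)
Lemma forked_win n F mu q M B :
    #|F| = n.*2 -> forked F mu q M -> rough F mu q B = set0 ->
    (F = set0 -> [set q; p1] \notin B /\ [set q; p2] \notin B) ->
  win G n.+1 M B.
Proof.
elim: n F mu q M B => [|n IHn] F mu q M B cF fk clean last_edge.
  have F0 : F = set0 by apply/eqP; rewrite -cards_eq0 cF.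
  have [q1 q2] := last_edge F0; have [pr qF p1F p2F [qp1 qp2 cl1 cl2]] := fk.
  rewrite F0 !setU0 in cl1 cl2.
  apply: win_round => s t st; pose p := if [set q; p1] == [set s; t] then p2 else p1.
  have qp : q != p by rewrite /p; case: ifP.
  exists q, p; split=> //.
    rewrite in_setU1 negb_or /p; case: ifPn => [/eqP<-|->//]; rewrite q2 andbT.
    by apply: contra p12 => /eqP/eqP/eq_set2P[[_ ->]|[<- ->]].
  left; apply: (@closes_pair mu q p); rewrite ?setU11 1?eq_sym //.
  by rewrite /p; case: ifP => _; apply: closes_sub (subsetUr _ _) _.
have [pr qF p1F p2F [qp1 qp2 cl1 cl2]] := fk.
apply: win_round => s t st.
have [||r [rF qr hit]] := pick_extension (e := [set s; t]) pr qF; first by rewrite cards2 st.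
  by rewrite -card_gt0 cF.
have [r'F _] := pr.1 r rF.
have rq : r != q by apply: contra qF => /eqP<-.
have fresh u v : u \in F -> v \in F :|: [set q; p1; p2] -> v != u -> v != mu u ->
    [set u; v] \notin B.
  by move=> uF vF vu vu'; rewrite -(@rough_edge F mu q B u v) // clean inE.
have r'q : q != mu r by apply: contra qF => /eqP->.
have qrB : [set q; r] \notin B.
  rewrite setUC; apply: fresh; rewrite // 1?eq_sym // !inE eqxx ?orbT //.
exists q, r; split; first by rewrite eq_sym.
  by rewrite in_setU1 negb_or qr.
apply: (IHn (shrink F mu r) mu (mu r)).
- by move: (card_shrink pr rF); rewrite cF doubleS => -[]<-.
- exact: forked_extend.
- apply/setP=> e; rewrite [RHS]inE; apply/negbTE/negP => eR.
  have [eR0 qe re [u uF' ue]] := rough_extend fk rF eR.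
  have e_old : e \notin B.
    apply/negP=> eB; have : e \in rough F mu q B.
      by have /roughP[x [y [xF yF yx yx' [eE _]]]] := eR0; apply/roughP; exists x, y.
    by rewrite clean inE.
  have : e \in [set s; t] |: B by move: eR0; rewrite inE => /andP[].
  rewrite in_setU1 (negbTE e_old) orbF => /eqP est.
  move: hit; rewrite -est (negbTE qe) (negbTE re) /= => /pred0P/(_ u)/=.
  by rewrite ue; move: uF'; rewrite inE => /andP[_ ->].
have tipB p : p != mu r -> p != r -> p != q -> p \notin F -> p \in [set q; p1; p2] ->
    [set mu r; p] \notin [set s; t] |: B.
  move=> pr' p_r pq pF pX; rewrite in_setU1 negb_or fresh //; last 2 first.
  - by rewrite in_setU pX orbT.
  - by rewrite (pr.1 r rF).2.
  rewrite andbT; apply/eqP=> eE; move: hit; rewrite -eE !inE.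
  rewrite (negbTE r'q) [q == p]eq_sym (negbTE pq) eq_sym (negbTE (pr.2 r rF)).
  rewrite [r == p]eq_sym (negbTE p_r) /= => /pred0P/(_ (mu r)).
  by rewrite /= r'F set21.
move=> _; split; apply: tipB; rewrite ?inE ?eqxx ?orbT // 1?eq_sym //.
- by apply: contra p1F => /eqP<-.
- by apply: contra p1F => /eqP<-.
- by apply: contra p2F => /eqP<-.
by apply: contra p2F => /eqP<-.
Qed.

End Forked.

Section ForkedStart.

Variables (W : finType) (G : {set {set W}} -> Prop) (p1 p2 : W).
Hypothesis p12 : p1 != p2.
Implicit Types (F : {set W}) (mu nu : W -> W) (M B : {set {set W}}).

Lemma aside_win n F mu q a b M B :
    #|F| = n.+2.*2 -> forked G p1 p2 F mu q M ->
    a \in F -> b \in F -> b != a -> b != mu a -> [set a; b] \notin B ->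
    (forall e, e \in rough p1 p2 F mu q B -> (a \in e) || (b \in e)) ->
  exists u v, [/\ u != v, [set u; v] \notin B & win G n.+2 ([set u; v] |: M) B].
Proof.
move=> cF fk aF bF ba ba' abB hit; have [pr _ _ _ _] := fk.
exists a, b; split=> //; first by rewrite eq_sym.
have cJ : #|joinE F mu a b| = n.+1.*2 by move: (card_join pr aF bF ba ba'); rewrite cF doubleS => -[]<-.
apply: (forked_win p12 cJ (forked_aside fk aF bF ba ba')).
  apply/setP=> e; rewrite [RHS]inE; apply/negbTE/negP => eR.
  have [/hit + ae be] := rough_aside fk aF bF ba ba' eR.
  by rewrite (negbTE ae) (negbTE be).
by move=> J0; move: cJ; rewrite J0 cards0.
Qed.

Lemma extend_win n F mu q r M B :
    #|F| = n.+2.*2 -> forked G p1 p2 F mu q M -> r \in F -> [set q; r] \notin B ->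
    (forall e u, e \in rough p1 p2 F mu q B -> u \in shrink F mu r -> u \in e ->
       (q \in e) || (r \in e)) ->
  exists u v, [/\ u != v, [set u; v] \notin B & win G n.+2 ([set u; v] |: M) B].
Proof.
move=> cF fk rF qrB hit; have [pr qF _ _ _] := fk.
exists q, r; split=> //; first by apply: contra qF => /eqP->.
have cJ : #|shrink F mu r| = n.+1.*2 by move: (card_shrink pr rF); rewrite cF doubleS => -[]<-.
apply: (forked_win p12 cJ (forked_extend fk rF)).
  apply/setP=> e; rewrite [RHS]inE; apply/negbTE/negP => eR.
  have [eR' qe re [u uF ue]] := rough_extend fk rF eR.
  by have := hit e u eR' uF ue; rewrite (negbTE qe) (negbTE re).
by move=> J0; move: cJ; rewrite J0 cards0.
Qed.

(** One join disposes of two rough edges.  If they have no common end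
    they still offer nonmate ends, except when they lead from the two ends of
    one path to the fork; then that path is appended at [q]. *)
Lemma forked_kill2 n F mu q M B :
    #|F| = n.+2.*2 -> 18 <= #|F| -> forked G p1 p2 F mu q M ->
    #|rough p1 p2 F mu q B| <= 2 ->
  exists u v, [/\ u != v, [set u; v] \notin B & win G n.+2 ([set u; v] |: M) B].
Proof.
move=> cF F18 fk R2; have [pr qF p1F p2F [qp1 qp2 _ _]] := fk; have [mt ns] := pr.
set R := rough _ _ _ _ _ _ in R2.
have [e2 [e3 [sR R0]]] : exists e2 e3, R \subset [set e2; e3] /\
    (R != set0 -> e2 \in R /\ e3 \in R).
  have [->|/set0Pn[e2 e2R]] := eqVneq R set0.
    by exists set0, set0; rewrite sub0set; split=> //; rewrite eqxx.
  have [/eqP R0|/set0Pn[e3]] := boolP (R :\ e2 == set0).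
    exists e2, e2; split=> //; apply/subsetP=> e eR.
    have : e \notin R :\ e2 by rewrite R0 inE.
    by rewrite in_setD1 eR andbT negbK => /eqP->; rewrite set21.
  rewrite in_setD1 => /andP[e32 e3R]; exists e2, e3; split=> //.
  suff : [set e2; e3] == R by move/eqP->.
  rewrite eqEcard cards2 eq_sym e32 R2 andbT subUset !sub1set.
  by rewrite e2R e3R.
have hitR e : e \in R -> e = e2 \/ e = e3.
  by move=> /(subsetP sR)/set2P.
have card2R e : e \in R -> #|e| = 2.
  by case/roughP=> u [v [_ _ vu _ [-> _]]]; rewrite cards2 eq_sym vu.
have fresh (Y : {set W}) : #|Y| <= 8 -> exists2 c, c \in F & c \notin Y /\ mu c \notin Y.
  move=> Y8; have [|c cF' ] := @free_end _ F (Y :|: mu @: Y).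
    have := (leq_card_setU Y (mu @: Y)).1; have := leq_imset_card mu Y; move: Y8 F18.
    move: #|_| #|_| #|_| #|_|; clear; lia.
  rewrite inE negb_or => /andP[cY c'Y]; exists c => //; split=> //.
  by apply: contra c'Y => c'Y; apply/imsetP; exists (mu c); rewrite // (mt c cF').2.
have [R00|/R0[e2R e3R]] := eqVneq R set0.
  have [|a aF _] := fresh set0; first by rewrite cards0.
  have [|b bF []] := fresh [set a; mu a]; first by rewrite cards2; case: (_ != _).
  rewrite !inE !negb_or => /andP[ba ba'] _.
  apply: (aside_win cF fk aF bF ba ba').
    by rewrite -(@rough_edge W p1 p2 F mu q B) -/R ?R00 ?in_set0 // in_setU bF.
  by move=> e; rewrite -/R R00 inE.
have RB u v : u \in F -> v \in F :|: [set q; p1; p2] -> v != u -> v != mu u ->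
    [set u; v] != e2 -> [set u; v] != e3 -> [set u; v] \notin B.
  move=> uF vF vu vu' n2 n3; rewrite -(@rough_edge W p1 p2 F mu q B) //.
  by apply/negP=> /hitR[] eE; [rewrite eE eqxx in n2|rewrite eE eqxx in n3].
have FX u : u \in F -> u \in F :|: [set q; p1; p2] by rewrite inE => ->.
have qX : q \in F :|: [set q; p1; p2] by rewrite !inE eqxx !orbT.
have shared v : (v == q) || (v \in F) -> v \in e2 -> v \in e3 ->
    exists u v, [/\ u != v, [set u; v] \notin B & win G n.+2 ([set u; v] |: M) B].
  move=> vF ve2 ve3; have [|c cF' [cY c'Y]] := fresh (e2 :|: e3 :|: [set v; mu v]).
    have := (leq_card_setU (e2 :|: e3) [set v; mu v]).1.
    have := (leq_card_setU e2 e3).1; rewrite (card2R e2) // (card2R e3) // cards2.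
    by move: #|_| #|_| (_ != _); clear=> x y []; lia.
  move: cY; rewrite !in_setU !negb_or in_set1 in_set1.
  move=> /andP[/andP[ce2 ce3] /andP[cv cv']].
  have [vq|vq] := eqVneq v q.
    apply: (extend_win cF fk cF'); last by move=> e u /hitR[]->; rewrite -vq ?ve2 ?ve3.
    rewrite setUC; apply: RB => //.
    - by apply: contra qF => /eqP->.
    - by apply: contra c'Y => /eqP<-; rewrite -vq !inE ve2.
    - by apply: contra ce2 => /eqP<-; rewrite set21.
    by apply: contra ce3 => /eqP<-; rewrite set21.
  rewrite (negbTE vq) /= in vF.
  apply: (aside_win cF fk vF cF' cv cv'); last by move=> e /hitR[]->; rewrite ?ve2 ?ve3.
  apply: RB; rewrite ?FX //.
    by apply: contra ce2 => /eqP<-; rewrite set22.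
  by apply: contra ce3 => /eqP<-; rewrite set22.
have [a [s [aF sX sa sa' [e2E _]]]] := roughP _ _ _ _ _ _ _ e2R.
have [b [t [bF tX tb tb' [e3E _]]]] := roughP _ _ _ _ _ _ _ e3R.
have ae2 : a \in e2 by rewrite e2E set21.
have be3 : b \in e3 by rewrite e3E set21.
have se2 : s \in e2 by rewrite e2E set22.
have te3 : t \in e3 by rewrite e3E set22.
have sep u v : u \in F -> v \in F -> u \in e2 -> v \in e3 -> v != mu u ->
    exists u v, [/\ u != v, [set u; v] \notin B & win G n.+2 ([set u; v] |: M) B].
  move=> uF vF ue2 ve3 vu'.
  have [ue3|ue3] := boolP (u \in e3); first by apply: (shared u); rewrite ?uF ?orbT.
  have [ve2|ve2] := boolP (v \in e2); first by apply: (shared v); rewrite ?vF ?orbT.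
  have vu : v != u by apply: contra ue3 => /eqP<-.
  apply: (aside_win cF fk uF vF vu vu'); last first.
    by move=> e /hitR[]->; rewrite ?ue2 ?ve3 ?orbT.
  apply: RB; rewrite ?FX //.
    by apply: contra ve2 => /eqP<-; rewrite set22.
  by apply: contra ue3 => /eqP<-; rewrite set21.
have [ba'|ba'] := eqVneq b (mu a); last exact: (sep a b).
have [sF|sF] := boolP (s \in F).
  apply: (sep s b) => //; rewrite ba'; apply: contra sa => /eqP/(mating_inj mt aF sF)->.
  by [].
have [tF|tF] := boolP (t \in F); first by apply: (sep a t); rewrite // -ba'.
have aq : a != q by apply: contra qF => /eqP<-.
have bq : b != q by apply: contra qF => /eqP<-.
have ab : a != b by rewrite eq_sym ba' ns.
have [qe2|qe2] := boolP (q \in e2).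
  have [qe3|qe3] := boolP (q \in e3); first by apply: (shared q); rewrite ?eqxx.
  apply: (extend_win cF fk bF); last by move=> e u /hitR[]->; rewrite ?qe2 ?be3 ?orbT.
  rewrite setUC; apply: RB => //; first by rewrite eq_sym.
  - by apply: contra qF => /eqP->; exact: (mt b bF).1.
  - apply/eqP=> eE; have : b \in e2 by rewrite -eE set21.
    rewrite e2E !inE eq_sym (negbTE ab) => /eqP bs.
    by rewrite -bs bF in sF.
  by apply: contra qe3 => /eqP<-; rewrite set22.
apply: (extend_win cF fk aF).
  rewrite setUC; apply: RB => //; first by rewrite eq_sym.
  - by apply: contra qF => /eqP->; exact: (mt a aF).1.
  - by apply: contra qe2 => /eqP<-; rewrite set22.
  apply/eqP=> eE; have : a \in e3 by rewrite -eE set21.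
  rewrite e3E !inE (negbTE ab) => /eqP at_.
  by rewrite -at_ aF in tF.
move=> e u /hitR[]-> uF; rewrite ?ae2 ?orbT //.
move: uF; rewrite inE !inE negb_or => /andP[/andP[ua ua'] uF].
rewrite e3E !inE ba' (negbTE ua') /= => /eqP ut.
by rewrite -ut uF in tF.
Qed.

Lemma forked_start n F mu q M B :
    #|F| = n.+2.*2 -> 18 <= #|F| -> forked G p1 p2 F mu q M ->
    #|rough p1 p2 F mu q B| <= 1 ->
  win G n.+3 M B.
Proof.
move=> cF F18 fk R1; apply: win_round => s t st.
apply: (forked_kill2 cF F18 fk).
by apply: leq_trans (card_rough_add _ _ _ _ _ _ _) _.
Qed.

End ForkedStart.

(** * Linking up paths that have two ends *)

Section Endgame.

Variables (W : finType) (G : {set {set W}} -> Prop).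
Implicit Types (E F : {set W}) (mu nu : W -> W) (M B : {set {set W}}).

Lemma in_shrink E mu r u : (u \in shrink E mu r) = [&& u != r, u != mu r & u \in E].
Proof. by rewrite inE in_set2 negb_or -andbA. Qed.

(** The join of [r] and [b], in the form in which it occurs in forked
    systems. *)
Lemma closes_append E mu r b M :
    paired E mu -> r \in E -> b \in E -> b != r -> b != mu r ->
    [set r; b] \in M -> closes G E mu M ->
  closes G (mu r |: (mu b |: shrink (shrink E mu r) mu b)) (upd mu (mu r) (mu b)) M.
Proof.
move=> pr rE bE br br' rbM clM; have [mt ns] := pr.
have := closes_join mt rE bE br br' clM.
rewrite (setUidPr _) ?sub1set //; apply: closes_eq => //.
have [r'E r'K] := mt r rE; have [b'E b'K] := mt b bE.
apply/setP=> u; rewrite (joinEP _ pr) // !in_setU1 !in_shrink.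
have [->|_] := eqVneq u (mu r).
  by rewrite ns // r'E eq_sym br'.
have [->|_] := eqVneq u (mu b); last first.
  by case: (u == r); case: (u == b); rewrite /= ?andbF.
rewrite ns // b'E orbT !andbT.
by apply: contra br' => /eqP<-; rewrite b'K.
Qed.

Lemma closes_append2 E mu r b c M :
    paired E mu -> r \in E -> b \in shrink E mu r -> c \in shrink (shrink E mu r) mu b ->
    [set r; b] \in M -> [set mu b; c] \in M -> closes G E mu M ->
  closes G (mu r |: (mu c |: shrink (shrink (shrink E mu r) mu b) mu c))
         (upd mu (mu r) (mu c)) M.
Proof.
move=> pr rE bE' cE' rbM bcM clM; have [mt ns] := pr.
have pr1 := paired_shrink pr rE; have pr2 := paired_shrink pr1 bE'.
have [c'E' _] := pr2.1 c cE'.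
move: (bE') (cE') (c'E'); rewrite !in_shrink => /and3P[br br' bE].
move=> /and3P[cb cb' /and3P[cr cr' cE]] /and3P[c'b c'b' /and3P[c'r c'r' c'E]].
have [r'E r'K] := mt r rE; have [b'E b'K] := mt b bE; have [_ c'K] := mt c cE.
have b'r : mu b != r by apply: contra br' => /eqP<-; rewrite b'K.
have b'r' : mu b != mu r by apply: contra br => /eqP/(mating_inj mt bE rE)->.
have := closes_append pr rE bE br br' rbM clM.
set E1 := mu r |: _; set mu1 := upd _ _ _ => cl1.
have pr1' : paired E1 mu1.
  apply: paired_ends => //; last by rewrite eq_sym.
    by rewrite !in_shrink eqxx !andbF.
  by rewrite in_shrink eqxx andbF.
have mu1b : mu1 (mu b) = mu r by rewrite /mu1 /upd (negbTE b'r') eqxx.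
have mu1c : mu1 c = mu c by rewrite /mu1 /upd (negbTE cr') (negbTE cb').
have b'E1 : mu b \in E1 by rewrite /E1 !in_setU1 eqxx orbT.
have cE1 : c \in E1 by rewrite !in_setU1 cE' !orbT.
have := @closes_append E1 mu1 (mu b) c M pr1' b'E1 cE1 cb'.
rewrite mu1b mu1c => /(_ cr' bcM cl1).
apply: closes_eq.
  apply/setP=> u; rewrite !in_setU1 !in_shrink !in_setU1 !in_shrink mu1b mu1c.
  have [//|_] := eqVneq u (mu r); have [//|_] := eqVneq u (mu c).
  by have [->|_] := eqVneq u (mu b); rewrite ?andbF.
move=> u; rewrite !in_setU1 !in_shrink mu1b mu1c /mu1 /upd.
case: (u == mu r) => //; case: (u == mu c) => //=.
by case: (u == mu b); rewrite ?andbF.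
Qed.

Lemma rough_sub p1 p2 E F mu q B :
    dirty E mu B = set0 -> F :|: [set q; p1; p2] \subset E ->
  rough p1 p2 F mu q B = set0.
Proof.
move=> clean /subsetP sE; apply/setP=> e; rewrite [RHS]inE; apply/negbTE/negP.
move=> /roughP[u [v [uF vF vu vu' [eE eB]]]].
have : e \in dirty E mu B.
  by apply/dirtyP; exists u, v; split=> //; apply: sE; rewrite // inE uF.
by rewrite clean inE.
Qed.

Lemma rough_harmless p1 p2 E F mu q r B (e : {set W}) :
    F :|: [set q; p1; p2] \subset E -> r \notin F :|: [set q; p1; p2] ->
    (r \in e) || [disjoint E & e] ->
  rough p1 p2 F mu q (e |: B) \subset rough p1 p2 F mu q B.
Proof.
move=> sE rF hit; apply/subsetP=> e' /roughP[u [v [uF vF vu vu' [e'E e'B]]]].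
apply/roughP; exists u, v; split=> //; split=> //.
case/setU1P: e'B => [e'e|//]; case/orP: hit => [re|/pred0P/(_ u)/=].
  move: re; rewrite -e'e e'E => /set2P[] eq_r; move: rF; rewrite eq_r.
    by rewrite inE uF.
  by rewrite vF.
by rewrite (subsetP sE) 1?inE ?uF // -e'e e'E set21.
Qed.

(** Maker joins [r] and [b].  The chord from [r] to [mu b] would close a cycle
    through the path of [b], which can be left at [b] or at [mu b].  If Breaker
    claims this chord, Maker joins [mu b] with a further end [c].  Now the chords
    from [mu b] to [mu c] and from [r] to [mu c] both create a fork, with the last
    ends [c], [mu c] and [b], [mu c]; Breaker cannot claim both.  The vertex [r]
    meets Breaker's first edge whenever possible, and the chord he claims contains
    it as well, so at most the last of his edges is not harmless. *)
Lemma clean_win K E mu M B :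
    paired E mu -> #|E| = K.*2 -> 15 <= K -> closes G E mu M ->
    dirty E mu B = set0 ->
  win G K.+1 M B.
Proof.
case: K => [|[|[|[|[|n]]]]] // pr cE K15 clM clean; have [mt ns] := pr.
apply: win_round => s t st; set e1 := [set s; t]; set B1 := e1 |: B.
have ce1 : #|e1| = 2 by rewrite cards2 st.
have freeB u v : u \in E -> v \in E -> v != u -> v != mu u -> [set u; v] \notin B.
  by move=> uE vE vu vu'; rewrite -(@dirty_edge W E mu B) // clean inE.
have [r rE hit] : exists2 r, r \in E & (r \in e1) || [disjoint E & e1].
  have [dis|/pred0Pn[r /andP[rE re1]]] := boolP [disjoint E & e1].
    have /card_gt0P[r rE] : 0 < #|E| by rewrite cE.
    by exists r; rewrite // orbT.
  by exists r; rewrite // [r \in e1]re1.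
have [r'E r'K] := mt r rE.
have prr := paired_shrink pr rE; have cr := card_shrink pr rE.
have fresh F : paired F mu -> 4 < #|F| ->
    exists b, [/\ b \in F, b \notin e1 & mu b \notin e1].
  move=> [mtF _] F4; have [|b bF] := @free_end _ F (e1 :|: mu @: e1).
    apply: leq_ltn_trans F4; apply: leq_trans (leq_card_setU _ _) _.
    by rewrite ce1 (leq_add2l 2 _ 2) -ce1 leq_imset_card.
  rewrite inE negb_or => /andP[be b'e]; exists b; split=> //.
  by apply: contra b'e => b'e; apply/imsetP; exists (mu b); rewrite // (mtF b bF).2.
have [|b [bE' be1 b'e1]] := fresh _ prr; first by move: cr; rewrite cE; clear; lia.
have prb := paired_shrink prr bE'; have cb := card_shrink prr bE'.
have [b'E' b'K] := prr.1 b bE'.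
move: (bE') (b'E'); rewrite !in_shrink => /and3P[br br' bE] /and3P[b'r b'r' b'E].
exists r, b; split; first by rewrite eq_sym.
  rewrite in_setU1 negb_or freeB // andbT; apply: contra be1 => /eqP<-.
  by rewrite set22.
set M1 := _ |: M; apply: win_round => s2 t2 st2.
set e2 := [set s2; t2]; set B2 := e2 |: _.
have [e2E|e2E] := eqVneq e2 [set r; mu b]; last first.
  exists r, (mu b); split; first by rewrite eq_sym.
    rewrite !in_setU1 !negb_or eq_sym e2E freeB // andbT.
    by apply: contra b'e1 => /eqP<-; rewrite set22.
  set M2 := _ |: M1; set F := shrink (shrink E mu r) mu b.
  have fk : forked G (mu b) b F mu (mu r) M2.
    split=> //; rewrite ?in_shrink ?eqxx ?andbF //.
    have clM2 : closes G E mu M2.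
      by apply: closes_sub clM; rewrite /M2 /M1 setUA; apply: subsetUr.
    split; rewrite 1?eq_sym //.
      by apply: closes_append; rewrite // !inE eqxx !orbT.
    rewrite -[X in upd mu (mu r) X]b'K -[X in (X |: F)]b'K.
    have -> : F = shrink (shrink E mu r) mu (mu b).
      by apply/setP=> u; rewrite !in_shrink b'K [RHS]andbCA.
    by apply: closes_append; rewrite // setU11.
  have cF : #|F| = n.+3.*2 by move: cr cb; rewrite cE -/F; clear; lia.
  apply: (forked_start (ns b bE) cF _ fk); first by rewrite cF; move: K15; clear; lia.
  have sFE : F :|: [set mu r; mu b; b] \subset E.
    apply/subsetP=> u; rewrite in_setU => /orP[|].
      by rewrite !in_shrink => /and3P[_ _ /and3P[]].
    by rewrite !inE -orbA => /or3P[]/eqP->.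
  have rF : r \notin F :|: [set mu r; mu b; b].
    rewrite in_setU !in_shrink eqxx !andbF !inE !negb_or.
    by rewrite eq_sym ns // eq_sym b'r eq_sym br.
  apply: leq_trans (card_rough_add _ _ _ _ _ _ _) _.
  rewrite (eqP (_ : rough _ _ _ _ _ _ == set0)) ?cards0 // -subset0.
  by rewrite -(rough_sub clean sFE); apply: rough_harmless sFE rF hit.
have [|c [cE' cne1 c'ne1]] := fresh _ prb; first by move: cr cb; rewrite cE; clear; lia.
have prc := paired_shrink prb cE'; have cc := card_shrink prb cE'.
have [c'E' c'K] := prb.1 c cE'.
move: (cE') (c'E'); rewrite !in_shrink => /and3P[cb0 cb' /and3P[c_r cr' cE0]].
move=> /and3P[c'b c'b' /and3P[c'r c'r' c'E]].
have {}e2E : [set s2; t2] = [set r; mu b] by [].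
exists (mu b), c; split; first by rewrite eq_sym.
  rewrite !in_setU1 !negb_or -/e2 /e2 e2E freeB //; last by rewrite b'K.
  rewrite andbT; apply/andP; split.
    by apply/negP=> /eq_set2P[][eqb eqc]; [rewrite eqc eqxx in cb'|rewrite eqc eqxx in c_r].
  by apply: contra cne1 => /eqP<-; rewrite set22.
set M2 := _ |: M1; apply: win_round => s3 t3 st3.
set e3 := [set s3; t3]; set B3 := e3 |: _.
set F := shrink (shrink (shrink E mu r) mu b) mu c.
have cF : #|F| = n.+2.*2 by move: cr cb cc; rewrite cE -/F; clear; lia.
have finish M3 p : M2 \subset M3 -> p \in E -> p != r -> p != mu r -> p != mu c ->
    p \notin F -> closes G (mu r |: (p |: F)) (upd mu (mu r) p) M3 -> win G n.+3 M3 B3.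
  move=> sM23 pE p_r pr' pc' pF clp.
  have fk : forked G (mu c) p F mu (mu r) M3.
    split=> //; rewrite ?in_shrink ?eqxx ?andbF //.
    split; rewrite 1?eq_sym //; apply: closes_append2 => //.
    - by apply: (subsetP sM23); rewrite !in_setU1 eqxx orbT.
    - by apply: (subsetP sM23); rewrite !in_setU1 eqxx.
    apply: closes_sub clM; apply: subset_trans sM23.
    by rewrite /M2 /M1 setUA; apply: subsetUr.
  apply: (forked_start _ cF _ fk); [by rewrite eq_sym | by rewrite cF; move: K15; clear; lia | ].
  have sFE : F :|: [set mu r; mu c; p] \subset E.
    apply/subsetP=> u; rewrite in_setU => /orP[|].
      by rewrite !in_shrink => /and3P[_ _ /and3P[_ _ /and3P[]]].
    by rewrite !inE -orbA => /or3P[]/eqP->.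
  have rF : r \notin F :|: [set mu r; mu c; p].
    rewrite in_setU !in_shrink eqxx !andbF !inE !negb_or.
    by rewrite eq_sym ns // eq_sym c'r eq_sym p_r.
  apply: leq_trans (card_rough_add _ _ _ _ _ _ _) _.
  rewrite (eqP (_ : rough _ _ _ _ _ _ == set0)) ?cards0 // -subset0.
  rewrite -(rough_sub clean sFE).
  apply: subset_trans (rough_harmless _ _ sFE rF hit).
  by apply: rough_harmless sFE rF _; rewrite /e2 e2E set21.
have [e3E|e3E] := eqVneq e3 [set mu b; mu c].
  exists r, (mu c); split; first by rewrite eq_sym.
    rewrite !in_setU1 !negb_or freeB // andbT e3E /e2 e2E; apply/and3P; split.
    - by apply/negP=> /eq_set2P[][eqr _];
        [rewrite -eqr eqxx in b'r|rewrite -eqr eqxx in c'r].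
    - by apply/negP=> /eq_set2P[[_ eqc]|[eqr _]];
        [rewrite eqc eqxx in c'b'|rewrite -eqr eqxx in b'r].
    by apply: contra c'ne1 => /eqP<-; rewrite set22.
  apply: (finish _ b); rewrite ?subsetUr ?in_shrink ?eqxx ?andbF // 1?eq_sym //.
  rewrite -[X in upd mu (mu r) X]b'K -[X in (X |: F)]b'K.
  have -> : F = shrink (shrink (shrink E mu r) mu (mu c)) mu (mu b).
    apply/setP=> u; rewrite !in_shrink b'K c'K.
    by do 4!case: (u == _); rewrite ?andbF.
  apply: closes_append2; rewrite // ?c'K.
  - by rewrite in_shrink c'r c'r'.
  - by rewrite !in_shrink c'K b'r b'r' eq_sym c'b' eq_sym cb'.
  - by rewrite setU11.
  - by rewrite setUC !in_setU1 eqxx orbT.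
  apply: closes_sub clM; apply/subsetP=> e eM; by rewrite !in_setU1 eM !orbT.
exists (mu b), (mu c); split; first by rewrite eq_sym.
  rewrite !in_setU1 !negb_or eq_sym e3E freeB //; last by rewrite b'K.
  rewrite andbT /= /e2 e2E; apply/andP; split.
    by apply/negP=> /eq_set2P[[eqr _]|[_ eqc]];
      [rewrite eqr eqxx in b'r|rewrite eqc eqxx in c'r].
  by apply: contra c'ne1 => /eqP<-; rewrite set22.
apply: (finish _ c); rewrite ?subsetUr ?in_shrink ?eqxx ?andbF // 1?eq_sym //.
  exact: ns.
rewrite -[X in upd mu (mu r) X]c'K -[X in (X |: F)]c'K.
have -> : F = shrink (shrink (shrink E mu r) mu b) mu (mu c).
  by apply/setP=> u; rewrite !in_shrink c'K [RHS]andbCA.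
apply: closes_append2; rewrite // ?in_shrink ?c'b ?c'b' ?c'r //.
- by rewrite !in_setU1 eqxx !orbT.
- by rewrite setU11.
apply: closes_sub clM; apply/subsetP=> e eM; by rewrite !in_setU1 eM !orbT.
Qed.

(** With fewer dirty edges than paths, each join disposes of two of them
    against Breaker's one, so that they run out before the paths do. *)
Lemma few_dirty_win K E mu M B :
    paired E mu -> #|E| = K.*2 -> 15 <= K -> closes G E mu M ->
    #|dirty E mu B| + 15 <= K ->
  win G K.+1 M B.
Proof.
elim: K E mu M B => // K IHK E mu M B pr cE K15 clM DK.
have [/eqP D0|D0] := boolP (dirty E mu B == set0); first exact: (clean_win pr cE).
rewrite -card_gt0 in D0; apply: win_round => s t st; set B1 := _ |: B.
have leD1 : #|dirty E mu B1| <= #|dirty E mu B|.+1 by apply: card_dirty_add.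
have leD0 : #|dirty E mu B| <= #|dirty E mu B1|.
  apply/subset_leq_card/subsetP=> e /dirtyP[u [v [uE vE vu vu' [eE eB]]]].
  by apply/dirtyP; exists u, v; split=> //; split=> //; apply: setU1r.
have [a [b [[aE bE ba ba' abB] leD]]] : exists a b, joinable E mu B1 a b /\
    #|dirty (joinE E mu a b) (upd mu (mu a) (mu b)) B1| < #|dirty E mu B|.
  have [D1|D1] := leqP #|dirty E mu B1| 1.
    have [||a [b [jab kill]]] := @kill1 _ E mu B1 pr.
    - exact: leq_trans leD0.
    - by rewrite cE; move: D1 K15; clear; lia.
    by exists a, b; split=> //; move: D0 D1 kill; clear; lia.
  have [|a [b [jab kill]]] := @kill2 _ E mu B1 pr D1.
    by rewrite cE; move: leD1 DK; clear; lia.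
  by exists a, b; split=> //; move: leD1 kill; clear; lia.
exists a, b; split=> //; first by rewrite eq_sym.
apply: (IHK (joinE E mu a b) (upd mu (mu a) (mu b))).
- exact: paired_join.
- by move: (card_join pr aE bE ba ba'); rewrite cE; clear; lia.
- by move: DK D0; clear; lia.
- by apply: closes_join => //; apply: pr.1.
by move: DK leD; clear; lia.
Qed.

Lemma card_twinned_add E mu B e : mating E mu ->
  #|twinned E mu (e |: B)| <= #|twinned E mu B| + 2.
Proof.
move=> mt; have /subset_leq_card le_tw :
    twinned E mu (e |: B) \subset twinned E mu B :|: [set e; mu @: e].
  apply/subsetP=> f; rewrite {1}/twinned in_set => /andP[fD tD].
  rewrite in_setU in_set2; have old g : g \in dirty E mu (e |: B) -> g != e -> g \in dirty E mu B.
    by move=> /(subsetP (dirty_add _ _ _ _)); rewrite in_setU1 => /orP[->|].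
  have [//|fe /=] := eqVneq f e; first by rewrite orbT.
  have [tfe|tfe] := eqVneq (mu @: f) e.
    have -> : f = mu @: e; last by rewrite eqxx orbT.
    rewrite -tfe -imset_comp; have /dirtyP[u [v [uE vE _ _ [-> _]]]] := fD.
    by rewrite imset2_set2 /= (mt u uE).2 (mt v vE).2.
  by rewrite inE !old.
apply: leq_trans le_tw _; apply: leq_trans (leq_card_setU _ _) _.
by rewrite leq_add2l cards2; case: (_ != _).
Qed.

Lemma twinned_sub E mu B : #|twinned E mu B| <= #|dirty E mu B|.
Proof. by apply/subset_leq_card/subsetP=> e; rewrite inE => /andP[]. Qed.

(** Number of paths that suffices to work off a surplus of [g] dirty edges:
    between two decreases of the surplus, each pair of twins may cost a path,
    and there are at most half as many pairs as dirty edges. *)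
Fixpoint spare (g : nat) : nat := if g is g'.+1 then (spare g').*2 + g + 40 else 60.

Lemma spare_ge g : g + 60 <= spare g.
Proof. by elim: g => //= g; lia. Qed.

(** Induction on the surplus [g] of dirty edges over paths.  Between two
    decreases of [g] every round breaks up two pairs of twins while Breaker can
    make only one, so that [t] decreases. *)
Lemma many_dirty_win g t K E mu M B :
    paired E mu -> #|E| = K.*2 -> closes G E mu M ->
    #|dirty E mu B| + 15 <= K + g -> #|twinned E mu B| <= t.*2 -> t + spare g <= K ->
  win G K.+1 M B.
Proof.
elim: g t K E mu M B => [|g IHg] t K E mu M B.
  rewrite addn0 => pr cE clM DK _ tK; apply: few_dirty_win pr cE _ clM DK.
  by move: tK; clear => /=; lia.
elim/ltn_ind: t K E mu M B => t IHt [|K] E mu M B pr cE clM DK tw tK.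
  by move: tK; clear => /=; lia.
have sg := spare_ge g; rewrite /= in tK.
apply: win_round => p q pq; set B1 := _ |: B.
have leD1 : #|dirty E mu B1| <= #|dirty E mu B|.+1 by apply: card_dirty_add.
have letw1 := card_twinned_add B [set p; q] pr.1; rewrite -/B1 in letw1.
have play a b : joinable E mu B1 a b ->
    (forall M', closes G (joinE E mu a b) (upd mu (mu a) (mu b)) M' ->
       paired (joinE E mu a b) (upd mu (mu a) (mu b)) ->
       #|joinE E mu a b| = K.*2 -> win G K.+1 M' B1) ->
    exists u v, [/\ u != v, [set u; v] \notin B1 & win G K.+1 ([set u; v] |: M) B1].
  case=> aE bE ba ba' abB goal; exists a, b; split=> //; first by rewrite eq_sym.
  apply: goal; first by apply: closes_join => //; apply: pr.1.
    exact: paired_join.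
  by move: (card_join pr aE bE ba ba'); rewrite cE doubleS => -[].
have [KD|DK1] := leqP K.+1 (#|dirty E mu B1| + 14).
  have [|||a [b [jab gain]]] := @gain3 _ E mu B1 pr.
  - by rewrite cE leq_double.
  - by rewrite cE; move: leD1 DK tK sg; clear; lia.
  - by rewrite cE; move: tK sg; clear; lia.
  apply: (play a b jab) => M' clM' pr' cE'.
  have letD := twinned_sub (joinE E mu a b) (upd mu (mu a) (mu b)) B1.
  case: gain => [k3|[k2 k4]].
    apply: (IHg (uphalf #|dirty (joinE E mu a b) (upd mu (mu a) (mu b)) B1|)
                 K _ _ _ _ pr' cE' clM').
    - by move: k3 leD1 DK; clear; lia.
    - by move: letD; clear; lia.
    by move: k3 leD1 DK tK sg; clear; lia.
  apply: (IHt t.-1 _ K _ _ _ _ pr' cE' clM').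
  - by move: k4 letw1 tw; clear; lia.
  - by move: k2 leD1 DK; clear; lia.
  - by move: k4 letw1 tw; clear; lia.
  by move: k4 letw1 tw tK; rewrite /=; clear; lia.
have [D1|D1] := leqP #|dirty E mu B1| 1.
  have /card_gt0P[a aE] : 0 < #|E| by rewrite cE.
  have [|b jab] := @free_partner W E mu B1 a aE.
    have := card_dnbr mu B1 aE; rewrite cE; move: D1 tK sg; clear; lia.
  have [_ bE ba ba' _] := jab.
  apply: (play a b jab) => M' clM' pr' cE'.
  apply: few_dirty_win pr' cE' _ clM' _; first by move: tK sg; clear; lia.
  have := @dirty_join_kill W E mu B1 a b set0 pr aE bE ba ba' (sub0set _).
  rewrite cards0 addn0 => le.
  have {}le := le (fun e eX => False_ind _ (notF (etrans (esym (in_set0 e)) eX))).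
  by move: le D1 tK sg; clear; lia.
have [|a [b [jab kill]]] := @kill2 _ E mu B1 pr D1.
  by rewrite cE; move: DK1 tK sg; clear; lia.
apply: (play a b jab) => M' clM' pr' cE'.
apply: few_dirty_win pr' cE' _ clM' _; first by move: tK sg; clear; lia.
by move: kill DK1; clear; lia.
Qed.

End Endgame.

(** * Building Hamilton paths *)

Section Singles.

Variables (W : finType) (G : {set {set W}} -> Prop).
Implicit Types (E F : {set W}) (mu nu : W -> W) (M B : {set {set W}}).

Definition singles E mu : {set W} := [set u in E | mu u == u].

Lemma dirty_join_sub E mu B a b :
    mating E mu -> a \in E -> b \in E -> b != a -> b != mu a ->
  dirty (joinE E mu a b) (upd mu (mu a) (mu b)) B \subset dirty E mu B.
Proof.
by move=> mt aE bE ba ba'; apply/subsetP=> e /(dirty_join mt aE bE ba ba')[].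
Qed.

(** Breaker's edges from [u] to [X] are dirty and lie in [u |: X]. *)
Lemma nonadjacent E mu B (X : {set W}) u :
    u \in E -> X \subset E -> u \notin X -> mu u \notin X ->
    #|[set e in dirty E mu B | e \subset u |: X]| < #|X| ->
  exists2 v, v \in X & [set u; v] \notin B.
Proof.
move=> uE sXE uX u'X lt; have [|v vX nv] := @free_end _ X [set v in X | [set u; v] \in B].
  apply: leq_ltn_trans lt; rewrite -(card_in_imset (f := fun v => [set u; v])).
    apply/subset_leq_card/subsetP=> _ /imsetP[v + ->]; rewrite inE => /andP[vX vB].
    rewrite inE dirty_edge ?vB //; last by apply: contra u'X => /eqP<-.
    - by rewrite subUset !sub1set setU11 !inE vX orbT.
    - exact: (subsetP sXE).
    by apply: contra uX => /eqP<-.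
  move=> v w; rewrite !inE => /andP[vX _] _ /eqP/eq_set2P[[]//|[_ vu]].
  by rewrite -vu vX in uX.
by exists v => //; move: nv; rewrite inE vX.
Qed.

(** There are more ends of longer paths than dirty edges, so each single vertex
    finds one that Breaker has not joined to it.  During these [s] rounds the
    number of longer paths does not change, and Breaker adds [s] dirty edges. *)
Lemma attach_win g s K E mu M B :
    mating E mu -> #|singles E mu| = s -> #|E| = s + K.*2 -> closes G E mu M ->
    #|dirty E mu B| + 15 + s <= K + g -> (spare g).*2 + g + 2 <= K ->
  win G (K + s).+1 M B.
Proof.
have sg := spare_ge g.
elim: s E mu M B => [|s IHs] E mu M B mt cS cE clM DK gK.
  have pr : paired E mu.
    split=> // u uE; have : u \notin singles E mu by rewrite (cards0_eq cS) inE.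
    by rewrite inE uE.
  rewrite addn0; rewrite !addn0 in cE DK.
  apply: (@many_dirty_win _ G g (uphalf #|dirty E mu B|) K _ _ _ _ pr) => //.
    by have := twinned_sub E mu B; clear; lia.
  by move: DK gK; clear; lia.
have /card_gt0P[u] : 0 < #|singles E mu| by rewrite cS.
rewrite inE => /andP[uE /eqP u'u].
rewrite addnS; apply: win_round => p q pq; set B1 := _ |: B.
have leD1 : #|dirty E mu B1| <= #|dirty E mu B|.+1 by apply: card_dirty_add.
set X := E :\: singles E mu.
have sS : singles E mu \subset E by apply/subsetP=> v; rewrite inE => /andP[].
have cX : #|X| = K.*2.
  have := cardsID (singles E mu) E; rewrite (setIidPr sS) cS cE -/X; clear; lia.
have uX : u \notin X by rewrite !inE uE u'u eqxx.
have [|||||b bX ubB] := @nonadjacent E mu B1 X u; rewrite ?u'u ?subsetDl //.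
  apply: leq_ltn_trans (_ : #|dirty E mu B1| < _).
    by apply/subset_leq_card/subsetP=> e; rewrite inE => /andP[].
  by rewrite cX; move: leD1 DK gK sg; clear; lia.
have /andP[bE b'b] : (b \in E) && (mu b != b).
  by move: bX; rewrite !inE; case: (b \in E); rewrite //= andbT.
have bu : b != u by apply: contra uX => /eqP<-.
have bu' : b != mu u by rewrite u'u.
exists u, b; split=> //; first by rewrite eq_sym.
have [b'E b'K] := mt b bE.
have b'u : mu b != u by apply: contra bu => /eqP b'u; rewrite -b'K b'u u'u.
have E'E : joinE E mu u b = E :\ b.
  apply/setP=> v; rewrite !inE u'u negb_or.
  have [->|vu] := eqVneq v u; first by rewrite eq_sym bu uE.
  by have [->|_] := eqVneq v (mu b); rewrite ?b'b ?b'E ?orbT ?orbF.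
apply: (IHs (joinE E mu u b) (upd mu (mu u) (mu b))) => //.
- exact: mating_join.
- have -> : singles (joinE E mu u b) (upd mu (mu u) (mu b)) = singles E mu :\ u.
    apply/setP=> v; rewrite [LHS]inE E'E !inE /upd u'u.
    have [->|vu] := eqVneq v u; first by rewrite ?eqxx /= (negbTE b'u) andbF.
    have [->|vb'] := eqVneq v (mu b).
      by rewrite /= b'K [u == _]eq_sym [b == _]eq_sym (negbTE b'u) (negbTE b'b) !andbF.
    by have [->|_] := eqVneq v b; rewrite ?(negbTE b'b) ?andbF /=.
  by have := cardsD1 u (singles E mu); rewrite cS inE uE u'u eqxx; clear; lia.
- by rewrite E'E; have := cardsD1 b E; rewrite bE cE; clear; lia.
- exact: closes_join.
have := subset_leq_card (dirty_join_sub B1 mt uE bE bu bu').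
by move: leD1 DK; clear; lia.
Qed.

(** A Breaker edge between two single vertices is answered by pairing one of
    its ends, so that the number of such edges never grows, and pairing goes on
    until [c + 5] single vertices are left.  Each round creates a path for the
    dirty edge that Breaker adds, so the surplus [g] does not grow. *)
Lemma pairing_win c g J K E mu M B :
    mating E mu -> #|singles E mu| = c + 5 + J.*2 -> #|E| = #|singles E mu| + K.*2 ->
    closes G E mu M -> #|[set e in dirty E mu B | e \subset singles E mu]| <= c ->
    #|dirty E mu B| + 15 + (c + 5) <= K + g -> (spare g).*2 + g + 2 <= K + J ->
  win G (K + #|singles E mu|).+1 M B.
Proof.
elim: J K E mu M B => [|J IHJ] K E mu M B mt cS cE clM DS DK gK.
  rewrite !addn0 in cS gK; rewrite cS; apply: (@attach_win g (c + 5) K E mu) => //.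
  by rewrite cE cS.
have sS : singles E mu \subset E by apply/subsetP=> v; rewrite inE => /andP[].
rewrite cS (_ : (K + _).+1 = (K.+1 + (c + 5 + J.*2)).+2); last by clear; lia.
apply: win_round => p q pq; set B1 := _ |: B.
have leD1 : #|dirty E mu B1| <= #|dirty E mu B|.+1 by apply: card_dirty_add.
have [u uS hit] : exists2 u, u \in singles E mu &
    [set p; q] \subset singles E mu -> u \in [set p; q].
  have [pS|pS] := boolP (p \in singles E mu); first by exists p; rewrite ?set21.
  have /card_gt0P[u uS] : 0 < #|singles E mu| by rewrite cS !addnS.
  by exists u => //; rewrite subUset sub1set (negbTE pS).
move: (uS); rewrite inE => /andP[uE /eqP u'u].
set X := singles E mu :\ u.
have leDS : #|[set e in dirty E mu B1 | e \subset singles E mu]| <= c.+1.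
  apply: leq_trans (_ : #|[set p; q] |: [set e in dirty E mu B | e \subset singles E mu]| <= _).
    apply/subset_leq_card/subsetP=> e; rewrite in_set => /andP[eD eS].
    rewrite in_setU1; have := subsetP (dirty_add _ _ _ _) _ eD.
    by case/setU1P=> [->|eD0]; rewrite ?eqxx // in_set eD0 eS orbT.
  by rewrite cardsU1; case: (_ \notin _) => //=; apply: leqW.
have cX : #|X|.+1 = #|singles E mu| by rewrite (cardsD1 u (singles E mu)) uS.
have uX : u \notin X by rewrite !inE eqxx.
have [|||||b bX ubB] := @nonadjacent E mu B1 X u; rewrite ?u'u //.
- exact: subset_trans (subsetDl _ _) sS.
- rewrite -ltnS cX cS; apply: leq_ltn_trans (_ : c.+2 < _); last by clear; lia.
  apply: leq_trans leDS; apply/subset_leq_card/subsetP=> e.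
  by rewrite setD1K.
move: (bX); rewrite in_setD1 => /andP[bu bS]; move: (bS); rewrite inE => /andP[bE /eqP b'b].
have bu' : b != mu u by rewrite u'u.
exists u, b; split=> //; first by rewrite eq_sym.
have E'E : joinE E mu u b = E.
  apply/setP=> v; rewrite !inE u'u b'b negb_or.
  have [->|_] := eqVneq v u; first by rewrite uE.
  by have [->|_] := eqVneq v b; rewrite ?bE ?orbF.
have S'E : singles (joinE E mu u b) (upd mu (mu u) (mu b)) = singles E mu :\: [set u; b].
  apply/setP=> v; rewrite [LHS]inE E'E !inE /upd u'u b'b negb_or.
  have [->|vu] := eqVneq v u; first by rewrite ?eqxx /= (negbTE bu) andbF.
  by have [->|//] := eqVneq v b; rewrite ?eqxx /= eq_sym (negbTE bu) andbF.
have cS' : #|singles (joinE E mu u b) (upd mu (mu u) (mu b))| = c + 5 + J.*2.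
  rewrite S'E; have := cardsID [set u; b] (singles E mu); rewrite (setIidPr _).
    by rewrite cards2 eq_sym bu cS; clear; lia.
  by rewrite subUset !sub1set uS.
rewrite -cS'.
have sD := dirty_join_sub B1 mt uE bE bu bu'.
apply: IHJ => //.
- exact: mating_join.
- by rewrite cS' E'E cE cS; clear; lia.
- exact: closes_join.
- apply: leq_trans DS; apply/subset_leq_card/subsetP=> e.
  rewrite in_set S'E => /andP[/(subsetP sD) eD eS].
  have eSS : e \subset singles E mu by apply: subset_trans eS (subsetDl _ _).
  rewrite in_set eSS andbT; have := subsetP (dirty_add _ _ _ _) _ eD.
  case/setU1P=> // ee; move: hit; rewrite -ee => /(_ eSS) ue.
  by have := subsetP eS u ue; rewrite !inE eqxx.
- by have := subset_leq_card sD; move: leD1 DK; clear; lia.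
by rewrite addSnnS.
Qed.

(** A cycle through the path from [x] to [y] and the single vertices of [U],
    when cut open at this path, is a path through [U] from [x] to [y] or back. *)
Lemma closes_start (x y : W) (U : {set W}) M :
    x != y -> x \notin U -> y \notin U ->
    (forall M' s, M \subset M' -> uniq s -> s =i U ->
       path [rel u v | [set u; v] \in M'] x (rcons s y) -> G M') ->
  closes G (x |: (y |: U)) (upd id x y) M.
Proof.
move=> xy xU yU ham M' s sMM' [Us sE cov once] cyc.
have mux : upd id x y x = y by rewrite /upd eqxx.
have muy : upd id x y y = x by rewrite /upd eqxx eq_sym (negbTE xy).
have muU u : u \in U -> upd id x y u = u.
  move=> uU; rewrite /upd; case: eqP => [ux|_]; first by rewrite -ux uU in xU.
  by case: eqP => // uy; rewrite -uy uU in yU.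
have body w t : w \in s -> w \in [set x; y] ->
    uniq (w :: t) -> s =i w :: t -> uniq t /\ t =i U.
  move=> ws wxy /andP[wt Ut] st; split=> // u; apply/idP/idP => [ut|uU].
    have : u \in x |: (y |: U) by apply: sE; rewrite st inE ut orbT.
    rewrite !in_setU1 orbA; case/orP=> // uxy.
    have uw : u != w by apply: contra wt => /eqP<-.
    have u's : upd id x y u \in s.
      rewrite st inE; move: wxy uxy uw; rewrite !inE.
      by case/orP=> /eqP-> /orP[]/eqP->; rewrite ?mux ?muy ?eqxx.
    have us : u \in s by rewrite st inE ut orbT.
    have := once u us u's; move: uxy; case/orP=> /eqP->; rewrite ?mux ?muy => eq_xy.
      by rewrite eq_xy eqxx in xy.
    by rewrite eq_xy eqxx in xy.
  have uE : u \in x |: (y |: U) by rewrite !inE uU !orbT.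
  have := cov u uE; rewrite muU // orbb st inE => /orP[/eqP uw|//].
  move: wxy; rewrite !inE -uw => /orP[]/eqP eq_u; first by rewrite -eq_u uU in xU.
  by rewrite -eq_u uU in yU.
have rotP w : w \in s -> exists t, [/\ uniq (w :: t), s =i w :: t &
    path (link (upd id x y) M') w (rcons t w)].
  move=> ws; have [i t rot_s] := rot_to ws; exists t; rewrite -rot_s rot_uniq; split=> //.
    by move=> u; rewrite mem_rot.
  by have := cyc; rewrite -(rot_cycle i) rot_s.
have : x \in x |: (y |: U) by rewrite setU11.
move=> /cov; rewrite mux => /orP[xs|ys].
  have [t [Uxt st pt]] := rotP x xs.
  have [Ut tU] := body x t xs (set21 _ _) Uxt st.
  apply: (ham M' (rev t)); rewrite ?rev_uniq //; first by move=> u; rewrite mem_rev tU.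
  have {}pt : path (link id M') y (rcons t x).
    by apply: path_link_upd pt => // u; rewrite tU; apply: muU.
  have := rev_path (link id M') y (rcons t x).
  rewrite last_rcons belast_rcons rev_cons => ->.
  rewrite (eq_path (e' := link id M')) // => u v.
  by rewrite /link /= setUC.
have [t [Uyt st pt]] := rotP y ys.
have [Ut tU] := body y t ys (set22 _ _) Uyt st.
apply: (ham M' t) => //.
by apply: path_link_upd pt => // u; rewrite tU; apply: muU.
Qed.

(** The number of vertices for which [pairing_win] applies with [c] dirty edges,
    one path and therefore the surplus [2 * c + 19]. *)
Definition path_length (c : nat) : nat := c + 5 + ((spare (2 * c + 19)).*2 + 2 * c + 21).*2.

Lemma hamilton_path_win (x y : W) (U : {set W}) M B c :
    x != y -> x \notin U -> y \notin U -> #|U| = path_length c ->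
    #|dirty (x |: (y |: U)) (upd id x y) B| <= c ->
    (forall M' s, M \subset M' -> uniq s -> s =i U ->
       path [rel u v | [set u; v] \in M'] x (rcons s y) -> G M') ->
  win G #|U|.+2 M B.
Proof.
move=> xy xU yU cU Dc ham; set mu := upd id x y.
have mux : mu x = y by rewrite /mu /upd eqxx.
have muy : mu y = x by rewrite /mu /upd eqxx eq_sym (negbTE xy).
have muU u : u \in U -> mu u = u.
  move=> uU; rewrite /mu /upd; case: eqP => [ux|_]; first by rewrite -ux uU in xU.
  by case: eqP => // uy; rewrite -uy uU in yU.
have SU : singles (x |: (y |: U)) mu = U.
  apply/setP=> u; rewrite inE !in_setU1.
  have [->|ux] := eqVneq u x; first by rewrite mux [y == x]eq_sym (negbTE xy) andbF (negbTE xU).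
  have [->|uy] := eqVneq u y; first by rewrite muy (negbTE xy) andbF (negbTE yU).
  by have [uU|//] := boolP (u \in U); rewrite muU ?eqxx.
have := @pairing_win c (2 * c + 19) ((spare (2 * c + 19)).*2 + 2 * c + 21) 1
          (x |: (y |: U)) mu M B.
rewrite SU add1n; apply=> //.
- move=> u; rewrite !in_setU1; case/or3P=> [/eqP->|/eqP->|uU].
  + by rewrite mux muy eqxx orbT.
  + by rewrite muy mux eqxx.
  by rewrite !muU // uU !orbT.
- rewrite !cardsU1 !inE negb_or xy xU yU; clear; lia.
- exact: closes_start.
- apply: leq_trans Dc; apply/subset_leq_card/subsetP=> e.
  by rewrite in_set => /andP[].
- by move: Dc; rewrite -/mu; clear; lia.
by clear; lia.
Qed.

End Singles.

(** * Growing an embedded subtree *)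

Section Growing.

Variables (V W : finType) (e : rel V) (x y : V) (ip : seq V).
Hypothesis (tree_e : tree e) (bare : bare_path e x (rcons ip y)).
Implicit Types (S : {set V}) (f : V -> W) (a b u v : V) (w z : W).
Implicit Types (U : {set W}) (M B : {set {set W}}).

Let sym_e : symmetric e. Proof. by case: tree_e => -[]. Qed.
Let irr_e : irreflexive e. Proof. by case: tree_e => -[]. Qed.

Definition spine : {set V} := [set v in x :: rcons ip y].
Definition inner : {set V} := [set v in ip].

(** An inner vertex has degree 2, and its two neighbours on the path are
    distinct. *)
Lemma inner_nbrs l1 u l2 v :
    ip = l1 ++ u :: l2 -> e u v -> v = last x l1 \/ v = head y (rcons l2 y).
Proof.
move=> ipE uv; have [pth Us deg] := bare.
have ux : u \in x :: rcons ip y by rewrite ipE !inE mem_rcons !inE mem_cat !inE eqxx !orbT.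
have uNx : u != x.
  by apply: contraTneq Us => <-; rewrite /= ipE mem_rcons inE mem_cat !inE eqxx !orbT.
have uNy : u != last x (rcons ip y).
  rewrite last_rcons; apply: contraTneq Us => <-.
  by rewrite /= rcons_uniq ipE mem_cat !inE eqxx !orbT /= andbF.
have du := deg u ux uNx uNy.
have lastu : last x l1 \in x :: l1 by apply: mem_last.
have headu : head y (rcons l2 y) \in rcons l2 y by case: (l2) => [|? ?]; rewrite /= inE eqxx.
have [e1 e2] : e (last x l1) u /\ e u (head y (rcons l2 y)).
  move: pth; rewrite ipE rcons_cat /= cat_path /= => /and3P[_ -> pth]; split=> //.
  by case: (l2) pth => [|? ?] /= /andP[].
have ne : last x l1 != head y (rcons l2 y).
  apply: contraTneq Us => eq_lh.
  rewrite ipE rcons_cat -cat_cons cat_uniq; apply/negP=> /and3P[_ /hasPn/(_ (last x l1))].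
  by rewrite lastu inE eq_lh headu orbT => /(_ isT).
have sub : [set last x l1; head y (rcons l2 y)] \subset [set w | e u w].
  by rewrite subUset !sub1set !inE sym_e e1 e2.
have /eqP eqN : [set last x l1; head y (rcons l2 y)] == [set w | e u w].
  by rewrite eqEcard sub cards2 ne; rewrite /degree in du; rewrite du.
have : v \in [set w | e u w] by rewrite inE.
by rewrite -eqN => /set2P.
Qed.

Lemma mem_split (s : seq V) u : u \in s -> exists l1 l2, s = l1 ++ u :: l2.
Proof. by case/path.splitPr=> l1 l2; exists l1, l2. Qed.

Lemma inner_spine u v : u \in inner -> e u v -> v \in spine.
Proof.
rewrite inE => /mem_split[l1 [l2 ipE]] /(inner_nbrs ipE) uv.
rewrite inE ipE rcons_cat -cat_cons mem_cat rcons_cons; case: uv => ->.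
  by rewrite mem_last.
have -> : head y (rcons l2 y) \in u :: rcons l2 y; last by rewrite orbT.
by rewrite inE; apply/orP; right; case: (l2) => [|z l]; rewrite /= mem_head.
Qed.

(** The tree between embedded vertices.  The inner vertices of the bare path
    count as embedded although they have no image; this keeps the embedded part
    connected. *)
Definition within S : rel V := [rel u v | [&& e u v, u \in S & v \in S]].

Definition grown S : Prop :=
  spine \subset S /\ forall a, a \in S -> connect (within S) x a.

Definition children S a : {set V} := [set v in ~: S | e a v].

(** Children that have children themselves: in a tree, all neighbours of [v] but
    one are missing. *)
Definition branching S a : {set V} := [set v in children S a | 1 < degree e v].

Lemma within_sym S : connect_sym (within S).
Proof. by apply: sym_connect_sym => u v; rewrite /within /= sym_e; congr (_ && _); apply: andbC. Qed.

(** Two neighbours in the connected part [S] would close a cycle. *)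
Lemma unique_parent S v a b :
  grown S -> v \notin S -> a \in S -> b \in S -> e a v -> e b v -> a = b.
Proof.
move=> [_ con] vS aS bS av bv; apply/eqP/negPn/negP => ab.
have : connect (within S) a b.
  by apply: connect_trans (con b bS); rewrite within_sym; apply: con.
case/connectP=> p0 /shortenP[p pth Up _] lastp.
have [_ _ acyc] := tree_e; case: p => [|c p] in pth Up lastp; first by rewrite lastp eqxx in ab.
apply: (acyc (v :: a :: c :: p)) => //.
have pS : {subset c :: p <= S}.
  move=> u up; have [q1 [q2 pE]] := mem_split up; move: pth; rewrite pE cat_path /=.
  by case/andP=> _ /andP[/and3P[]].
apply/andP; split.
  have pe : path e a (c :: p) by apply: sub_path pth => u w /= /and3P[].
  have -> : cycle e [:: v, a, c & p] = e v a && path e a (rcons (c :: p) v) by [].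
  by rewrite sym_e av rcons_path pe -lastp bv.
rewrite /= inE negb_or; move: Up => /= ->; rewrite andbT; apply/andP; split.
  by apply: contra vS => /eqP->.
by apply: contra vS => /pS.
Qed.

Lemma grown_spine : grown spine.
Proof.
split=> // a; rewrite inE => a_sp; have [pth _ _] := bare.
apply: (@path_connect _ (within spine) x (rcons ip y)) => //.
apply: (@sub_in_path _ (mem spine) e (within spine)) pth => //.
  move=> u v us vs uv; rewrite /within /= uv /=; apply/andP; split; [exact: us | exact: vs].
by apply/allP=> u us; have : u \in spine by rewrite inE.
Qed.

Section Attach.

Variables (S : {set V}) (a v : V).
Hypotheses (grS : grown S) (aS : a \in S) (v_child : v \in children S a).

Let vS : v \notin S. Proof. by move: v_child; rewrite !inE => /andP[]. Qed.
Let av : e a v. Proof. by move: v_child; rewrite !inE => /andP[]. Qed.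

Lemma parent_outer : a \notin inner.
Proof.
apply/negP=> /inner_spine/(_ av); have [/subsetP sp _] := grS => /sp.
by rewrite (negbTE vS).
Qed.

Lemma child_outer : v \notin inner.
Proof.
apply: contra vS => vip; have [/subsetP sp _] := grS; apply: sp.
by move: vip; rewrite !inE mem_rcons !inE => ->; rewrite !orbT.
Qed.

Lemma grown_attach : grown (v |: S).
Proof.
have [sp con] := grS; split; first exact: subset_trans sp (subsetUr _ _).
have con' u : u \in S -> connect (within (v |: S)) x u.
  move=> /con; apply: connect_sub => c d /= /and3P[cd cS dS]; apply: connect1.
  by rewrite /within /= cd !inE cS dS !orbT.
move=> u /setU1P[->|]; last exact: con'.
apply: connect_trans (con' a aS) _; apply: connect1.
by rewrite /within /= av !inE eqxx aS orbT.
Qed.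

Lemma children_parent : children (v |: S) a = children S a :\ v.
Proof. by apply/setP=> u; rewrite !inE negb_or -andbA. Qed.

Lemma children_other b : b \in S -> b != a -> children (v |: S) b = children S b.
Proof.
move=> bS ba; apply/setP=> u; rewrite !inE negb_or.
have [->|//] := eqVneq u v; rewrite vS /=; apply/esym/negbTE.
by apply: contra ba => bv; apply/eqP/(unique_parent grS vS).
Qed.

Lemma children_new : children (v |: S) v = [set u | e v u] :\ a.
Proof.
apply/setP=> u; rewrite !inE negb_or.
have [->|ua] := eqVneq u a; first by rewrite aS !andbF.
have [vu|] := boolP (e v u); last by rewrite !andbF.
rewrite !andbT; apply/andP; split.
  by apply: contraTneq vu => ->; rewrite irr_e.
apply: contra ua => uS; apply/eqP/(unique_parent grS vS) => //.
by rewrite sym_e.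
Qed.

Lemma card_children_new : #|children (v |: S) v|.+1 = degree e v.
Proof. by rewrite children_new /degree (cardsD1 a [set u | _]) inE sym_e av. Qed.

Lemma branching_parent : branching (v |: S) a = branching S a :\ v.
Proof. by rewrite /branching children_parent; apply/setP=> u; rewrite !inE -andbA. Qed.

End Attach.

(** Partial embeddings: [f] matters on [S] without the inner vertices. *)
Definition embeds S f M : Prop :=
  {in S :\: inner &, injective f} /\
  (forall u v, u \in S :\: inner -> v \in S :\: inner -> e u v -> [set f u; f v] \in M).

Definition unused S f : {set W} := ~: (f @: (S :\: inner)).

Definition place f v w : V -> W := fun u => if u == v then w else f u.

Lemma place_old S f v w u : v \notin S -> u \in S -> place f v w u = f u.
Proof. by move=> vS uS; rewrite /place; case: eqP => // uv; rewrite -uv uS in vS. Qed.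

Lemma setU1_outer S v : v \notin inner -> (v |: S) :\: inner = v |: (S :\: inner).
Proof.
move=> vI; apply/setP=> u; rewrite !in_setD !in_setU1 in_setD.
by have [->|] := eqVneq u v; rewrite ?vI.
Qed.

Lemma unused_place S f v w :
    v \notin S -> v \notin inner -> w \in unused S f ->
  unused (v |: S) (place f v w) = unused S f :\ w.
Proof.
move=> vS vI wU; rewrite /unused setU1_outer // imsetU1 {1}/place eqxx.
rewrite (@eq_in_imset _ _ _ f) => [|u]; last by rewrite inE => /andP[_ /(place_old f w vS)->].
by apply/setP=> z; rewrite !inE negb_or.
Qed.

Lemma embeds_place S f M a v w :
    grown S -> a \in S -> v \in children S a -> w \in unused S f -> embeds S f M ->
  embeds (v |: S) (place f v w) ([set f a; w] |: M).
Proof.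
move=> grS aS vC wU [inj edg].
have vI := child_outer grS vC; move: (vC); rewrite !inE => /andP[vS av].
have old u : u \in S :\: inner -> place f v w u = f u.
  by rewrite inE => /andP[_ uS]; apply: place_old vS uS.
have new : place f v w v = w by rewrite /place eqxx.
have wN u : u \in S :\: inner -> f u <> w.
  by move=> uS fuw; move: wU; rewrite inE -fuw imset_f.
rewrite /embeds setU1_outer //; split=> u1 u2.
  move=> /setU1P[->|u1S] /setU1P[->|u2S] //; rewrite ?new ?old //.
  - by move=> /esym/(wN _ u2S).
  - by move=> /(wN _ u1S).
  exact: inj.
have par u : u \in S :\: inner -> e u v -> u = a.
  by rewrite inE => /andP[_ uS] uv; apply: unique_parent grS vS uS aS uv av.
move=> /setU1P[->|u1S] /setU1P[->|u2S]; rewrite ?new ?old // => e12.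
- by rewrite irr_e in e12.
- by rewrite (par u2) 1?sym_e // setUC setU11.
- by rewrite (par u1) // setU11.
by rewrite setU1r // edg.
Qed.

End Growing.

(** * Replies during the embedding *)

Section Replies.

Variables (V W : finType) (e : rel V) (x y : V) (ip : seq V).
Hypothesis (tree_e : tree e) (bare : bare_path e x (rcons ip y)).
Hypothesis cVW : #|V| = #|W|.
Implicit Types (S : {set V}) (f : V -> W) (a b u v : V) (w z : W).
Implicit Types (U : {set W}) (M B : {set {set W}}).

Local Notation inner := (inner ip).
Local Notation grown := (grown e x y ip).
Local Notation children := (children e).
Local Notation branching := (branching e).
Local Notation embeds := (embeds e ip).
Local Notation unused := (unused ip).

Lemma open_exists S : grown S -> S != setT ->
  exists a v, [/\ a \in S, a \notin inner & v \in children S a].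
Proof.
move=> grS; rewrite -subTset => /subsetPn[v0 _ v0S]; have [[sp _] [_ [_ con] _]] := (grS, tree_e).
have xS : x \in S by apply: (subsetP sp); rewrite inE mem_head.
have /connectP[p pth lastp] := con x v0.
have [a [v [aS av vS]]] : exists a v, [/\ a \in S, e a v & v \notin S].
  elim: p (x) xS pth lastp {con} => [|c p IHp] b bS /=.
    by move=> _ eq_v; rewrite eq_v bS in v0S.
  case/andP=> bc pth lastp; have [cS|cS] := boolP (c \in S); first exact: (IHp c).
  by exists b, c.
have vC : v \in children S a by rewrite !inE vS.
by exists a, v; split=> //; apply: (parent_outer tree_e bare grS vC).
Qed.

Lemma inner_sub S : grown S -> inner \subset S.
Proof.
case=> /subsetP sp _; apply/subsetP=> u; rewrite inE => uip; apply: sp.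
by rewrite !inE mem_rcons inE uip !orbT.
Qed.

Lemma card_unused S f M : grown S -> embeds S f M ->
  #|unused S f| = #|~: S| + size ip.
Proof.
move=> grS [inj _]; have [_ Us _] := bare.
have Uip : uniq ip by move: Us; rewrite /= rcons_uniq => /and3P[].
have cI : #|inner| = size ip by rewrite cardsE; apply/card_uniqP.
have := cardsC (f @: (S :\: inner)); rewrite card_in_imset //.
have := cardsID inner S; rewrite (setIidPr (inner_sub grS)) cI.
have := cardsC S; rewrite -/(unused S f); move: cVW.
move: #|_| #|_| #|_| #|_| #|_| #|_|; clear; lia.
Qed.

Lemma outer_used S f a : a \in S :\: inner -> f a \notin unused S f.
Proof. by move=> aS; rewrite inE negbK imset_f. Qed.

Definition nb (g : W) U B : {set W} := [set w in U | [set g; w] \in B].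

Lemma nb_le g U U' B : U' \subset U -> #|nb g U' B| <= #|nb g U B|.
Proof.
move=> /subsetP sU; apply/subset_leq_card/subsetP=> w.
by rewrite !inE => /andP[/sU-> ->].
Qed.

Lemma nb_add g U B p q : (forall w, w \in U -> [set g; w] != [set p; q]) ->
  nb g U ([set p; q] |: B) = nb g U B.
Proof.
move=> ne; apply/setP=> w; rewrite !inE; have [wU|//] := boolP (w \in U).
by rewrite (negbTE (ne w wU)).
Qed.

Lemma card_nb_add g U B p q : g \notin U -> #|nb g U ([set p; q] |: B)| <= #|nb g U B|.+1.
Proof.
move=> gU; pose t := if g == p then q else p.
have /subset_leq_card le : nb g U ([set p; q] |: B) \subset t |: nb g U B.
  apply/subsetP=> w; rewrite !inE => /andP[wU /orP[/eq_set2P eq_gw|->]]; last by rewrite wU orbT.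
  rewrite /t; have [gp|gp] := eqVneq g p; case: eq_gw => [[gp' wq]|[gq wp]].
  - by rewrite wq eqxx.
  - by rewrite gp -wp wU in gU.
  - by rewrite gp' eqxx in gp.
  by rewrite wp eqxx.
by apply: leq_trans le _; rewrite cardsU1; case: (_ \notin _).
Qed.

Lemma nb_pick g U B : #|nb g U B| < #|U| -> exists2 z, z \in U & z \notin nb g U B.
Proof. exact: free_end. Qed.

(** Replies to an edge with an end [p] outside [U].  Active vertices have
    children that may be embedded next, and Maker embeds a child of the active
    vertex [r] at [z].  If [p] is the image of an active [a], she takes
    [r = a], which loses a child for the new Breaker edge.  Otherwise any
    active [r] will do: either [z] can be a vertex that Breaker has joined to [a]
    and not to [r], which makes up for the new edge, or the load of [a] is at
    most that of [r]. *)
Lemma outer_reply S f M B p q (active : pred V) k :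
    embeds S f M -> p \notin unused S f ->
    (forall a, a \in S :\: inner -> #|nb (f a) (unused S f) B| <= k) ->
    k.+1 < #|unused S f| ->
    (exists2 r, r \in S :\: inner & active r) ->
  exists r z a0, [/\ r \in S :\: inner, active r, z \in unused S f,
    z \notin nb (f r) (unused S f) ([set p; q] |: B) &
  [/\ z \notin nb (f r) (unused S f) B,
    forall b, b \in S :\: inner -> b != a0 ->
      #|nb (f b) (unused S f :\ z) ([set p; q] |: B)| <= #|nb (f b) (unused S f) B| &
    [\/ #|nb (f a0) (unused S f :\ z) ([set p; q] |: B)| <= #|nb (f a0) (unused S f) B|,
      a0 = r /\ #|nb (f a0) (unused S f :\ z) ([set p; q] |: B)|
                  <= #|nb (f a0) (unused S f) B|.+1
    | [/\ a0 \in S :\: inner, ~~ active a0 &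
         #|nb (f a0) (unused S f :\ z) ([set p; q] |: B)| <= #|nb (f r) (unused S f) B|]]]].
Proof.
set U := unused S f => -[inj _] pU ld kU [r rS act].
set B1 := _ |: B.
have fU b : b \in S :\: inner -> f b \notin U by apply: outer_used.
have same b : b \in S :\: inner -> f b != p -> nb (f b) U B1 = nb (f b) U B.
  move=> bS fbp; apply: nb_add => w wU; apply/negP=> /eq_set2P[[fb _]|[_ wp]].
    by rewrite fb eqxx in fbp.
  by rewrite -wp wU in pU.
have sU z : U :\ z \subset U by apply: subsetDl.
have le z b : b \in S :\: inner -> f b != p -> #|nb (f b) (U :\ z) B1| <= #|nb (f b) U B|.
  by move=> bS fbp; rewrite -same //; apply: nb_le.
have subB g w : w \in nb g U B -> w \in nb g U B1.
  by rewrite !inE => /andP[-> ->]; rewrite orbT.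
have outer_case r1 z : r1 \in S :\: inner -> active r1 -> z \in U ->
    z \notin nb (f r1) U B -> f r1 != p -> forall a0,
    (forall b, b \in S :\: inner -> b != a0 -> f b != p) ->
    [\/ #|nb (f a0) (U :\ z) B1| <= #|nb (f a0) U B|
      | [/\ a0 \in S :\: inner, ~~ active a0 & #|nb (f a0) (U :\ z) B1| <= #|nb (f r1) U B|]] ->
    exists r z a0, [/\ r \in S :\: inner, active r, z \in U, z \notin nb (f r) U B1 &
    [/\ z \notin nb (f r) U B,
      forall b, b \in S :\: inner -> b != a0 -> #|nb (f b) (U :\ z) B1| <= #|nb (f b) U B| &
    [\/ #|nb (f a0) (U :\ z) B1| <= #|nb (f a0) U B|,
      a0 = r /\ #|nb (f a0) (U :\ z) B1| <= #|nb (f a0) U B|.+1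
    | [/\ a0 \in S :\: inner, ~~ active a0 & #|nb (f a0) (U :\ z) B1| <= #|nb (f r) U B|]]]].
  move=> r1S act1 zU zN r1p a0 others bound; exists r1, z, a0; split=> //; first by rewrite same.
  split=> //; first by move=> b bS ba; apply: le => //; apply: others.
  by case: bound; [constructor 1|constructor 3].
have pick r1 : r1 \in S :\: inner -> exists2 z, z \in U & z \notin nb (f r1) U B.
  by move=> r1S; apply: nb_pick; apply: leq_ltn_trans (ld r1 r1S) (ltnW kU).
have [/existsP[a /andP[aS /eqP fa]]|none] := boolP [exists a, (a \in S :\: inner) && (f a == p)];
    last first.
  have np b : b \in S :\: inner -> f b != p.
    by move=> bS; apply: contra none => fbp; apply/existsP; exists b; rewrite bS.
  have [z zU zN] := pick r rS.
  apply: (outer_case r z _ _ _ _ _ r) => //; first exact: np.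
    by move=> b bS _; apply: np.
  by constructor 1; apply: le => //; apply: np.
have others b : b \in S :\: inner -> b != a -> f b != p.
  by move=> bS; apply: contra => /eqP fb; apply/eqP/inj => //; rewrite fb fa.
have a1 := card_nb_add B p q (fU a aS); rewrite -/B1 in a1.
have [acta|nacta] := boolP (active a).
  have [z zU zN] : exists2 z, z \in U & z \notin nb (f a) U B1.
    by apply: nb_pick; apply: leq_ltn_trans a1 _; apply: leq_ltn_trans kU; rewrite ltnS ld.
  exists a, z, a; split=> //; split.
  - by apply: contra zN; apply: subB.
  - by move=> b bS ba; apply: le => //; apply: others.
  by constructor 2; split=> //; apply: leq_trans a1; apply: nb_le.
have ra : r != a by apply: contraTneq act => ->.
have rp := others r rS ra.
have [sub|/subsetPn[z]] := boolP (nb (f a) U B1 \subset nb (f r) U B).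
  have [z zU zN] := pick r rS.
  apply: (outer_case r z _ _ _ _ _ a) => //; constructor 2; split=> //.
  by apply: leq_trans (nb_le _ _ (sU z)) _; apply: subset_leq_card.
rewrite inE => /andP[zU az] zN; apply: (outer_case r z _ _ _ _ _ a) => //.
constructor 1; rewrite -ltnS; apply: leq_trans a1.
rewrite (cardsD1 z (nb (f a) U B1)) inE zU az ltnS.
by apply/subset_leq_card/subsetP=> w; rewrite !inE -andbA => /and3P[-> -> ->].
Qed.

Lemma attach_round (G : {set {set W}} -> Prop) n S f M B1 r z :
    r \in S :\: inner -> z \in unused S f -> z \notin nb (f r) (unused S f) B1 ->
    win G n ([set f r; z] |: M) B1 ->
  exists s t : W, [/\ s != t, [set s; t] \notin B1 & win G n ([set s; t] |: M) B1].
Proof.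
move=> rS zU zN winM; exists (f r), z; split=> //.
  by apply: contraTneq zU => <-; apply: outer_used.
by move: zN; rewrite inE zU.
Qed.

Lemma card_compl_attach S v : v \notin S -> #|~: S| = #|~: (v |: S)|.+1.
Proof.
move=> vS; rewrite (cardsD1 v (~: S)) inE vS add1n; congr _.+1.
by apply: eq_card => u; rewrite !inE negb_or.
Qed.

End Replies.

(** * Embedding leaves *)

Definition load_bound (Delta : nat) : nat := Delta.*2.+1.

(** The square bounds Breaker's edges between common neighbours of a vertex; the
    rest is for his edges at the images of the two ends of the bare path. *)
Definition dirt_bound (Delta : nat) : nat := load_bound Delta ^ 2 + (load_bound Delta).*2.

Section SpanningTree.

Variables (V W : finType) (e : rel V) (x y : V) (ip : seq V) (Delta : nat).
Variable G : {set {set W}} -> Prop.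
Hypothesis (tree_e : tree e) (bare : bare_path e x (rcons ip y)).
Hypothesis cVW : #|V| = #|W|.
Hypothesis size_ip : size ip = path_length (dirt_bound Delta).
Implicit Types (S : {set V}) (f : V -> W) (a b u v : V) (w z : W).
Implicit Types (U : {set W}) (M B : {set {set W}}).

Local Notation inner := (inner ip).
Local Notation grown := (grown e x y ip).
Local Notation children := (children e).
Local Notation branching := (branching e).
Local Notation embeds := (embeds e ip).
Local Notation unused := (unused ip).
Local Notation outer S := (S :\: inner).
Local Notation K := (load_bound Delta).

Hypothesis hamilton_copy : forall f M M' s,
  embeds setT f M -> M \subset M' -> uniq s -> s =i unused setT f ->
  path [rel u v | [set u; v] \in M'] (f x) (rcons s (f y)) -> G M'.

Lemma path_length_ge c : c + 5 <= path_length c.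
Proof. by rewrite /path_length leq_addr. Qed.

Lemma room S f M : grown S -> embeds S f M -> K.+2 < #|unused S f|.
Proof.
move=> grS em; rewrite (card_unused bare cVW grS em) size_ip.
apply: leq_trans (leq_addl _ _); apply: leq_trans (path_length_ge _).
by rewrite /dirt_bound; clear; lia.
Qed.

(** When only leaves are missing, no embedded vertex ever gets new children to
    wait for.  So if an edge in the unused part joins common neighbours of all
    vertices that wait for children, this remains true; and since no load
    exceeds [K], there are few such edges. *)
Definition only_leaves S f M B : Prop :=
  [/\ grown S, embeds S f M, forall a, a \in outer S -> branching S a = set0,
      forall a, a \in outer S -> #|nb (f a) (unused S f) B| + #|children S a| <= K
    & (forall a (u w : W), a \in outer S -> children S a != set0 ->
         u \in unused S f -> w \in unused S f -> u != w -> [set u; w] \in B ->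
         u \in nb (f a) (unused S f) B)
      /\ #|dirty (unused S f) id B| <= K ^ 2].

(** Dirty edges at the start of the second part are those in the unused part and
    those at the images of [x] and [y], whose number is bounded by the loads. *)
Lemma finish_win S f M B : S = setT -> only_leaves S f M B -> win G (size ip).+2 M B.
Proof.
move=> -> [grS em _ ld [_ cD]]; set U := unused setT f in ld cD.
have [_ Us _] := bare; have [inj _] := em.
have xo : x \in outer setT.
  move: Us; rewrite /= mem_rcons inE negb_or => /andP[/andP[_ xip] _].
  by rewrite !inE xip.
have yo : y \in outer setT.
  by move: Us; rewrite /= rcons_uniq => /and3P[_ yip _]; rewrite !inE yip.
have xy : f x != f y.
  have xy0 : x != y by move: Us; rewrite /= mem_rcons inE negb_or => /andP[/andP[]].
  by apply: contra xy0 => /eqP/(inj _ _ xo yo)->.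
have xU : f x \notin U by apply: outer_used.
have yU : f y \notin U by apply: outer_used.
have cU : #|U| = size ip by rewrite (card_unused bare cVW grS em) setCT cards0.
have pathL : #|U| = path_length (dirt_bound Delta) by rewrite cU.
rewrite -cU; apply: (hamilton_path_win xy xU yU pathL); last first.
  by move=> M' s sMM' Us' sU; apply: hamilton_copy em sMM' Us' sU.
set D := dirty _ _ _.
pose star g := [set [set g; w] | w in nb g U B].
have le_star a : a \in outer setT -> #|star (f a)| <= K.
  move=> ao; apply: leq_trans (leq_imset_card _ _) _.
  by apply: leq_trans (ld a ao); apply: leq_addr.
have /subset_leq_card leD : D \subset dirty U id B :|: (star (f x) :|: star (f y)).
  apply/subsetP=> e0 /dirtyP[u [v [uE vE vu vu' [eE eB]]]].
  have inU w : w \in f x |: (f y |: U) -> w \in U \/ w = f x \/ w = f y.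
    by rewrite !in_setU1 => /or3P[/eqP->|/eqP->|]; auto.
  have mx : upd id (f x) (f y) (f x) = f y by rewrite /upd eqxx.
  have my : upd id (f x) (f y) (f y) = f x by rewrite /upd eqxx eq_sym (negbTE xy).
  rewrite !in_setU; case: (inU u uE) => [uU|ux]; case: (inU v vE) => [vU|vx].
  - by apply/orP; left; apply/dirtyP; exists u, v.
  - apply/orP; right; apply/orP; case: vx => vE'; [left|right]; apply/imsetP;
      by exists u; [rewrite inE uU -vE' setUC -eE | rewrite -vE' setUC].
  - apply/orP; right; apply/orP; case: ux => uE'; [left|right]; apply/imsetP;
      by exists v; [rewrite inE vU -uE' -eE | rewrite -uE'].
  by case: ux vx vu vu' => -> [] ->; rewrite ?mx ?my ?eqxx.
apply: leq_trans leD _; rewrite /dirt_bound -addnn.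
apply: leq_trans (leq_card_setU _ _) _; apply: leq_add => //.
by apply: leq_trans (leq_card_setU _ _) _; apply: leq_add; apply: le_star.
Qed.

Lemma outer_attach S a v u : grown S -> a \in S -> v \in children S a ->
  (u \in outer (v |: S)) = (u == v) || (u \in outer S).
Proof.
by move=> grS aS vC; rewrite setU1_outer ?in_setU1 //; apply: (child_outer grS vC).
Qed.

Lemma children_sub S v b : children (v |: S) b \subset children S b.
Proof.
by apply/subsetP=> u; rewrite !inE negb_or => /andP[/andP[_ ->] ->].
Qed.

Lemma card_children_parent S r v : v \in children S r ->
  #|children S r| = #|children (v |: S) r|.+1.
Proof. by move=> vC; rewrite children_parent (cardsD1 v (children S r)) vC. Qed.

(** Embedding a child of [r] at [z] keeps all loads under control, in one of the
    ways that occur in [outer_reply]. *)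
Definition eases S f B B1 (active : pred V) r z : Prop :=
  exists a0, (forall b, b \in outer S -> b != a0 ->
      #|nb (f b) (unused S f :\ z) B1| <= #|nb (f b) (unused S f) B|) /\
    [\/ #|nb (f a0) (unused S f :\ z) B1| <= #|nb (f a0) (unused S f) B|,
      a0 = r /\ #|nb (f a0) (unused S f :\ z) B1| <= #|nb (f a0) (unused S f) B|.+1
    | [/\ a0 \in outer S, ~~ active a0 &
         #|nb (f a0) (unused S f :\ z) B1| <= #|nb (f r) (unused S f) B|]].

Lemma only_leaves_attach S f M B B1 r v z :
    only_leaves S f M B -> r \in outer S -> v \in children S r -> z \in unused S f ->
    eases S f B B1 (fun a => children S a != set0) r z ->
    #|nb z (unused S f :\ z) B1| <= 1 ->
    (forall a (u w : W), a \in outer S -> children S a != set0 ->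
         u \in unused S f :\ z -> w \in unused S f :\ z -> u != w -> [set u; w] \in B1 ->
         u \in nb (f a) (unused S f :\ z) B1) ->
    #|dirty (unused S f :\ z) id B1| <= K ^ 2 ->
  only_leaves (v |: S) (place f v z) ([set f r; z] |: M) B1.
Proof.
move=> [grS em br ld _] ro vC zU [a0 [d_other d_a0]] nz common cD.
have rS : r \in S by move: ro; rewrite inE => /andP[].
have vS : v \notin S by move: vC; rewrite !inE => /andP[].
have fv : place f v z v = z by rewrite /place eqxx.
have fo b : b \in outer S -> place f v z b = f b.
  by rewrite inE => /andP[_ bS]; apply: place_old vS bS.
have U' : unused (v |: S) (place f v z) = unused S f :\ z.
  by apply: unused_place => //; apply: (child_outer grS vC).
have degv : degree e v <= 1.
  have := in_set0 v; rewrite -(br r ro) inE vC /=.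
  by move/negbT; rewrite -leqNgt.
have vC0 : children (v |: S) v = set0.
  apply/eqP; rewrite -cards_eq0 -leqn0 -ltnS.
  by rewrite (card_children_new tree_e grS rS vC).
have outerE u : (u \in outer (v |: S)) = (u == v) || (u \in outer S).
  exact: outer_attach grS rS vC.
split.
- exact: (grown_attach grS rS vC).
- exact: (embeds_place tree_e grS rS vC zU em).
- move=> b; rewrite outerE => /orP[/eqP->|bo].
    by apply/setP=> u; rewrite inE vC0 !inE.
  apply/eqP; rewrite -subset0 -(br b bo); apply/subsetP=> u; rewrite /branching in_set.
  by case/andP=> /(subsetP (children_sub _ _ _)) uC du; rewrite in_set uC.
- move=> b; rewrite outerE U' => /orP[/eqP->|bo].
    by rewrite fv vC0 cards0 addn0; apply: leq_trans nz _.
  rewrite fo //.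
  have leC := subset_leq_card (children_sub S v b).
  have ldb := ld b bo.
  have [ba|ba] := eqVneq b a0; last first.
    by apply: leq_trans ldb; apply: leq_add (d_other b bo ba) leC.
  rewrite -ba in d_a0 *; case: d_a0 => [le_d|[br' le_d]|[_ idle le_d]].
  + by apply: leq_trans ldb; apply: leq_add.
  + have := card_children_parent vC; rewrite -br' => eqC.
    by apply: leq_trans ldb; rewrite eqC addnS -addSn leq_add2r.
  rewrite (eqP (negPn idle)) in ldb leC *; rewrite cards0 in leC.
  by have := ld r ro; move: le_d leC; clear; lia.
rewrite U'; split=> // b u w; rewrite outerE => /orP[/eqP->|bo].
  by rewrite vC0 eqxx.
move=> Cb uU wU uw uwB; rewrite fo //; apply: common uwB => //.
by apply: contra Cb => /eqP C0; rewrite -subset0 -C0 children_sub.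
Qed.

Lemma dirty_idP U B (t : {set W}) :
  reflect (exists u w : W, [/\ u \in U, w \in U, w != u & t = [set u; w] /\ t \in B])
          (t \in dirty U id B).
Proof.
apply: (iffP (dirtyP _ _ _ _)).
  by case=> u [w [uU wU wu _ tE]]; exists u, w.
by case=> u [w [uU wU wu tE]]; exists u, w.
Qed.

Lemma nb_unused S f B b p q z : b \in outer S -> p \in unused S f -> q \in unused S f ->
  #|nb (f b) (unused S f :\ z) ([set p; q] |: B)| <= #|nb (f b) (unused S f) B|.
Proof.
move=> bo pU qU; have fb := outer_used f bo.
rewrite -(@nb_add _ (f b) (unused S f) B p q).
  by apply: nb_le; apply: subsetDl.
move=> w _; apply: contra fb => /eqP/eqP/eq_set2P[[-> _]|[-> _]] //.
Qed.

(** An edge [pq] in the unused part is answered by embedding a leaf at [p] or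
    [q].  This fails only if all vertices that wait for children are joined to
    both; then the edge may stay, and any reply is good. *)
Lemma only_leaves_win n S f M B :
  #|~: S| = n -> only_leaves S f M B -> win G (n + (size ip).+2) M B.
Proof.
elim: n S f M B => [|n IHn] S f M B cS ol.
  by apply: finish_win ol; apply/eqP; rewrite -subTset -setCS setCT subset0 -cards_eq0 cS.
have [grS em br ld [common cD]] := ol; set U := unused S f in ld common cD.
apply: win_round => p q pq; set B1 := _ |: B.
have inB (u w : W) : [set u; w] \in B1 -> [set u; w] != [set p; q] -> [set u; w] \in B.
  by rewrite in_setU1 => /orP[->//|].
have roomU : K.+2 < #|U| by apply: room grS em.
have [r0 r0o C0] : exists2 r, r \in outer S & children S r != set0.
  have [|a [v [aS aI vC]]] := open_exists tree_e bare grS.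
    by apply/eqP=> ST; move: cS; rewrite ST setCT cards0.
  by exists a; [rewrite inE aI | apply/set0Pn; exists v].
have serve r z : r \in outer S -> children S r != set0 -> z \in U ->
    z \notin nb (f r) U B1 -> eases S f B B1 (fun a => children S a != set0) r z ->
    #|nb z (U :\ z) B1| <= 1 ->
    (forall a (u w : W), a \in outer S -> children S a != set0 ->
         u \in U :\ z -> w \in U :\ z -> u != w -> [set u; w] \in B1 ->
         u \in nb (f a) (U :\ z) B1) ->
    #|dirty (U :\ z) id B1| <= K ^ 2 ->
    exists s t : W, [/\ s != t, [set s; t] \notin B1
                      & win G (n + (size ip).+2) ([set s; t] |: M) B1].
  move=> ro /set0Pn[v vC] zU zN ea nz com cD1.
  have vS : v \notin S by move: vC; rewrite !inE => /andP[].
  apply: (attach_round ro zU zN); apply: (IHn (v |: S) (place f v z)).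
    by move: cS; rewrite (card_compl_attach vS) => -[].
  exact: only_leaves_attach ol ro vC zU ea nz com cD1.
(* Replies that leave no new edge in [U]. *)
have quiet r z : r \in outer S -> children S r != set0 -> z \in U ->
    z \notin nb (f r) U B1 -> z \notin nb (f r) U B ->
    eases S f B B1 (fun a => children S a != set0) r z ->
    [\/ p \notin U, q \notin U | z \in [set p; q]] ->
    exists s t : W, [/\ s != t, [set s; t] \notin B1
                      & win G (n + (size ip).+2) ([set s; t] |: M) B1].
  move=> ro Cr zU zN1 zN ea out.
  have ne (u w : W) : u \in U :\ z -> w \in U :\ z -> [set u; w] != [set p; q].
    rewrite !in_setD1 => /andP[uz uU] /andP[wz wU]; apply/eqP=> eq_pq.
    have pE : p \in [set u; w] by rewrite eq_pq set21.
    have qE : q \in [set u; w] by rewrite eq_pq set22.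
    case: out => [pU|qU|].
    - by move: pE pU => /set2P[]->; rewrite ?uU ?wU.
    - by move: qE qU => /set2P[]->; rewrite ?uU ?wU.
    by rewrite -eq_pq => /set2P[]eq_z; rewrite eq_z eqxx in uz wz.
  have sB (u w : W) : u \in U :\ z -> w \in U :\ z -> [set u; w] \in B1 -> [set u; w] \in B.
    by move=> uU wU uwB; apply: inB => //; apply: ne.
  apply: (serve r z) => //.
  - have /subset_leq_card : nb z (U :\ z) B1 \subset [set w | [set z; w] == [set p; q]].
      apply/subsetP=> w; rewrite /nb in_set => /andP[]; rewrite in_setD1 in_setU1.
      move=> /andP[wz wU] zwB1; rewrite in_set; case/orP: zwB1 => // zwB.
      by case/negP: zN; apply: (common r z w) => //; rewrite eq_sym.
    move/leq_trans; apply; apply: leq_trans (_ : #|[set (if z == p then q else p)]| <= 1); last first.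
      by rewrite cards1.
    apply/subset_leq_card/subsetP=> w; rewrite !inE => /eq_set2P[[-> ->]|[-> ->]].
      by rewrite eqxx.
    by rewrite [q == p]eq_sym (negbTE pq) eqxx.
  - move=> a u w ao Ca uU wU uw uwB; have := common a u w ao Ca.
    have uU0 := subsetP (subsetDl _ _) u uU; have wU0 := subsetP (subsetDl _ _) w wU.
    move=> /(_ uU0 wU0 uw (sB u w uU wU uwB)); rewrite [u \in nb _ _ B]inE => /andP[_ auB].
    by rewrite inE uU in_setU1 auB orbT.
  apply: leq_trans cD; apply/subset_leq_card/subsetP=> t /dirty_idP[u [w [uU wU wu [tE tB]]]].
  apply/dirty_idP; exists u, w; split=> //.
  - exact: (subsetP (subsetDl _ _) u uU).
  - exact: (subsetP (subsetDl _ _) w wU).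
  by split=> //; rewrite tE; apply: sB => //; rewrite -tE.
have ld0 a : a \in outer S -> #|nb (f a) U B| <= K.
  by move=> ao; apply: leq_trans (leq_addr _ _) (ld a ao).
have outside p' q' : [set p'; q'] = [set p; q] -> p' \notin U ->
    exists s t : W, [/\ s != t, [set s; t] \notin B1
                      & win G (n + (size ip).+2) ([set s; t] |: M) B1].
  move=> eq_pq p'U.
  have [|r [z [a0 [ro Cr zU zN1 [zN d_other d_a0]]]]] := @outer_reply V W e ip S f M B p' q'
    (fun a => children S a != set0) K em p'U ld0 (ltnW roomU).
    by exists r0.
  rewrite -/U eq_pq -/B1 in zN1 d_other d_a0.
  apply: (quiet r z) => //; first by exists a0.
  move: (set21 p' q'); rewrite eq_pq => /set2P[] eq_p'.
    by constructor 1; rewrite -eq_p'.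
  by constructor 2; rewrite -eq_p'.
have [pU|pU] := boolP (p \in U); last exact: outside.
have [qU|qU] := boolP (q \in U); last by apply: (outside q p) => //; rewrite setUC.
have nbE b : b \in outer S -> nb (f b) U B1 = nb (f b) U B.
  move=> bo; have fb := outer_used f bo; apply: nb_add => w _.
  by apply: contra fb => /eq_set2P[[-> _]|[-> _]].
have ease r z : eases S f B B1 (fun a => children S a != set0) r z.
  by exists r0; split=> [b bo _|]; [apply: nb_unused|constructor 1; apply: nb_unused].
have [/existsP[r /and3P[ro Cr]]|blocked] := boolP [exists r, [&& r \in outer S,
    children S r != set0 & (p \notin nb (f r) U B) || (q \notin nb (f r) U B)]].
  case/orP=> zN; [apply: (quiet r p) | apply: (quiet r q)]; rewrite ?nbE //.
    by constructor 3; rewrite set21.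
  by constructor 3; rewrite set22.
have both r : r \in outer S -> children S r != set0 ->
    p \in nb (f r) U B /\ q \in nb (f r) U B.
  move=> ro Cr; move: blocked; rewrite negb_exists => /forallP/(_ r).
  by rewrite ro Cr /= negb_or !negbK => /andP.
have [z zU zN] := @nb_pick _ (f r0) U B (leq_ltn_trans (ld0 r0 r0o) (ltnW (ltnW roomU))).
have [pN qN] := both r0 r0o C0.
have zp : z != p by apply: contra zN => /eqP->.
have zq : z != q by apply: contra zN => /eqP->.
have common1 a (u w : W) : a \in outer S -> children S a != set0 -> u \in U -> w \in U ->
    u != w -> [set u; w] \in B1 -> u \in nb (f a) U B.
  move=> ao Ca uU wU uw; rewrite in_setU1 => /orP[/eq_set2P|]; last exact: common.
  by have [pa qa] := both a ao Ca; case=> -[-> _].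
apply: (serve r0 z); rewrite ?nbE //.
- rewrite (_ : nb _ _ _ = set0) ?cards0 //; apply/setP=> w; rewrite [RHS]inE.
  apply/negbTE; rewrite inE in_setD1; apply/negP=> /andP[/andP[wz wU] zwB].
  by case/negP: zN; apply: (common1 r0 z w) => //; rewrite eq_sym.
- move=> a u w ao Ca uU wU uw uwB.
  have uU0 := subsetP (subsetDl _ _) u uU; have wU0 := subsetP (subsetDl _ _) w wU.
  have := common1 a u w ao Ca uU0 wU0 uw uwB; rewrite inE => /andP[_ auB].
  by rewrite inE uU in_setU1 auB orbT.
pose N := nb (f r0) U B.
apply: leq_trans (_ : #|[set [set t.1; t.2] | t in setX N N]| <= _); last first.
  by apply: leq_trans (leq_imset_card _ _) _; rewrite cardsX -mulnn leq_mul // ld0.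
apply/subset_leq_card/subsetP=> t /dirty_idP[u [w [uU wU wu [tE tB]]]].
have uU0 := subsetP (subsetDl _ _) u uU; have wU0 := subsetP (subsetDl _ _) w wU.
rewrite tE in tB *; apply/imsetP; exists (u, w) => //; rewrite in_setX /=.
apply/andP; split; first by apply: (common1 r0 u w) => //; rewrite eq_sym.
by apply: (common1 r0 w u) => //; rewrite setUC.
Qed.

(** * Embedding the other vertices *)

Hypothesis deg_e : forall v, degree e v <= Delta.

Definition calm S f B : {set V} :=
  [set a in outer S | (children S a != set0) && (#|nb (f a) (unused S f) B| <= 1)].

(** Calm vertices act as a reserve: an edge [pq] in the unused part with both
    ends adjacent to all vertices that wait for branching children is removed
    by embedding a leaf below a calm vertex, whose load is too small to block
    both [p] and [q].  Such a move may use up a calm vertex, but it takes away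
    a neighbour from each vertex that waits for branching children.  A load
    grows only together with the embedding of a branching child, and this child
    is calm when it is embedded.  Hence loads exceed the size of the reserve by
    at most 1. *)
Definition growing S f M B : Prop :=
  [/\ grown S, embeds S f M,
      forall u w : W, u \in unused S f -> w \in unused S f -> u != w -> [set u; w] \notin B,
      forall a, a \in outer S -> #|nb (f a) (unused S f) B| + #|branching S a| <= Delta.+1
    & forall a, a \in outer S -> branching S a != set0 ->
        0 < #|calm S f B| /\ #|nb (f a) (unused S f) B| <= #|calm S f B|.+1].

Lemma branching_sub S v b : branching (v |: S) b \subset branching S b.
Proof.
apply/subsetP=> u; rewrite /branching in_set => /andP[uC du].
by rewrite in_set du andbT; apply: (subsetP (children_sub S v b)).
Qed.

Lemma branching_children S b : branching S b \subset children S b.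
Proof. by apply/subsetP=> u; rewrite in_set => /andP[]. Qed.

Lemma branching_child S a v : v \in branching S a -> v \in children S a /\ 1 < degree e v.
Proof. by rewrite in_set => /andP[]. Qed.

Lemma subset_neq0 (T : finType) (X Y : {set T}) : X \subset Y -> X != set0 -> Y != set0.
Proof. by move=> sXY; apply: contra => /eqP Y0; rewrite -subset0 -Y0. Qed.

(** When a branching child of [r] is embedded, the reserve loses at most one
    vertex, namely [r] or the vertex [a0] whose load may have grown, and gains the
    child. *)
Lemma growing_attach S f M B B1 r v z :
    growing S f M B -> r \in outer S -> v \in branching S r -> z \in unused S f ->
    eases S f B B1 (fun a => branching S a != set0) r z ->
    #|nb z (unused S f :\ z) B1| <= 1 ->
    (forall u w : W, u \in unused S f :\ z -> w \in unused S f :\ z -> u != w ->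
       [set u; w] \notin B1) ->
  growing (v |: S) (place f v z) ([set f r; z] |: M) B1.
Proof.
move=> [grS em _ ld res] ro vB zU [a0 [d_other d_a0]] nz empty.
have rS : r \in S by move: ro; rewrite inE => /andP[].
have [vC dv] := branching_child vB.
have vS : v \notin S by move: vC; rewrite !inE => /andP[].
have fv : place f v z v = z by rewrite /place eqxx.
have fo b : b \in outer S -> place f v z b = f b.
  by rewrite inE => /andP[_ bS]; apply: place_old vS bS.
have U' : unused (v |: S) (place f v z) = unused S f :\ z.
  by apply: unused_place => //; apply: (child_outer grS vC).
have outerE u : (u \in outer (v |: S)) = (u == v) || (u \in outer S).
  exact: outer_attach grS rS vC.
have cCv : #|children (v |: S) v|.+1 = degree e v.
  exact: (card_children_new tree_e grS rS vC).
set C := calm S f B; set C' := calm (v |: S) (place f v z) B1.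
have vC' : v \in C'.
  by rewrite inE outerE eqxx fv U' nz andbT -card_gt0 -ltnS cCv.
have keep b : b \in C -> b != r -> #|nb (f b) (unused S f :\ z) B1| <= 1 -> b \in C'.
  rewrite inE => /and3P[bo bC _] br d1.
  have bS : b \in S by move: bo; rewrite inE => /andP[].
  by rewrite inE outerE bo orbT fo // U' d1 (children_other tree_e grS rS vC) // bC.
have vNC : v \notin C by rewrite inE in_setD (negbTE vS) andbF.
pose d0 b := #|nb (f b) (unused S f) B|; pose l := if d0 r <= 1 then r else a0.
have d0C b : b \in C -> d0 b <= 1 by rewrite inE => /and3P[].
have sub : v |: C :\ l \subset C'.
  rewrite subUset sub1set vC'; apply/subsetP=> b; rewrite in_setD1 => /andP[bl bC].
  have d0b := d0C b bC; move: bl; rewrite /l; case: ifPn => [r1 br|r2 ba].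
    apply: keep => //; have [ba|ba] := eqVneq b a0; last first.
      apply: leq_trans d0b; apply: d_other => //.
      by move: bC; rewrite inE => /andP[].
    rewrite ba in d0b br *; case: d_a0 => [le|[ar _]|[_ _ le]].
    - exact: leq_trans le d0b.
    - by rewrite ar eqxx in br.
    exact: leq_trans le r1.
  apply: keep => //; first by apply: contra r2 => /eqP<-.
  apply: leq_trans d0b; apply: d_other => //.
  by move: bC; rewrite inE => /andP[].
have leC : #|C :\ l|.+1 <= #|C'|.
  by have := subset_leq_card sub; rewrite cardsU1 in_setD1 (negbTE vNC) andbF.
have leCC : #|C| <= #|C'|.
  by apply: leq_trans leC; rewrite (cardsD1 l C); case: (_ \in _).
split.
- exact: (grown_attach grS rS vC).
- exact: (embeds_place tree_e grS rS vC zU em).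
- by rewrite U'.
- move=> b; rewrite outerE U' => /orP[/eqP->|bo].
    rewrite fv; have := subset_leq_card (branching_children (v |: S) v).
    by have := deg_e v; move: nz cCv; clear; lia.
  rewrite fo //.
  have leB := subset_leq_card (branching_sub S v b).
  have ldb := ld b bo.
  have [ba|ba] := eqVneq b a0; last first.
    by apply: leq_trans ldb; apply: leq_add (d_other b bo ba) leB.
  rewrite -ba in d_a0 *; case: d_a0 => [le_d|[br' le_d]|[_ idle le_d]].
  + by apply: leq_trans ldb; apply: leq_add.
  + have := branching_parent e S r v; rewrite -br' => eqB.
    have := cardsD1 v (branching S b); rewrite -eqB br' vB => cB.
    by move: ldb le_d cB; rewrite br'; clear; lia.
  rewrite (eqP (negPn idle)) in ldb leB *; rewrite cards0 in leB.
  by have := ld r ro; move: le_d leB; clear; lia.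
move=> b; rewrite outerE U' => /orP[/eqP->|bo].
  rewrite fv => _; split; last exact: leq_trans nz _.
  by apply/card_gt0P; exists v.
move=> /(subset_neq0 (branching_sub S v b)) Bb; split; first by apply/card_gt0P; exists v.
have [C0 le0] := res b bo Bb; rewrite fo // -/C -/(d0 b) in C0 le0 *.
have [ba|ba] := eqVneq b a0; last first.
  by apply: leq_trans (d_other b bo ba) _; apply: leq_trans le0 _; rewrite ltnS.
rewrite ba in bo Bb le0 *; case: d_a0 => [le|[ar le]|[_ idle _]].
- by apply: leq_trans le _; apply: leq_trans le0 _; rewrite ltnS.
- apply: leq_trans le _; rewrite ltnS -/(d0 a0).
  have [d1|d2] := leqP (d0 r) 1; first by rewrite ar; apply: leq_trans d1 (leq_trans C0 leCC).
  have lr : l = r by rewrite /l ar; case: ifP.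
  apply: leq_trans le0 _; apply: leq_trans leC; rewrite ltnS lr.
  rewrite (cardsD1 r C); case: (boolP (r \in C)) => // /d0C.
  by rewrite leqNgt d2.
by rewrite Bb in idle.
Qed.

(** The leaf below [g] may cost the calm vertex [g]; the strict decrease of the
    loads that matter makes up for this. *)
Lemma calm_attach S f M B B1 g v z :
    growing S f M B -> g \in calm S f B -> branching S g = set0 ->
    v \in children S g -> z \in unused S f ->
    (forall b, b \in outer S ->
       #|nb (f b) (unused S f :\ z) B1| <= #|nb (f b) (unused S f) B|) ->
    (forall b, b \in outer S -> branching S b != set0 ->
       #|nb (f b) (unused S f :\ z) B1| < #|nb (f b) (unused S f) B|) ->
    #|nb z (unused S f :\ z) B1| <= 1 ->
    (forall u w : W, u \in unused S f :\ z -> w \in unused S f :\ z -> u != w ->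
       [set u; w] \notin B1) ->
  growing (v |: S) (place f v z) ([set f g; z] |: M) B1.
Proof.
move=> [grS em _ ld res] gC Bg vC zU le lt nz empty.
have go : g \in outer S by move: gC; rewrite inE => /andP[].
have gS : g \in S by move: go; rewrite inE => /andP[].
have vS : v \notin S by move: vC; rewrite !inE => /andP[].
have fv : place f v z v = z by rewrite /place eqxx.
have fo b : b \in outer S -> place f v z b = f b.
  by rewrite inE => /andP[_ bS]; apply: place_old vS bS.
have U' : unused (v |: S) (place f v z) = unused S f :\ z.
  by apply: unused_place => //; apply: (child_outer grS vC).
have outerE u : (u \in outer (v |: S)) = (u == v) || (u \in outer S).
  exact: outer_attach grS gS vC.
have degv : degree e v <= 1.
  have := in_set0 v; rewrite -Bg inE vC /=.
  by move/negbT; rewrite -leqNgt.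
have Bv : branching (v |: S) v = set0.
  apply/eqP; rewrite -subset0; apply: subset_trans (branching_children _ _) _.
  rewrite subset0 -cards_eq0 -leqn0 -ltnS.
  by rewrite (card_children_new tree_e grS gS vC).
set C := calm S f B; set C' := calm (v |: S) (place f v z) B1.
have sub : C :\ g \subset C'.
  apply/subsetP=> b; rewrite in_setD1 [b \in C]inE => /and4P[bg bo bC b1].
  have bS : b \in S by move: bo; rewrite inE => /andP[].
  rewrite inE outerE bo orbT fo // U' (children_other tree_e grS gS vC) // bC.
  exact: leq_trans (le b bo) b1.
have leC : #|C| <= #|C'|.+1.
  by rewrite (cardsD1 g C) gC ltnS; apply: subset_leq_card.
split.
- exact: (grown_attach grS gS vC).
- exact: (embeds_place tree_e grS gS vC zU em).
- by rewrite U'.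
- move=> b; rewrite outerE U' => /orP[/eqP->|bo].
    by rewrite fv Bv cards0 addn0; apply: leq_trans nz _.
  rewrite fo //; apply: leq_trans (ld b bo).
  by apply: leq_add (le b bo) _; apply: subset_leq_card (branching_sub _ _ _).
move=> b; rewrite outerE U' => /orP[/eqP->|bo]; first by rewrite Bv eqxx.
move=> B'b; have Bb := subset_neq0 (branching_sub S v b) B'b.
have [C0 le0] := res b bo Bb; have lt0 := lt b bo Bb; rewrite fo // -/C in C0 le0 *.
split; last by apply: leq_trans leC; rewrite -ltnS; apply: leq_trans lt0 le0.
rewrite lt0n; apply/eqP=> C'0.
have : b \in C'; last by rewrite /C' (cards0_eq C'0) inE.
rewrite inE outerE bo orbT fo // U' (subset_neq0 (branching_children _ _) B'b).
rewrite C'0 in leC; rewrite -ltnS.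
by apply: leq_trans lt0 (leq_trans le0 _); rewrite ltnS.
Qed.

Lemma growing_leaves S f M B :
    growing S f M B -> ~~ [exists r, (r \in outer S) && (branching S r != set0)] ->
  only_leaves S f M B.
Proof.
move=> [grS em empty ld _] /existsPn leafy.
have br a : a \in outer S -> branching S a = set0.
  by move=> ao; have := leafy a; rewrite ao negbK => /eqP.
have nodirt : dirty (unused S f) id B = set0.
  apply/setP=> t; rewrite [RHS]inE; apply/negbTE/negP => /dirty_idP[u [w [uU wU wu [tE tB]]]].
  by have := empty u w uU wU; rewrite eq_sym wu -tE tB => /(_ isT).
have sub a : #|children S a| <= Delta.
  apply: leq_trans (deg_e a); apply/subset_leq_card/subsetP=> u.
  by rewrite !inE => /andP[].
split=> //; first by move=> a ao; have := ld a ao; have := sub a;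
  rewrite br // cards0 /load_bound; clear; lia.
split; last by rewrite nodirt cards0.
by move=> a u w _ _ uU wU uw uwB; have := empty u w uU wU uw; rewrite uwB.
Qed.

Lemma growing_win n S f M B :
  #|~: S| = n -> growing S f M B -> win G (n + (size ip).+2) M B.
Proof.
elim: n S f M B => [|n IHn] S f M B cS gr; have [grS em empty ld res] := gr;
  set U := unused S f in empty ld;
  have [/existsP[r0 /andP[r0o B0]]|leafy] :=
    boolP [exists r, (r \in outer S) && (branching S r != set0)].
- have /set0Pn[v vB] := B0; have [vC _] := branching_child vB.
  have : v \in ~: S by move: vC; rewrite !inE => /andP[->].
  by rewrite (cards0_eq cS) inE.
- exact: (only_leaves_win cS (growing_leaves gr leafy)).
- apply: win_round => p q pq; set B1 := _ |: B.
  have inB (u w : W) : [set u; w] \in B1 -> [set u; w] != [set p; q] -> [set u; w] \in B.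
    by rewrite in_setU1 => /orP[->//|].
  have roomU : K.+2 < #|U| by apply: room grS em.
  have ld0 a : a \in outer S -> #|nb (f a) U B| <= K.
    move=> ao; apply: leq_trans (leq_addr _ _) (leq_trans (ld a ao) _).
    by rewrite /load_bound; clear; lia.
  have emptyB1 z : [\/ p \notin U, q \notin U | z \in [set p; q]] ->
      forall u w : W, u \in U :\ z -> w \in U :\ z -> u != w -> [set u; w] \notin B1.
    move=> out u w; rewrite !in_setD1 => /andP[uz uU] /andP[wz wU] uw.
    have neB := empty u w uU wU uw; rewrite in_setU1 negb_or neB andbT.
    apply/eqP=> eq_pq; have pE : p \in [set u; w] by rewrite eq_pq set21.
    have qE : q \in [set u; w] by rewrite eq_pq set22.
    case: out => [pU|qU|].
    - by move: pE pU => /set2P[]->; rewrite ?uU ?wU.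
    - by move: qE qU => /set2P[]->; rewrite ?uU ?wU.
    by rewrite -eq_pq => /set2P[]eq_z; rewrite eq_z eqxx in uz wz.
  have nbz z : z \in U -> #|nb z (U :\ z) B1| <= 1.
    move=> zU; apply: leq_trans (_ : #|[set (if z == p then q else p)]| <= 1); last first.
      by rewrite cards1.
    apply/subset_leq_card/subsetP=> w; rewrite /nb in_set => /andP[]; rewrite in_setD1.
    move=> /andP[wz wU] zwB; rewrite in_set1.
    have zwE : [set z; w] == [set p; q].
      by apply: contraTT zwB => ne; apply: contra (empty z w zU wU _) => [/inB/(_ ne)|];
         rewrite // eq_sym.
    case/eq_set2P: zwE => -[-> ->]; first by rewrite eqxx.
    by rewrite [q == p]eq_sym (negbTE pq) eqxx.
  have serve r z : r \in outer S -> branching S r != set0 -> z \in U ->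
      z \notin nb (f r) U B1 -> eases S f B B1 (fun a => branching S a != set0) r z ->
      [\/ p \notin U, q \notin U | z \in [set p; q]] ->
      exists s t : W, [/\ s != t, [set s; t] \notin B1
                        & win G (n + (size ip).+2) ([set s; t] |: M) B1].
    move=> ro /set0Pn[v vB] zU zN ea out; have [vC _] := branching_child vB.
    have vS : v \notin S by move: vC; rewrite !inE => /andP[].
    apply: (attach_round ro zU zN); apply: (IHn (v |: S) (place f v z)).
      by move: cS; rewrite (card_compl_attach vS) => -[].
    exact: growing_attach gr ro vB zU ea (nbz z zU) (emptyB1 z out).
  have outside p' q' : [set p'; q'] = [set p; q] -> p' \notin U ->
      exists s t : W, [/\ s != t, [set s; t] \notin B1
                        & win G (n + (size ip).+2) ([set s; t] |: M) B1].
    move=> eq_pq p'U.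
    have [|r [z [a0 [ro Br zU zN1 [zN d_other d_a0]]]]] := @outer_reply V W e ip S f M B p' q'
      (fun a => branching S a != set0) K em p'U ld0 (ltnW roomU).
      by exists r0.
    rewrite -/U eq_pq -/B1 in zN1 d_other d_a0.
    apply: (serve r z) => //; first by exists a0.
    move: (set21 p' q'); rewrite eq_pq => /set2P[] eq_p'.
      by constructor 1; rewrite -eq_p'.
    by constructor 2; rewrite -eq_p'.
  have [pU|pU] := boolP (p \in U); last exact: outside.
  have [qU|qU] := boolP (q \in U); last by apply: (outside q p) => //; rewrite setUC.
  have nbE b : b \in outer S -> nb (f b) U B1 = nb (f b) U B.
    move=> bo; have fb := outer_used f bo; apply: nb_add => w _.
    by apply: contra fb => /eq_set2P[[-> _]|[-> _]].
  have ease r z : eases S f B B1 (fun a => branching S a != set0) r z.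
    by exists r0; split=> [b bo _|]; [apply: nb_unused|constructor 1; apply: nb_unused].
  have [/existsP[r /and3P[ro Br]]|blocked] := boolP [exists r, [&& r \in outer S,
      branching S r != set0 & (p \notin nb (f r) U B) || (q \notin nb (f r) U B)]].
    case/orP=> zN; [apply: (serve r p) | apply: (serve r q)]; rewrite ?nbE //.
      by constructor 3; rewrite set21.
    by constructor 3; rewrite set22.
  have both r : r \in outer S -> branching S r != set0 ->
      p \in nb (f r) U B /\ q \in nb (f r) U B.
    move=> ro Br; move: blocked; rewrite negb_exists => /forallP/(_ r).
    by rewrite ro Br /= negb_or !negbK => /andP.
  have [/card_gt0P[g gC] _] := res r0 r0o B0.
  have := gC; rewrite inE => /and3P[go Cg g1].
  have [z zpq zN] : exists2 z, z \in [set p; q] & z \notin nb (f g) U B.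
    apply/subsetPn; apply: contraTN g1 => /subset_leq_card.
    by rewrite cards2 pq -ltnNge.
  have zU : z \in U by case/set2P: zpq => ->.
  have Bg : branching S g = set0.
    apply: contraNeq zN => Bg; have [pN qN] := both g go Bg.
    by case/set2P: zpq => ->.
  have /set0Pn[v vC] := Cg.
  have vS : v \notin S by move: vC; rewrite !inE => /andP[].
  apply: (attach_round go zU); first by rewrite nbE.
  apply: (IHn (v |: S) (place f v z)).
    by move: cS; rewrite (card_compl_attach vS) => -[].
  apply: (calm_attach gr gC Bg vC zU _ _ (nbz z zU) (emptyB1 z _)).
  - by move=> b bo; apply: nb_unused.
  - move=> b bo Bb; rewrite [in X in _ < X](cardsD1 z).
    have -> : z \in nb (f b) U B by have [pN qN] := both b bo Bb; case/set2P: zpq => ->.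
    rewrite add1n ltnS; apply/subset_leq_card/subsetP=> w.
    rewrite /nb in_set => /andP[wU wB]; rewrite in_setD1 in_set.
    move: wU; rewrite in_setD1 => /andP[-> wU]; rewrite wU.
    have : w \in nb (f b) U B1 by rewrite in_set wU.
    by rewrite nbE // in_set => /andP[].
  by constructor 3.
exact: (only_leaves_win cS (growing_leaves gr leafy)).
Qed.

End SpanningTree.

(** * From Hamilton paths to copies of the tree *)

Section Copies.

Variables (n : nat) (V : finType) (e : rel V) (x y : V) (ip : seq V).
Hypotheses (tree_e : tree e) (cV : #|V| = n).
Hypothesis (bare : bare_path e x (rcons ip y)).
Implicit Types (f : V -> 'I_n) (M : {set {set 'I_n}}).

Let sym_e : symmetric e. Proof. by case: tree_e => -[]. Qed.
Let irr_e : irreflexive e. Proof. by case: tree_e => -[]. Qed.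
Let cVn : #|V| = #|'I_n|. Proof. by rewrite card_ord. Qed.

Definition contains_copy M : Prop :=
  exists2 f, injective f & forall u v, e u v -> [set f u; f v] \in M.

(** The inner vertices of the bare path are placed along [s].  All edges at them
    belong to the bare path, because they have degree 2. *)
Lemma hamilton_copy f M M' (s : seq 'I_n) :
    embeds e ip setT f M -> M \subset M' -> uniq s -> s =i unused ip setT f ->
    path [rel u v | [set u; v] \in M'] (f x) (rcons s (f y)) ->
  contains_copy M'.
Proof.
move=> em sMM' Us sU pth; have [inj edg] := em; have [_ Usp _] := bare.
have Uip : uniq ip by move: Usp; rewrite /= rcons_uniq => /and3P[].
have [xip yip] : x \notin ip /\ y \notin ip.
  by move: Usp; rewrite /= rcons_uniq mem_rcons inE negb_or => /andP[/andP[_ ->] /andP[->]].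
have gr : grown e x y ip setT.
  have [? con] := grown_spine bare; split; first exact: subsetT.
  have [_ [_ con0] _] := tree_e => a _; apply: connect_sub (con0 x a) => u v uv.
  by apply: connect1; rewrite /within /= uv !inE.
have sz : size s = size ip.
  rewrite -(card_uniqP Us) (eq_card sU) (card_unused bare cVn gr em).
  by rewrite setCT cards0.
pose g u := if u \in ip then nth (f x) s (index u ip) else f u.
have gs : map g ip = s.
  apply: (@eq_from_nth _ (f x)) => [|i]; rewrite size_map // => li.
  by rewrite (nth_map x) // /g mem_nth // index_uniq.
have gin u : u \in ip -> g u \in s.
  by move=> uip; rewrite /g uip mem_nth // sz index_mem.
have gN u : u \notin ip -> g u = f u by rewrite /g => /negbTE->.
have fN u : u \notin ip -> f u \notin s.
  move=> uip; rewrite sU; apply: outer_used.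
  by rewrite !inE uip.
have link_ip u v : u \in ip -> e u v -> [set g u; g v] \in M'.
  move=> /mem_split[l1 [l2 ipE]] /(inner_nbrs tree_e bare ipE) uv.
  have := pth; rewrite -(gN x xip) -(gN y yip) -gs -map_rcons ipE.
  rewrite rcons_cat map_cat /= cat_path /= last_map => /and3P[_ pu].
  case: uv => ->; first by rewrite setUC pu.
  by case: (l2) => [|w l] /= /andP[].
exists g => [u v|u v uv].
  have [uip|uip] := boolP (u \in ip); have [vip|vip] := boolP (v \in ip).
  - rewrite /g uip vip => /eqP; rewrite nth_uniq ?sz ?index_mem // => /eqP.
    exact: index_inj.
  - by move=> guv; have := gin u uip; rewrite guv gN // (negbTE (fN v vip)).
  - by move=> guv; have := gin v vip; rewrite -guv gN // (negbTE (fN u uip)).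
  by rewrite !gN // => /inj; apply; rewrite !inE ?uip ?vip.
have [uip|uip] := boolP (u \in ip); first exact: link_ip.
have [vip|vip] := boolP (v \in ip); first by rewrite setUC; apply: link_ip; rewrite // sym_e.
by rewrite !gN //; apply: (subsetP sMM'); apply: edg; rewrite ?inE ?uip ?vip.
Qed.

Lemma copy_in_family (M : {set complete_edge n}) :
  contains_copy (val @: M) -> exists2 A, A \in tree_copies e n & A \subset M.
Proof.
case=> f inj edg; exists (copy_edges e [ffun u => f u]).
  apply: imset_f; rewrite inE; apply/injectiveP=> u v.
  by rewrite !ffunE; apply: inj.
apply/subsetP=> a; rewrite inE => /existsP[u /existsP[v /andP[uv /eqP aE]]].
have := edg u v uv; rewrite !ffunE in aE; rewrite -aE => /imsetP[b bM].
by move/val_inj->.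
Qed.

(** At the beginning only the ends of the bare path have images.  They are not
    adjacent, since the path would close to a cycle; so no edge is needed. *)
Lemma growing_spine Delta f :
    injective f -> 0 < size ip -> (forall v, degree e v <= Delta) ->
  growing e x y ip Delta (spine x y ip) f set0 set0.
Proof.
move=> inj ip0 deg_e; have [pth Us deg2] := bare.
have irr := irr_e.
have outer u : u \in spine x y ip :\: inner ip -> u = x \/ u = y.
  rewrite !inE mem_rcons inE => /andP[uip /or3P[/eqP->|/eqP->|]]; [by left|by right|].
  by move=> uip'; rewrite uip' in uip.
have nxy : ~~ e x y.
  apply/negP=> xy; have [_ _ acyc] := tree_e; apply: (acyc (x :: rcons ip y)).
    by rewrite /= size_rcons.
  rewrite /ucycle Us andbT -[cycle _ _]/(path e x (rcons (rcons ip y) x)).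
  by rewrite rcons_path pth last_rcons sym_e.
have nb0 g U : nb g U set0 = set0 by apply/setP=> w; rewrite !inE andbF.
split.
- exact: grown_spine.
- split=> [u v _ _ /inj //|u v].
  by case/outer=> -> /outer[]->; rewrite ?irr // ?(negbTE nxy) // sym_e (negbTE nxy).
- by move=> u w _ _ _; rewrite inE.
- move=> a _; rewrite nb0 cards0; apply: leq_trans (leqW (deg_e a)).
  apply/subset_leq_card/subsetP=> u; rewrite !inE => /andP[/andP[_ ->]] //.
move=> a ao Ba; rewrite nb0 cards0; split=> //; apply/card_gt0P; exists a.
by rewrite inE ao nb0 cards0 (subset_neq0 (branching_children _ _ _) Ba).
Qed.

Lemma card_spine : #|~: spine x y ip| + (size ip).+2 = n.
Proof.
have [_ Us _] := bare; have := cardsC (spine x y ip); rewrite cV.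
by rewrite cardsE (card_uniqP Us) /= size_rcons addnC.
Qed.

Lemma exists_embedding : exists f, injective f.
Proof.
exists (fun v => cast_ord cV (enum_rank v)) => u v /cast_ord_inj/enum_rank_inj //.
Qed.

End Copies.

Theorem theorem1p2 (Delta : nat) (Delta_gt0 : 0 < Delta) :
  exists m1 : nat, exists n1 : nat,
    forall n : nat, n1 <= n ->
    forall (V : finType) (T : rel V),
      tree T -> #|V| = n -> max_degree T <= Delta ->
      has_bare_path T m1 ->
      maker_wins_within (tree_copies T n) n.
Proof.
(* From [n = 5] on, the board has room for [n] moves of each player. *)
exists (path_length (dirt_bound Delta)).+1, 5 => n n5 V T tree_T cV maxT [x [p [bare sz]]].
case/lastP: p => // ip y in bare sz; move: sz; rewrite size_rcons => -[sz].
have deg_T v : degree T v <= Delta by apply: leq_trans maxT; apply: (leq_bigmax v).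
apply: (@win_strategy _ _ (contains_copy T)).
- by rewrite bin2 -divn2 leq_divRL // mulnAC mulnC; apply: leq_mul => //; move: n5; clear; lia.
- exact: copy_in_family.
have [f injf] := exists_embedding cV.
rewrite -[X in win _ X _ _](card_spine cV bare).
have ip0 : 0 < size ip by rewrite sz; apply: leq_trans (path_length_ge _); rewrite addnS.
apply: (growing_win tree_T bare _ sz _ deg_T erefl (growing_spine tree_T bare injf ip0 deg_T)).
  by rewrite card_ord.
by move=> f' M M' s; apply: hamilton_copy.
Qed.
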